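(* Let $d=2$. For every $\mathsf m\in(0,1)$ there exists a constant $c=c(\mathsf m)>0$ such that for all $T,\epsilon$ with $0\leq T\leq c$ and $0\leq\epsilon\leq c$, $$\psi(T,\mathsf m,\epsilon)\;\geq\; \exp\!\Big(\frac{c\,\epsilon^{-4/3}}{\log(1/\epsilon)}\Big),$$ where $\psi(T,\mathsf m,\epsilon)$ is the correlation length of the two-dimensional random field Ising model at temperature $T$ with disorder strength $\epsilon$.
   Context: Lattice: on $\mathbb Z^d$ (here $d=2$), write $u\sim v$ if the $\ell_1$-distance of $u,v$ is $1$. For an integer $N\geq1$, $\Lambda_N=[-N,N]^d\cap\mathbb Z^d$; $o$ is the origin. $\Lambda_N^c=\mathbb Z^d\setminus\Lambda_N$. Disorder: $\{h_v:v\in\mathbb Z^d\}$ are i.i.d. Gaussian random variables with mean $0$ and variance $1$; $\mathbb P,\mathbb E$ denote probability and expectation with respect to $\{h_v\}$. Random field Ising model: for $\epsilon\geq0$ and $\sigma\in\{-1,1\}^{\Lambda_N}$, the Hamiltonian with plus (respectively minus) boundary condition is $$H^{\pm,\Lambda_N,\epsilon h}(\sigma)=-\Big(\sum_{u\sim v,\ u,v\in\Lambda_N}\sigma_u\sigma_v\ \pm\sum_{u\sim v,\ u\in\Lambda_N,\ v\in\Lambda_N^c}\sigma_u+\sum_{u\in\Lambda_N}\epsilon h_u\sigma_u\Big),$$ where the sums over $u\sim v$ count each (unordered) nearest-neighbour edge once. The Gibbs measure at temperature $T$ is the (random) probability measure on $\{-1,1\}^{\Lambda_N}$ $$\mu^{\pm}_{T,\Lambda_N,\epsilon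 h}(\sigma)=\frac{e^{-\frac1T H^{\pm,\Lambda_N,\epsilon h}(\sigma)}}{\sum_{\sigma'\in\{-1,1\}^{\Lambda_N}}e^{-\frac1T H^{\pm,\Lambda_N,\epsilon h}(\sigma')}},$$ understood for $T=0$ as its limit as $T\downarrow0$, i.e. the uniform measure on the minimizers of $H^{\pm,\Lambda_N,\epsilon h}$. Boundary influence: $m_{T,\Lambda_N,\epsilon h}=\mu^+_{T,\Lambda_N,\epsilon h}(\sigma_o=1)-\mu^-_{T,\Lambda_N,\epsilon h}(\sigma_o=1)$. Correlation length: for $\mathsf m\in(0,1)$, $\psi(T,\mathsf m,\epsilon)=\min\{N\geq1:\mathbb E(m_{T,\Lambda_N,\epsilon h})\leq\mathsf m\}$, with $\min\emptyset=+\infty$. For $\epsilon=0$ the right-hand side of the bound is read as $+\infty$. *)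

(* Defs.v *)
From HB Require Import structures.
From mathcomp Require Import all_boot all_order all_algebra finmap zify.
From mathcomp Require Import all_classical all_reals all_analysis.

Set Implicit Arguments.
Unset Strict Implicit.
Unset Printing Implicit Defensive.
Import Order.TTheory GRing.Theory Num.Theory.
Import numFieldNormedType.Exports.
Local Open Scope classical_set_scope.
Local Open Scope ring_scope.

Notation vertex := (int * int)%type.

Definition origin : vertex := (0, 0).

Definition adj (u v : vertex) : bool :=
  (`|u.1 - v.1| + `|u.2 - v.2| == 1)%N.

Definition box (N : nat) : {fset vertex} :=
  [fset ((i%:Z - N%:Z, j%:Z - N%:Z) : vertex)
    | i in iota 0 N.*2.+1, j in iota 0 N.*2.+1]%fset.

Lemma in_box N (v : vertex) :
  (v \in box N) = (`|v.1| <= N)%N && (`|v.2| <= N)%N.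
Proof.
case: v => a b /=; apply/imfset2P/idP => /=.
  case=> i /= hi [j /= hj [-> ->]]; move: hi hj; rewrite !inE !mem_iota.
  by lia.
case/andP => ha hb.
exists `|(a + N%:Z)%R|%N; first by rewrite inE mem_iota; lia.
exists `|(b + N%:Z)%R|%N; first by rewrite inE mem_iota; lia.
by congr (_, _); lia.
Qed.

(* Every neighbour of a vertex of box N lies in box N.+1, so boundary edges
   can be summed over a finite type. *)
Lemma adj_box N (u v : vertex) : u \in box N -> adj u v -> v \in box N.+1.
Proof. by rewrite !in_box /adj; case: u v => [a b] [c e] /=; lia. Qed.

Lemma origin_in_box N : origin \in box N.
Proof. by rewrite in_box. Qed.

Notation config N := {ffun box N -> bool}.

Section RFIM.
Context {R : realType}.

(* The spin values +1 and -1 are encoded by true and false. *)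
Definition spin (b : bool) : R := if b then 1 else -1.

(* The boundary condition is plus if b is true and minus otherwise; eta is the
   external field.  The factor 1/2 compensates for the double sum visiting
   each unordered edge twice. *)
Definition hamiltonian (b : bool) (N : nat) (eta : vertex -> R)
    (s : config N) : R :=
  - (2^-1 * (\sum_(u : box N) \sum_(v : box N | adj (val u) (val v))
               spin (s u) * spin (s v))
     + spin b * (\sum_(u : box N)
         \sum_(v : box N.+1 | (val v \notin box N) && adj (val u) (val v))
               spin (s u))
     + \sum_(u : box N) eta (val u) * spin (s u)).

Definition ground_states (b : bool) (N : nat) (eta : vertex -> R)
    : {set config N} :=
  [set s | [forall t : config N, hamiltonian b eta s <= hamiltonian b eta t]]%SET.

Definition gibbs (temp : R) (b : bool) (N : nat) (eta : vertex -> R)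
    (s : config N) : R :=
  if temp == 0 then
    (s \in ground_states b N eta)%:R / #|ground_states b N eta|%:R
  else
    expR (- temp^-1 * hamiltonian b eta s)
    / \sum_(t : config N) expR (- temp^-1 * hamiltonian b eta t).

Lemma gibbs_cvg0 b N eta (s : config N) :
  gibbs temp b eta s @[temp --> 0^'+] --> gibbs 0 b eta s.
Proof.
pose H := hamiltonian b (N := N) eta.
have [s0 s0min] : exists s0, forall t, H s0 <= H t.
  have [s0 _ hs0] := @arg_minP _ _ _ ([ffun=> true] : config N) xpredT H isT.
  by exists s0 => t; exact: hs0.
have gsE t : (t \in ground_states b N eta) = (H t == H s0).
  rewrite inE; apply/forallP/eqP => [ht|ht t'].
    by apply/eqP; rewrite eq_le s0min andbT; exact: ht.
  by rewrite -/(H t) -/(H t') ht; exact: s0min.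
pose g t (x : R) := expR (- x^-1 * (H t - H s0)).
have g_cvg t : g t x @[x --> 0^'+] --> ((t \in ground_states b N eta)%:R : R).
  rewrite gsE; have [eqt|neq] := eqVneq (H t) (H s0).
    rewrite (_ : g t = fun=> 1); first exact: cvg_cst.
    by apply/funext => x; rewrite /g eqt subrr mulr0 expR0.
  have dpos : 0 < H t - H s0 by rewrite subr_gt0 lt_neqAle eq_sym neq s0min.
  have inv_cvg : x^-1 * (H t - H s0) @[x --> (0:R)^'+] --> +oo.
    apply/cvgryPge => A; have [A0|A0] := leP A 0; near=> x.
      have x0 : 0 < x by near: x; exact: nbhs_right_gt.
      by rewrite (le_trans A0)// mulr_ge0// ?invr_ge0 ltW.
    have x0 : 0 < x by near: x; exact: nbhs_right_gt.
    rewrite mulrC ler_pdivlMr// -ler_pdivlMl// mulrC; near: x.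
    by apply: nbhs_right_le; exact: divr_gt0.
  have := cvg_comp _ _ inv_cvg (@cvgr_expR R).
  by apply: cvg_trans; apply: near_eq_cvg; near=> x; rewrite /g /= mulNr.
have gs0 : (\sum_(t : config N) (t \in ground_states b N eta)%:R : R)
    = #|ground_states b N eta|%:R.
  by rewrite -natr_sum -sum1_card [in RHS]big_mkcond; congr _%:R; apply: eq_bigr => t _; case: ifP.
have cpos : (#|ground_states b N eta|%:R : R) != 0.
  by rewrite pnatr_eq0 -lt0n; apply/card_gt0P; exists s0; rewrite gsE.
rewrite /gibbs eqxx -gs0.
have : g s x / (\sum_(t : config N) g t x) @[x --> (0:R)^'+] -->
    ((s \in ground_states b N eta)%:R
      / \sum_(t : config N) (t \in ground_states b N eta)%:R : R).
  apply: cvgM; first exact: g_cvg.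
  apply: cvgV; first by rewrite gs0.
  by apply: cvg_big => [|t _]; [exact: add_continuous|exact: g_cvg].
apply: cvg_trans; apply: near_eq_cvg; near=> x.
have x0 : x != 0 by rewrite gt_eqF//; near: x; exact: nbhs_right_gt.
rewrite (negbTE x0) /g.
under eq_bigr do rewrite mulrBr expRD.
rewrite mulrBr expRD -mulr_suml -mulf_div.
by rewrite divff ?mulr1// gt_eqF// expR_gt0.
Unshelve. all: by end_near. Qed.

Definition influence (temp : R) (N : nat) (eta : vertex -> R) : R :=
  let o : box N := [` origin_in_box N]%fset in
  \sum_(s : config N | s o) gibbs temp true eta s
  - \sum_(s : config N | s o) gibbs temp false eta s.

Definition min_or_infty (A : set nat) : \bar R :=
  if pselect (exists n, n \in A) is left exA then ((ex_minn exA)%:R)%:E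
  else +oo%E.

Section Disorder.
Context {d : measure_display} {T : measurableType d} (P : probability T R).

Definition mutually_independent (h : vertex -> {RV P >-> R}) : Prop :=
  forall (J : {fset vertex}) (A : vertex -> set R),
    (forall v, measurable (A v)) ->
    P (\bigcap_(v in [set` J]) (h v @^-1` A v)) =
    (\prod_(v <- J) P (h v @^-1` A v))%E.

Definition iid_standard_gaussian (h : vertex -> {RV P >-> R}) : Prop :=
  mutually_independent h /\
  forall v (A : set R), measurable A ->
    distribution P (h v) A = normal_prob 0 1 A.

Definition correlation_length (h : vertex -> {RV P >-> R}) (temp m eps : R)
    : \bar R :=
  min_or_infty [set N : nat | (1 <= N)%N /\
    ('E_P[fun w => influence temp N (fun v => eps * h v w)%R] <= m%:E)%E].

End Disorder.
End RFIM.

(* Main.v *)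
(** Let F be the free energy [T log Z] (minus the ground state energy if
    [T = 0]).  If the spin at the origin disagrees with the boundary condition,
    some closed dual walk of length L around the origin consists of disagreement
    edges; flipping both the spins and the field inside it lowers the energy by
    2L, so the Gibbs weight of such a walk is at most [exp (- L / T)] as soon as
    F(field flipped inside the walk) - F(field) <= L.  A Peierls sum then bounds
    the influence from below on the event where this holds for all walks.

    The increments of F under flips are sub-Gaussian with variance proxy
    eps^2 times the number of flipped sites, and the event is controlled by
    chaining.  A walk padded to length [2^K] is replaced at scale [2^k] by the
    polygon through its points at multiples of [2^k], rounded to a grid of mesh
    about [eps 2^k] so that such a polygon costs an entropy of order
    [2^(K-k) log (1/eps)].  Two consecutive polygons differ by triangles whose
    heights are the second differences of the walk at scale [2^k].  By the
    parallelogram law, the squares of these second differences, divided by the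
    scale, have a sum of order [2^K] over all scales and positions; this
    replaces the factor K that chaining alone would give by [K^(3/4)], which is
    where the exponent 4/3 comes from. *)

(* With r^2 = log (1/eps) and an entropy of order r^2 per step of the polygon, flipping n sites per
   step costs about eps r sqrt n. Where the second differences at scale 2^k are at most 2^k a^2, n
   is of order (2^k a)^2 and each scale costs eps r a per unit of length; the excess is charged to
   the roughness at the total price eps r / a^3. The sum eps r (K a + a^-3) is smallest for a of
   order K^(-1/4), whence K^(3/4). As K is of order log N, the choice a = 8 eps^(1/3) r keeps the
   cost, constants included, below 1/2 as long as log N is at most a small multiple of eps^(-4/3) /
   log (1/eps). The fluctuation bound is proved on a finite product space: the Gaussian law is cut
   into cells and rounded towards 0, which preserves its bound on exponential moments. The bad
   events are then finite unions of cells and tails, hence measurable, although the functional of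
   the field is arbitrary. *)
Require Import Defs.
From HB Require Import structures.
From mathcomp Require Import all_boot all_order all_algebra finmap zify ring lra.
From mathcomp Require Import all_classical all_reals all_analysis.
From mathcomp Require Import measurable_realfun.

Set Implicit Arguments.
Unset Strict Implicit.
Unset Printing Implicit Defensive.
Import Order.TTheory GRing.Theory Num.Theory.
Import numFieldNormedType.Exports.
Local Open Scope classical_set_scope.
Local Open Scope ring_scope.

(** * Lattice points between polygons *)

(* Vertices of Z^2 serve both as primal vertices and as dual ones: the dual
   vertex (a, b) stands for the point (a - 1/2, b - 1/2). [below p q v] says
   that the primal vertex v lies below the line through the dual vertices p and
   q, when p is to the left of q. *)
Definition below (p q v : vertex) : bool :=
  (2 * v.2 + 1 - 2 * p.2) * (q.1 - p.1) < (2 * v.1 + 1 - 2 * p.1) * (q.2 - p.2).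

(** The upward vertical ray from v meets the segment pq. Dual vertices have half-integer abscissas,
    so the ray never passes through an endpoint and no tie has to be broken. *)
Definition under (p q v : vertex) : bool :=
  ((p.1 <= v.1) && (v.1 < q.1) && below p q v)
  || ((q.1 <= v.1) && (v.1 < p.1) && below q p v).

Lemma underC p q v : under p q v = under q p v.
Proof. by rewrite /under orbC. Qed.

Lemma under_vertical p q v : p.1 = q.1 -> under p q v = false.
Proof. by rewrite /under => ->; lia. Qed.

Lemma under_horizontal p q v : p.2 = q.2 -> `|p.1 - q.1| <= 1 ->
  under p q v = (v.2 < p.2) && ((v.1 == p.1) && (q.1 == p.1 + 1)
                                || (v.1 == q.1) && (p.1 == q.1 + 1)).
Proof.
rewrite /under /below => <- h; rewrite !subrr !mulr0.
have [h1|[h1|h1]] : p.1 = q.1 \/ (q.1 = p.1 + 1 \/ p.1 = q.1 + 1) by lia.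
- by rewrite h1; case: ltP; case: leP => //; lia.
- have -> : q.1 - p.1 = 1 by lia.
  have -> : (q.1 <= v.1) && (v.1 < p.1) = false by lia.
  have -> : (p.1 <= v.1) && (v.1 < q.1) = (v.1 == p.1) by lia.
  have -> : p.1 == q.1 + 1 = false by lia.
  rewrite h1 eqxx mulr1 /= !andbF !orbF andbT andbC; congr (_ && _); lia.
- have -> : p.1 - q.1 = 1 by lia.
  have -> : (p.1 <= v.1) && (v.1 < q.1) = false by lia.
  have -> : (q.1 <= v.1) && (v.1 < p.1) = (v.1 == q.1) by lia.
  have -> : q.1 == p.1 + 1 = false by lia.
  rewrite h1 eqxx mulr1 /= !andbF /= andbT andbC; congr (_ && _); lia.
Qed.

(** The interior of the triangle pqr by the parity rule. *)
Definition tri (p q r v : vertex) : bool := under p q v (+) under q r v (+) under p r v.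

(** Twice the signed area of the triangle pqr. *)
Definition cross (p q r : vertex) : int :=
  (q.1 - p.1) * (r.2 - p.2) - (q.2 - p.2) * (r.1 - p.1).

Lemma triC p q r : tri p q r =1 tri q p r.
Proof. by move=> v; rewrite /tri (underC p q) -!addbA [X in _ (+) X]addbC. Qed.

Lemma triAC p q r : tri p q r =1 tri p r q.
Proof. by move=> v; rewrite /tri (underC r q) addbAC [RHS]addbC addbA. Qed.

(** Within a column the heights differ by at most n, so they are told apart by their residues modulo
    n + 1. *)
Lemma size_columns (S : seq vertex) (x0 : int) (w n : nat) : uniq S ->
  (forall v : vertex, v \in S -> x0 <= v.1 < x0 + w%:Z) ->
  (forall v v' : vertex, v \in S -> v' \in S -> v.1 = v'.1 -> `|v.2 - v'.2| <= n%:Z) ->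
  (size S <= w * n.+1)%N.
Proof.
move=> uS hx hy.
pose g (v : vertex) : nat * nat := (`|v.1 - x0|%N, `|(v.2 %% n.+1%:Z)%Z|%N).
have gi : {in S &, injective g}.
  move=> [a b] [c e] ha hc /= [h1 h2].
  have := hx _ ha; have := hx _ hc => /= hc1 ha1.
  have eac : a = c by lia.
  have := hy _ _ ha hc eac => /= hbe.
  congr pair => //.
  have : (b %% n.+1%:Z)%Z = (e %% n.+1%:Z)%Z.
    have := modz_ge0 b (_ : n.+1%:Z != 0); have := modz_ge0 e (_ : n.+1%:Z != 0).
    by move=> /(_ isT) ? /(_ isT) ?; lia.
  move/eqP; rewrite eqz_mod_dvd => /dvdzP [k hk].
  have [k0|[k0|k0]] : k = 0 \/ (k <= -1 \/ 1 <= k) by lia.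
  - by rewrite k0 in hk; lia.
  - by nia.
  - by nia.
rewrite -(size_map g) -[w in (_ <= w * _)%N](size_iota 0) -[n.+1](size_iota 0).
rewrite -(size_allpairs pair); apply: uniq_leq_size; first by rewrite map_inj_in_uniq.
move=> _ /mapP [[a b] vS ->]; apply/allpairsP; exists (g (a, b)); split => //.
- rewrite mem_iota /g /=; have := hx _ vS => /=; lia.
- rewrite mem_iota /g [(a, b).2]/= [(_, _).2]/=.
  have := modz_ge0 b (_ : n.+1%:Z != 0); have := @ltz_pmod b n.+1%:Z.
  by move=> /(_ isT) ? /(_ isT) ?; lia.
Qed.

(** The longest vertical chord of a triangle passes through its middle vertex q, and its length is
    twice the area divided by the width. *)
Lemma tri_column (p q r : vertex) (x y y' : int) : p.1 <= q.1 -> q.1 <= r.1 -> 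
  tri p q r (x, y) -> tri p q r (x, y') ->
  `|y - y'| * (r.1 - p.1) <= `|cross p q r|.
Proof.
move=> pq qr.
have aux (X a w C d : int) : 0 < X -> X < 2 * a -> 0 <= d * w ->
    (d * w) * a <= X * C -> d * w <= 2 * `|C|.
  move=> X0 Xa dw h; have a0 : 0 < a by lia.
  rewrite -(ler_pM2r a0) (le_trans h) //.
  apply: (@le_trans _ _ (X * `|C|)); first by rewrite ler_pM2l // ler_norm.
  by rewrite mulrAC ler_wpM2r // ltW.
(* In doubled coordinates: two lines of slopes s/a and t/w leave a common vertex, and at a
   horizontal distance smaller than a their gap is at most |s - t a / w|. A point lies between them
   when it is below exactly one. *)
have key (X a w s t : int) (Y Y' : int) : 0 < X -> X < 2 * a -> a <= w ->
    (Y * a < X * s) (+) (Y * w < X * t) -> (Y' * a < X * s) (+) (Y' * w < X * t) ->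
    `|Y' - Y| * w <= 2 * `|s * w - t * a|.
  move=> X0 Xa aw; have a0 : 0 < a by lia.
  have w0 : 0 < w by lia.
  have sub u v z z' (h1 : u * a < z) (h2 : z' <= v * w) :
      (u - v) * w * a <= z * w - z' * a.
    have -> : (u - v) * w * a = u * a * w - v * w * a by ring.
    by apply: lerB; rewrite ler_pM2r // ltW.
  have sub2 u v z z' (h1 : u * w < z) (h2 : z' <= v * a) :
      (u - v) * w * a <= z * a - z' * w.
    have -> : (u - v) * w * a = u * w * a - v * a * w by ring.
    by apply: lerB; rewrite ler_pM2r // ltW.
  have fin1 d : 0 <= d -> d * w * a <= X * s * w - X * t * a ->
      d * w <= 2 * `|s * w - t * a|.
    move=> d0 h; apply: (aux X a) => //; first by rewrite mulr_ge0 // ltW.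
    by rewrite mulrBr !mulrA.
  have fin2 d : 0 <= d -> d * w * a <= X * t * a - X * s * w ->
      d * w <= 2 * `|s * w - t * a|.
    move=> d0 h; rewrite distrC; apply: (aux X a) => //; first by rewrite mulr_ge0 // ltW.
    by rewrite mulrBr !mulrA.
  case: ltP => h1; case: ltP => h2 //= _; case: ltP => h3; case: ltP => h4 //= _.
  - have [hY|hY] := leP Y Y'.
      by rewrite ger0_norm ?subr_ge0 //; apply: fin1; rewrite ?subr_ge0 //; exact: sub.
    rewrite distrC ger0_norm ?subr_ge0 ?(ltW hY) //; apply: fin1; rewrite ?subr_ge0 ?(ltW hY) //; exact: sub.
  - have := lt_le_trans h1 h3; have := lt_le_trans h4 h2.
    by rewrite !ltr_pM2r // => A /(lt_trans A); rewrite ltxx.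
  - have := lt_le_trans h2 h4; have := lt_le_trans h3 h1.
    by rewrite !ltr_pM2r // => A /(lt_trans A); rewrite ltxx.
  - have [hY|hY] := leP Y Y'.
      by rewrite ger0_norm ?subr_ge0 //; apply: fin2; rewrite ?subr_ge0 //; exact: sub2.
    rewrite distrC ger0_norm ?subr_ge0 ?(ltW hY) //; apply: fin2; rewrite ?subr_ge0 ?(ltW hY) //; exact: sub2.
rewrite /tri /under /=.
have [hx|hx] := ltP x p.1; first 
  have e1 : (q.1 <= x) = false by apply/negbTE; rewrite -ltNge (lt_le_trans hx).
  have e2 : (r.1 <= x) = false.
    by apply/negbTE; rewrite -ltNge (lt_le_trans hx) // (le_trans pq).
  by rewrite e1 e2.

have [hx2|hx2] := ltP x q.1.
  have xr : x < r.1 by exact: lt_le_trans hx2 qr.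
  have rx : (r.1 <= x) = false by apply/negbTE; rewrite -ltNge.
  rewrite xr rx.
  rewrite /= ?orbF ?andbF ?orbF => h1 h2.
  have := @key (2 * x + 1 - 2 * p.1) (q.1 - p.1) (r.1 - p.1) (q.2 - p.2) (r.2 - p.2)
    (2 * y + 1 - 2 * p.2) (2 * y' + 1 - 2 * p.2).
  move: h1 h2; rewrite /below /= ?addbF => h1 h2 /(_ _ _ _ h1 h2).
  rewrite /cross => H.
  have {}H := H ltac:(lia) ltac:(lia) ltac:(lia).
  have e1 : 2 * y' + 1 - 2 * p.2 - (2 * y + 1 - 2 * p.2) = 2 * (y' - y) by ring.
  rewrite e1 normrM in H; rewrite distrC [X in _ <= X]distrC.
  rewrite [(q.1 - p.1) * _]mulrC; move: H; lia.
have [hx3|hx3] := ltP x r.1; last first.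
  by rewrite !andbF.
rewrite /= ?andbF ?orbF => h1 h2.
(* To the right of q the same estimate applies after a reflection that makes r the common vertex. *)
have := @key (2 * r.1 - 2 * x - 1) (r.1 - q.1) (r.1 - p.1) (q.2 - r.2) (p.2 - r.2)
    (2 * y + 1 - 2 * r.2) (2 * y' + 1 - 2 * r.2).
have b1 z : below q r (x, z) = ((2 * z + 1 - 2 * r.2) * (r.1 - q.1)
    < (2 * r.1 - 2 * x - 1) * (q.2 - r.2)).
  by rewrite /below /= -subr_gt0 -[RHS]subr_gt0; congr (_ < _); ring.
have b2 z : below p r (x, z) = ((2 * z + 1 - 2 * r.2) * (r.1 - p.1)
    < (2 * r.1 - 2 * x - 1) * (p.2 - r.2)).
  by rewrite /below /= -subr_gt0 -[RHS]subr_gt0; congr (_ < _); ring.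
move: h1 h2; rewrite ?addFb !b1 !b2 => h1 h2 /(_ _ _ _ h1 h2) H.
have {}H := H ltac:(lia) ltac:(lia) ltac:(lia).
have e1 : 2 * y' + 1 - 2 * r.2 - (2 * y + 1 - 2 * r.2) = 2 * (y' - y) by ring.
have e2 : (q.2 - r.2) * (r.1 - p.1) - (p.2 - r.2) * (r.1 - q.1) = - cross p q r.
  by rewrite /cross; ring.
rewrite e1 e2 normrM normrN in H; rewrite distrC; move: H; lia.
Qed.

(** There are w columns with at most |cross| / w + 1 points each. The assumption bounds all three
    horizontal differences so that it is symmetric and the vertices can be sorted. *)
Lemma count_tri (S : seq vertex) (p q r : vertex) (W : int) : uniq S -> 
  `|p.1 - q.1| <= W -> `|q.1 - r.1| <= W -> `|p.1 - r.1| <= W ->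
  (count (tri p q r) S)%:Z <= `|cross p q r| + W.
Proof.
move=> uS.
wlog: p q r / p.1 <= q.1 /\ q.1 <= r.1 => [H h1 h2 h3|[pq qr] _ _ hW].
  have cC a b c : `|cross b a c| = `|cross a b c|.
    by rewrite -normrN; congr `|_|; rewrite /cross; ring.
  have cAC a b c : `|cross a c b| = `|cross a b c|.
    by rewrite -normrN; congr `|_|; rewrite /cross; ring.
  have [pq|qp] := leP p.1 q.1; have [qr|rq] := leP q.1 r.1.
  - by apply: H.
  - have [pr|rp] := leP p.1 r.1.
      by rewrite (eq_count (triAC _ _ _)) -cAC; apply: H; lia.
    rewrite (eq_count (triAC _ _ _)) (eq_count (triC _ _ _)) -cAC -cC; apply: H; lia.
  - have [pr|rp] := leP p.1 r.1.
      by rewrite (eq_count (triC _ _ _)) -cC; apply: H; lia.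
    rewrite (eq_count (triC _ _ _)) (eq_count (triAC _ _ _)) -cC -cAC; apply: H; lia.
  - rewrite (eq_count (triC _ _ _)) (eq_count (triAC _ _ _)) (eq_count (triC _ _ _)).
    by rewrite -cC -cAC -cC; apply: H; lia.
have [w0|w0] := eqVneq p.1 r.1.
  rewrite (eq_count (a2 := pred0)) ?count_pred0; first by lia.
  by move=> v; rewrite /tri !under_vertical //; lia.
pose w := `|r.1 - p.1|%N; pose n := (`|cross p q r| %/ w)%N.
have w1 : (0 < w)%N by lia.
have : (size (seq.filter (tri p q r) S) <= w * n.+1)%N.
  apply: (@size_columns _ p.1).
  - exact: filter_uniq.
  - by move=> v; rewrite mem_filter => /andP[+ _]; rewrite /tri /under /w; lia.
  - move=> [x y] [x' y']; rewrite !mem_filter => /andP[hv _] /andP[hv' _] /= ex.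
    rewrite -ex in hv'.
    have := tri_column pq qr hv hv'.
    rewrite /n => H; have : (`|y - y'| * w <= `|cross p q r|)%N by rewrite /w; lia.
    by rewrite -leq_divRL //; lia.
rewrite size_filter mulnS /n mulnC => H.
have := leq_divM `|cross p q r| w; lia.
Qed.

(* The parity of the number of edges of the polygon met by the upward ray from v,
   that is, membership in the interior modulo 2. *)
Definition inside (f : nat -> vertex) (M : nat) (v : vertex) : bool :=
  \big[addb/false]_(j < M) under (f j) (f j.+1) v.

Lemma big_addb_telescope (h : nat -> bool) M :
  \big[addb/false]_(j < M) (h j (+) h j.+1) = h 0%N (+) h M.
Proof.
elim: M => [|M IH]; first by rewrite big_ord0 addbb.
by rewrite big_ord_recr /= IH -addbA [h M (+) _]addbA addbb addFb.
Qed.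

(** Joining each f(2j) to g(j) cuts the region between the two polygons into pentagons, each divided
    into three triangles; the joining segments cancel because both polygons are closed. *)
Lemma poly_coarsen (f g : nat -> vertex) M v :
  f M.*2 = f 0%N -> g M = g 0%N ->
  inside f M.*2 v (+) inside g M v =
  \big[addb/false]_(j < M) (tri (f j.*2) (f j.*2.+1) (f j.+1.*2) v
    (+) tri (f j.*2) (f j.+1.*2) (g j.+1) v (+) tri (f j.*2) (g j) (g j.+1) v).
Proof.
move=> fM gM.
have dbl : inside f M.*2 v = \big[addb/false]_(j < M)
    (under (f j.*2) (f j.*2.+1) v (+) under (f j.*2.+1) (f j.+1.*2) v).
  rewrite /inside; elim: {fM gM} M => [|M IH]; first by rewrite !big_ord0.
  by rewrite doubleS !big_ord_recr /= IH -addbA.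
have tel := big_addb_telescope (fun j => under (f j.*2) (g j) v) M.
rewrite /= fM gM addbb in tel.
rewrite dbl /inside -(@big_split _ false addb) /=.
transitivity (\big[addb/false]_(j < M) (under (f j.*2) (f j.*2.+1) v
    (+) under (f j.*2.+1) (f j.+1.*2) v (+) under (g j) (g j.+1) v)
  (+) \big[addb/false]_(j < M) (under (f j.*2) (g j) v
    (+) under (f j.+1.*2) (g j.+1) v)); first by rewrite tel addbF.
rewrite -(@big_split _ false addb) /=.
apply: eq_bigr => j _; rewrite /tri.
move: (under (f j.*2) (f j.*2.+1) v) (under (f j.*2.+1) (f j.+1.*2) v)
  (under (f j.*2) (f j.+1.*2) v) (under (f j.+1.*2) (g j.+1) v)
  (under (f j.*2) (g j.+1) v) (under (f j.*2) (g j) v) (under (g j) (g j.+1) v).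
by do 7!case.
Qed.

Lemma count_big_addb (T : Type) (S : seq T) (B : nat -> pred T) M :
  (count (fun v => \big[addb/false]_(j < M) B j v) S <= \sum_(j < M) count (B j) S)%N.
Proof.
elim: M => [|M IH]; first by rewrite big_ord0 (eq_count (a2 := pred0)) ?count_pred0 // => v; rewrite big_ord0.
rewrite big_ord_recr /=; apply: leq_trans (leq_add IH (leqnn _)).
rewrite -count_predUI; apply: leq_trans (leq_addr _ _).
by apply: sub_count => v /=; rewrite big_ord_recr /=; case: (\big[_/_]_(_ < _) _); case: (B M v).
Qed.

Lemma count_addb3 (T : Type) (S : seq T) (a b c : pred T) :
  (count (fun v => a v (+) b v (+) c v) S <= count a S + count b S + count c S)%N.
Proof.
by elim: S => //= v S; case: (a v); case: (b v); case: (c v) => /=; lia.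
Qed.

Lemma cross_le (a b c d X Y Z : int) : `|a| <= X -> `|b| <= Y -> `|c| <= Z -> `|d| <= Z ->
  `|a * d - b * c| <= (X + Y) * Z.
Proof.
move=> hX hY hc hd; apply: le_trans (ler_normB _ _) _.
by rewrite !normrM mulrDl lerD // ler_pM.
Qed.

(** P, Q, R are points of the walk, the small letters their roundings at mesh m and the primed ones
    at a mesh of at most 2m. Only pqr sees the second difference, since twice its [cross] is the
    determinant of 2q - p - r and r - p; the other two triangles have a side as short as a rounding
    error. The constant is 46 = 6 + 12 + 16 + 12, from the three areas and from the three widths
    4s. *)
Lemma count_tri3 (S : seq vertex) (P Q R p q r p' r' : vertex) (s m : int) : uniq S ->
  1 <= m -> m <= s ->
  `|Q.1 - P.1| <= s -> `|R.1 - Q.1| <= s -> `|Q.2 - P.2| <= s -> `|R.2 - Q.2| <= s ->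
  0 <= P.1 - p.1 < m -> 0 <= Q.1 - q.1 < m -> 0 <= R.1 - r.1 < m ->
  0 <= P.2 - p.2 < m -> 0 <= Q.2 - q.2 < m -> 0 <= R.2 - r.2 < m ->
  0 <= P.1 - p'.1 < 2 * m -> 0 <= R.1 - r'.1 < 2 * m ->
  0 <= P.2 - p'.2 < 2 * m -> 0 <= R.2 - r'.2 < 2 * m ->
  (count (fun v => tri p q r v (+) tri p r r' v (+) tri p p' r' v) S)%:Z
  <= 2 * s * (`|2 * Q.1 - P.1 - R.1| + `|2 * Q.2 - P.2 - R.2|) + 46 * (s * m).
Proof.
move=> uS m1 ms QP1 RQ1 QP2 RQ2 p1 q1 r1 p2 q2 r2 p'1 r'1 p'2 r'2.
set D1 := `|_ - P.1 - R.1|; set D2 := `|_ - P.2 - R.2|.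
have s0 : 0 <= s by lia.
have sm : s <= s * m by rewrite ler_peMr.
have H : (count (fun v => tri p q r v (+) tri p r r' v (+) tri p p' r' v) S)%:Z
    <= (count (tri p q r) S)%:Z + (count (tri p r r') S)%:Z + (count (tri p p' r') S)%:Z.
  by rewrite -!PoszD lez_nat count_addb3.
apply: le_trans H _.
have t1 := @count_tri S p q r (4 * s) uS ltac:(lia) ltac:(lia) ltac:(lia).
have t2 := @count_tri S p r r' (4 * s) uS ltac:(lia) ltac:(lia) ltac:(lia).
have t3 := @count_tri S p p' r' (4 * s) uS ltac:(lia) ltac:(lia) ltac:(lia).
have c1 : 2 * `|cross p q r| <= (D1 + 2 * m + (D2 + 2 * m)) * (3 * s).
  have -> : 2 * `|cross p q r| = `|(2 * q.1 - p.1 - r.1) * (r.2 - p.2)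
              - (2 * q.2 - p.2 - r.2) * (r.1 - p.1)|.
    rewrite -[2 as X in X * _]ger0_norm // -normrM; congr `|_|; rewrite /cross; ring.
  by apply: cross_le; rewrite /D1 /D2; lia.
have c2 : `|cross p r r'| <= (2 * m + 2 * m) * (3 * s).
  have -> : cross p r r' = - ((r'.1 - r.1) * (r.2 - p.2) - (r'.2 - r.2) * (r.1 - p.1)).
    rewrite /cross; ring.
  by rewrite normrN; apply: cross_le; lia.
have c3 : `|cross p p' r'| <= (2 * m + 2 * m) * (4 * s).
  by rewrite /cross; apply: cross_le; lia.
have e1 : (D1 + 2 * m + (D2 + 2 * m)) * (3 * s) = 3 * (s * (D1 + D2)) + 12 * (s * m) by ring.
have e2 : (2 * m + 2 * m) * (3 * s) = 12 * (s * m) by ring.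
have e3 : (2 * m + 2 * m) * (4 * s) = 16 * (s * m) by ring.
have D0 : 0 <= s * (D1 + D2) by rewrite mulr_ge0 // addr_ge0 // normr_ge0.
rewrite e1 in c1; rewrite e2 in c2; rewrite e3 in c3.
have -> : 2 * s * (D1 + D2) = 2 * (s * (D1 + D2)) by ring.
move: t1 t2 t3 c1 c2 c3 D0 sm; move: (cross p q r) (cross p r r') (cross p p' r').
move: (count _ S) (count _ S) (count _ S) (s * (D1 + D2)) (s * m).
clear; move=> ? ? ? ? ? ? ? ?; lia.
Qed.

Definition round_to (m : nat) (p : vertex) : vertex :=
  ((p.1 %/ m%:Z)%Z * m%:Z, (p.2 %/ m%:Z)%Z * m%:Z).

Lemma round_to_bound (m : nat) p : (0 < m)%N ->
  (0 <= p.1 - (round_to m p).1 < m%:Z) /\ (0 <= p.2 - (round_to m p).2 < m%:Z).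
Proof.
move=> m0; have h (x : int) : 0 <= x - (x %/ m%:Z)%Z * m%:Z < m%:Z.
  have e := divz_eq x m%:Z; have l1 := modz_ge0 x (_ : m%:Z != 0).
  have l2 := @ltz_pmod x m%:Z; move: l1 l2 => /(_ ltac:(lia)) l1 /(_ ltac:(lia)) l2.
  by rewrite {1 3}e [_ + (x %% _)%Z]addrC addrK; lia.
by split; apply: h.
Qed.

Lemma round_to1 p : round_to 1 p = p.
Proof. by case: p => a b; rewrite /round_to /= !divz1 !mulr1. Qed.

(** * Multiscale approximation of a closed walk *)

Section Chain.
Variables (phi : nat -> vertex) (K kap : nat).
(** An inequality, so that a walk may be padded with stationary steps. *)
Hypothesis phi_step : forall i, ((phi i.+1).1 - (phi i).1) ^+ 2 + ((phi i.+1).2 - (phi i).2) ^+ 2 <= 1.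
Hypothesis phi_closed : phi (2 ^ K)%N = phi 0%N.

Lemma walk_lipschitz i n :
  (`|(phi (i + n)%N).1 - (phi i).1| <= n%:Z) /\ (`|(phi (i + n)%N).2 - (phi i).2| <= n%:Z).
Proof.
elim: n => [|n [IH1 IH2]]; first by rewrite addn0 !subrr.
rewrite addnS; have := phi_step (i + n).
set x := (phi _.+1).1 - _; set y := (phi _.+1).2 - _ => h.
have hx : `|x| <= 1 by have := sqr_ge0 y; nia.
have hy : `|y| <= 1 by have := sqr_ge0 x; nia.
by split; move: hx hy; rewrite /x /y; lia.
Qed.

Definition second_diff k j : vertex :=
  (2 * (phi (j.*2.+1 * 2 ^ k)%N).1 - (phi (j * 2 ^ k.+1)%N).1 - (phi (j.+1 * 2 ^ k.+1)%N).1,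
   2 * (phi (j.*2.+1 * 2 ^ k)%N).2 - (phi (j * 2 ^ k.+1)%N).2 - (phi (j.+1 * 2 ^ k.+1)%N).2).

Arguments second_diff : simpl never.

Definition energy k : int := \sum_(j < 2 ^ (K - k))
  (((phi (j.+1 * 2 ^ k)%N).1 - (phi (j * 2 ^ k)%N).1) ^+ 2
   + ((phi (j.+1 * 2 ^ k)%N).2 - (phi (j * 2 ^ k)%N).2) ^+ 2).

Definition roughness k : int := \sum_(j < 2 ^ (K - k.+1))
  ((second_diff k j).1 ^+ 2 + (second_diff k j).2 ^+ 2).

Lemma sum_double (V : nmodType) (F : nat -> V) n :
  \sum_(j < n.*2) F j = \sum_(j < n) (F j.*2 + F j.*2.+1).
Proof.
elim: n => [|n IH]; first by rewrite !big_ord0.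
by rewrite doubleS !big_ord_recr /= IH addrA.
Qed.

(* This is the parallelogram law for the two halves of each step. *)
Lemma energy_split k : (k < K)%N -> 2 * energy k = energy k.+1 + roughness k.
Proof.
move=> kK; rewrite /energy /roughness -(subnSK kK) expnS mul2n.
rewrite (sum_double (fun j => ((phi (j.+1 * 2 ^ k)%N).1 - (phi (j * 2 ^ k)%N).1) ^+ 2
   + ((phi (j.+1 * 2 ^ k)%N).2 - (phi (j * 2 ^ k)%N).2) ^+ 2)).
rewrite mulr_sumr -big_split /=; apply: eq_bigr => j _.
rewrite /second_diff /=.
have -> : (j * 2 ^ k.+1 = j.*2 * 2 ^ k)%N by rewrite expnS mulnA muln2.
have -> : (j.+1 * 2 ^ k.+1 = j.*2.+2 * 2 ^ k)%N by rewrite expnS mulnA muln2.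
ring.
Qed.

(* Rounding makes the number of choices per step independent of k. The truncated
   subtraction means that there is no rounding at the scales k <= kap. *)
Definition level k (j : nat) : vertex := round_to (2 ^ (k - kap)) (phi (j * 2 ^ k)%N).

Definition level_set k : pred vertex := inside (level k) (2 ^ (K - k)).

Lemma level_set0 v : level_set 0 v = inside phi (2 ^ K) v.
Proof.
rewrite /level_set subn0; apply: eq_bigr => j _.
by rewrite /level sub0n expn0 !muln1 !round_to1.
Qed.

Lemma level_setK v : level_set K v = false.
Proof.
rewrite /level_set subnn expn0 /inside big_ord_recr big_ord0 /= /level mul0n mul1n.
by rewrite phi_closed under_vertical.
Qed.

Lemma level_closed k : (k <= K)%N -> level k (2 ^ (K - k)) = level k 0.
Proof. by move=> kK; rewrite /level -expnD subnK // mul0n phi_closed. Qed.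

Lemma count_level_diff (S : seq vertex) k : uniq S -> (k < K)%N ->
  (count (fun v => level_set k v (+) level_set k.+1 v) S)%:Z <=
  \sum_(j < 2 ^ (K - k.+1)) (2 * (2 ^ k)%N%:Z * (`|(second_diff k j).1| + `|(second_diff k j).2|)
     + 46 * ((2 ^ k)%N%:Z * (2 ^ (k - kap))%N%:Z)).
Proof.
move=> uS kK.
have eM : (2 ^ (K - k) = (2 ^ (K - k.+1)).*2)%N by rewrite -mul2n -expnS subnSK.
have c1 : level k (2 ^ (K - k.+1)).*2 = level k 0 by rewrite -eM level_closed // ltnW.
have c2 := level_closed kK.
rewrite (eq_count (a2 := fun v => \big[addb/false]_(j < 2 ^ (K - k.+1))
  (tri (level k j.*2) (level k j.*2.+1) (level k j.+1.*2) v
    (+) tri (level k j.*2) (level k j.+1.*2) (level k.+1 j.+1) v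
    (+) tri (level k j.*2) (level k.+1 j) (level k.+1 j.+1) v))); last first.
  by move=> v; rewrite /level_set eM poly_coarsen.
apply: le_trans (_ : (\sum_(j < 2 ^ (K - k.+1)) count (fun v =>
  tri (level k j.*2) (level k j.*2.+1) (level k j.+1.*2) v
    (+) tri (level k j.*2) (level k j.+1.*2) (level k.+1 j.+1) v
    (+) tri (level k j.*2) (level k.+1 j) (level k.+1 j.+1) v) S)%N%:Z <= _).
  rewrite lez_nat; exact: (count_big_addb S (fun j v =>
   tri (level k j.*2) (level k j.*2.+1) (level k j.+1.*2) v
    (+) tri (level k j.*2) (level k j.+1.*2) (level k.+1 j.+1) v
    (+) tri (level k j.*2) (level k.+1 j) (level k.+1 j.+1) v)).
rewrite -natz natr_sum; apply: ler_sum => j _; rewrite natz.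
have e1 : (j.*2 * 2 ^ k = j * 2 ^ k.+1)%N by rewrite expnS mulnA muln2.
have e2 : (j.+1.*2 * 2 ^ k = j.+1 * 2 ^ k.+1)%N by rewrite expnS mulnA muln2.
have e3 : (j.*2.+1 * 2 ^ k = j * 2 ^ k.+1 + 2 ^ k)%N by rewrite -e1 mulSn addnC.
have e4 : (j.+1 * 2 ^ k.+1 = j.*2.+1 * 2 ^ k + 2 ^ k)%N by rewrite -e2 doubleS [in RHS]addnC -mulSn.
have [l1 l2] := walk_lipschitz (j * 2 ^ k.+1) (2 ^ k); rewrite -e3 in l1 l2.
have [l3 l4] := walk_lipschitz (j.*2.+1 * 2 ^ k) (2 ^ k); rewrite -e4 in l3 l4.
have m0 : (0 < 2 ^ (k - kap))%N by rewrite expn_gt0.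
have m0' : (0 < 2 ^ (k.+1 - kap))%N by rewrite expn_gt0.
(* The mesh at most doubles from one scale to the next, as [count_tri3] requires of the primed
   roundings. *)
have mm' : (2 ^ (k.+1 - kap) <= 2 * 2 ^ (k - kap))%N by rewrite -expnS leq_exp2l //; lia.
have [p1 p2] := round_to_bound (phi (j * 2 ^ k.+1)%N) m0.
have [q1 q2] := round_to_bound (phi (j.*2.+1 * 2 ^ k)%N) m0.
have [r1 r2] := round_to_bound (phi (j.+1 * 2 ^ k.+1)%N) m0.
have [p1' p2'] := round_to_bound (phi (j * 2 ^ k.+1)%N) m0'.
have [r1' r2'] := round_to_bound (phi (j.+1 * 2 ^ k.+1)%N) m0'.
have w (x : int) : 0 <= x < (2 ^ (k.+1 - kap))%N%:Z -> 0 <= x < 2 * (2 ^ (k - kap))%N%:Z.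
  by move=> /andP[-> /=] /lt_le_trans; apply; rewrite -[2]/(2%N%:Z) -PoszM lez_nat.
apply: (@count_tri3 S (phi (j * 2 ^ k.+1)%N) (phi (j.*2.+1 * 2 ^ k)%N)
  (phi (j.+1 * 2 ^ k.+1)%N)); rewrite // /level ?e1 ?e2 //; try exact: w.
by rewrite lez_nat leq_exp2l // leq_subr.
Qed.

Variable R : realFieldType.

(** By [energy_split], energy k / 2^k decreases from k to k + 1 by exactly the k-th summand; it
    starts at most at 2^K because the steps have length at most 1. *)
Lemma sum_roughness : \sum_(k < K) ((roughness k)%:~R / 2 ^+ k.+1 : R) <= 2 ^+ K.
Proof.
have H n : (n <= K)%N -> \sum_(k < n) ((roughness k)%:~R / 2 ^+ k.+1 : R) =
    (energy 0)%:~R - (energy n)%:~R / 2 ^+ n.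
  elim: n => [|n IH] nK; first by rewrite big_ord0 expr0 divr1 subrr.
  rewrite big_ord_recr [in LHS]/= (IH (ltnW nK)).
  have e : 2 * (energy n)%:~R = (energy n.+1)%:~R + (roughness n)%:~R :> R.
    by rewrite -intrD -energy_split // intrM.
  have p0 : 2 ^+ n != 0 :> R by rewrite expf_eq0 pnatr_eq0 andbF.
  move: e; rewrite exprS; move: ((energy n)%:~R : R) ((energy n.+1)%:~R : R) ((roughness n)%:~R : R).
  move: ((energy 0)%:~R : R) (2 ^+ n : R) p0 => t p p0 x y z e.
  have -> : x = (y + z) / 2 by lra.
  by field.
have en k : (0 : R) <= (energy k)%:~R.
  by rewrite ler0z; apply: sumr_ge0 => j _; rewrite addr_ge0 ?sqr_ge0.
rewrite H //; apply: (@le_trans _ _ ((energy 0)%:~R)).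
  by rewrite lerBlDr lerDl divr_ge0 // exprn_ge0.
rewrite -natrX -[X in _ <= X]mulrz_nat ler_int /energy subn0.
apply: (@le_trans _ _ (\sum_(j < 2 ^ K) (1 : int))).
  by apply: ler_sum => j _; rewrite expn0 !muln1.
by rewrite sumr_const card_ord.
Qed.

(** The area is linear in the second differences, whereas [sum_roughness] controls their squares.
    The weight b^2 of the arithmetic-geometric inequality also dominates the mesh, so the rounding
    error joins the same main term. *)
Lemma second_diff_amgm (X Y : int) k (b : R) : 0 < b ->
  (2 ^ (k - kap))%N%:R <= 2 ^+ k * b ^+ 2 ->
  (2 * (2 ^ k)%N%:Z * (`|X| + `|Y|) + 46 * ((2 ^ k)%N%:Z * (2 ^ (k - kap))%N%:Z))%:~R
  <= 2 * 2 ^+ k ^+ 2 * b ^+ 2 + 46 * (2 ^+ k * (2 ^+ k * b ^+ 2))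
     + (X ^+ 2 + Y ^+ 2)%:~R / b ^+ 2.
Proof.
move=> b0; have s0 : 0 < 2 ^+ k :> R by rewrite exprn_gt0.
rewrite (intrD _ (2 * _ * _)) (intrM _ (2 * _)) (intrM _ 2) (intrM _ 46) (intrM _ (Posz _)).
rewrite (intrD _ `|X|) !intr_norm -!pmulrn !natrX (intrD _ (X ^+ 2)) !rmorphXn /=.
move: (X%:~R : R) (Y%:~R : R) => x y.
have amgm (z : R) : 2 * 2 ^+ k * `|z| <= 2 ^+ k ^+ 2 * b ^+ 2 + z ^+ 2 / b ^+ 2.
  rewrite -subr_ge0 -(real_normK (num_real z)).
  have -> : 2 ^+ k ^+ 2 * b ^+ 2 + `|z| ^+ 2 / b ^+ 2 - 2 * 2 ^+ k * `|z| =
    (2 ^+ k * b - `|z| / b) ^+ 2.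
    by field; rewrite gt_eqF.
  exact: sqr_ge0.
move=> mub; have := amgm x; have := amgm y; have : 2 ^+ k * 2 ^+ (k - kap) <= 2 ^+ k * (2 ^+ k * b ^+ 2).
  by rewrite ler_pM2l.
lra.
Qed.

(** Each of the 2^(K-k-1) steps contributes (2 + 46) 2^(2k) b^2, which after division by 2^k b gives
    24 * 2^K b. The roughness appears divided by 2^k b^3, where b is bounded below by a. *)
Lemma chain_cost (S : seq vertex) (a : R) (b : nat -> R) : uniq S -> 0 < a ->
  (forall k, a <= b k) ->
  (forall k, (2 ^ (k - kap))%N%:R <= 2 ^+ k * b k ^+ 2) ->
  \sum_(k < K) ((count (fun v => level_set k v (+) level_set k.+1 v) S)%:R / (2 ^+ k * b k))
  <= 24 * 2 ^+ K * (\sum_(k < K) b k) + 2 * 2 ^+ K / a ^+ 3.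
Proof.
move=> uS a0 ab mub.
have b0 k : 0 < b k := lt_le_trans a0 (ab k).
apply: (@le_trans _ _ (\sum_(k < K) (24 * 2 ^+ K * b k + 2 / a ^+ 3 * ((roughness k)%:~R / 2 ^+ k.+1)))); last first.
  rewrite big_split /= -!mulr_sumr lerD2l (mulrAC 2 (2 ^+ K)) ler_wpM2l ?sum_roughness //.
  by rewrite divr_ge0 // exprn_ge0 // ltW.
apply: ler_sum => k _.
have s0 : 0 < 2 ^+ k :> R by rewrite exprn_gt0.
rewrite ler_pdivrMr ?mulr_gt0 //.
have := count_level_diff uS (ltn_ord k).
set C := count _ _; rewrite -(ler_int R) pmulrn => /le_trans -> //.
rewrite (@rmorph_sum _ _ (intr : int -> R)) /=.
apply: (@le_trans _ _ (\sum_(j < 2 ^ (K - k.+1)) (2 * 2 ^+ k ^+ 2 * b k ^+ 2 + 46 * (2 ^+ k * (2 ^+ k * b k ^+ 2)) +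
    (((second_diff k j).1 ^+ 2 + (second_diff k j).2 ^+ 2)%:~R) / b k ^+ 2))).
  by apply: ler_sum => j _; exact: second_diff_amgm.
rewrite big_split /= sumr_const card_ord -mulr_suml -rmorph_sum /= -/(roughness k).
have LamE : 2 ^+ K = (2 ^ (K - k.+1))%N%:R * (2 * 2 ^+ k) :> R.
  by rewrite -exprS natrX -exprD subnK.
have r0 : (0 : R) <= (roughness k)%:~R.
  by rewrite ler0z; apply: sumr_ge0 => j _; rewrite addr_ge0 ?sqr_ge0.
rewrite [X in _ <= X]mulrDl lerD //.
  rewrite LamE -[_ *+ (2 ^ _)]mulr_natl le_eqVlt; apply/orP; left; apply/eqP; ring.
have -> : 2 / a ^+ 3 * ((roughness k)%:~R / 2 ^+ k.+1) * (2 ^+ k * b k) = (roughness k)%:~R * (b k / a ^+ 3).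
  move: ((roughness k)%:~R : R) => W.
  rewrite [2 ^+ k.+1]exprS; move: (b k) (2 ^+ k : R) s0 => y t t0.
  by field; rewrite !gt_eqF.
rewrite ler_wpM2l // ler_pdivlMr ?exprn_gt0 // mulrC ler_pdivrMr ?exprn_gt0 // -exprS.
by apply: lerXn2r => //; rewrite nnegrE ltW.
Qed.
End Chain.

(** * Contours of spin configurations *)

Section Contour.
Variable s : vertex -> bool.

Definition boundary_edge (e : vertex * vertex) : bool := [&& adj e.1 e.2, s e.1 & ~~ s e.2].

(** The vector v - u rotated counterclockwise by a right angle: the direction of the dual edge that
    has u on its left. *)
Definition edge_turn (u v : vertex) : vertex := (u.2 - v.2, v.1 - u.1).

Definition translate (u t : vertex) : vertex := (u.1 + t.1, u.2 + t.2).

(* The pair (u, v) with s u and ~~ s v stands for the dual edge crossing uv,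
   oriented with u on its left. Where two boundary edges cross, the walk turns
   left, which makes the successor map injective. *)
Definition next_edge (e : vertex * vertex) : vertex * vertex :=
  let t := edge_turn e.1 e.2 in
  if ~~ s (translate e.1 t) then (e.1, translate e.1 t)
  else if ~~ s (translate e.2 t) then (translate e.1 t, translate e.2 t)
  else (translate e.2 t, e.2).

(** The rule of [next_edge] for the reversed direction. Where two boundary edges cross, both rules
    keep to the same vertex of [s], which makes them inverse to each other. *)
Definition prev_edge (e : vertex * vertex) : vertex * vertex :=
  let t := edge_turn e.2 e.1 in
  if ~~ s (translate e.1 t) then (e.1, translate e.1 t)
  else if ~~ s (translate e.2 t) then (translate e.1 t, translate e.2 t)
  else (translate e.2 t, e.2).

Definition edge_tail (e : vertex * vertex) : vertex :=
  (e.1.1 + ((e.2.1 == e.1.1 + 1) || (e.2.2 == e.1.2 + 1))%:Z,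
   e.1.2 + ((e.2.2 == e.1.2 + 1) || (e.1.1 == e.2.1 + 1))%:Z).

Definition edge_head (e : vertex * vertex) : vertex := translate (edge_tail e) (edge_turn e.1 e.2).

Lemma adj_cases (x y z t : int) : adj (x, y) (z, t) ->
  (z = x + 1 /\ t = y) \/ (z = x /\ t = y + 1) \/ (x = z + 1 /\ t = y) \/ (z = x /\ y = t + 1).
Proof. by rewrite /adj /=; lia. Qed.

Lemma boundary_next e : boundary_edge e -> boundary_edge (next_edge e).
Proof.
case: e => [[x y] [z t]]; rewrite /boundary_edge /next_edge /edge_turn /translate /= => /and3P[h su sv].
have h' := adj_cases h.
case: ifP => /= [h1|/negbFE h1]; first by rewrite su h1 !andbT /adj /=; lia.
case: ifP => /= [h2|/negbFE h2]; first by rewrite h1 h2 !andbT /adj /=; lia.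
by rewrite h2 sv !andbT /adj /=; lia.
Qed.

Lemma prev_next e : boundary_edge e -> prev_edge (next_edge e) = e.
Proof.
case: e => [u v]; rewrite /boundary_edge /= => /and3P[_ su sv].
rewrite /next_edge /=; set t := edge_turn u v.
have pairE (x y : vertex) : x.1 = y.1 -> x.2 = y.2 -> x = y by case: x y => [? ?] [? ?] /= -> ->.
have a1 : translate u (edge_turn (translate u t) u) = v.
  by apply: pairE; rewrite /t /translate /edge_turn /=; ring.
have a2 : translate (translate u t) (edge_turn (translate v t) (translate u t)) = u.
  by apply: pairE; rewrite /t /translate /edge_turn /=; ring.
have a3 : translate (translate v t) (edge_turn (translate v t) (translate u t)) = v.
  by apply: pairE; rewrite /t /translate /edge_turn /=; ring.
have a4 : translate (translate v t) (edge_turn v (translate v t)) = translate u t.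
  by apply: pairE; rewrite /t /translate /edge_turn /=; ring.
have a5 : translate v (edge_turn v (translate v t)) = u.
  by apply: pairE; rewrite /t /translate /edge_turn /=; ring.
case: ifP => [h1|/negbFE h1]; first by rewrite /prev_edge /= a1 sv.
case: ifP => [h2|/negbFE h2]; first by rewrite /prev_edge /= a2 a3 su sv.
by rewrite /prev_edge /= a4 a5 su h1.
Qed.

Lemma tail_next e : boundary_edge e -> edge_tail (next_edge e) = edge_head e.
Proof.
case: e => [[x y] [z t]]; rewrite /boundary_edge /next_edge /edge_head /edge_tail /edge_turn /translate /= => /and3P[h su sv].
have := adj_cases h.
by case: ifP => _ /=; [|case: ifP => _ /=]; case=> [[-> ->]|[[-> ->]|[[-> ->]|[-> ->]]]]; congr pair; lia.
Qed.

Lemma tail_head_step e : adj e.1 e.2 ->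
  ((edge_head e).1 - (edge_tail e).1) ^+ 2 + ((edge_head e).2 - (edge_tail e).2) ^+ 2 = 1.
Proof.
case: e => [[x y] [z t]] /= h; rewrite /edge_head /translate /edge_turn /=.
rewrite [_ + (y - t)]addrC addrK [_ + (z - x)]addrC addrK.
by case: (adj_cases h) => [[-> ->]|[[-> ->]|[[-> ->]|[-> ->]]]]; rewrite !expr2; lia.
Qed.

Lemma tail_head_cases e : adj e.1 e.2 ->
  [\/ [/\ e.2 = (e.1.1 + 1, e.1.2), edge_tail e = (e.1.1 + 1, e.1.2) & edge_head e = (e.1.1 + 1, e.1.2 + 1)],
      [/\ e.2 = (e.1.1, e.1.2 + 1), edge_tail e = (e.1.1 + 1, e.1.2 + 1) & edge_head e = (e.1.1, e.1.2 + 1)],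
      [/\ e.1 = (e.2.1 + 1, e.2.2), edge_tail e = (e.1.1, e.1.2 + 1) & edge_head e = e.1]
    | [/\ e.1 = (e.2.1, e.2.2 + 1), edge_tail e = e.1 & edge_head e = (e.1.1 + 1, e.1.2)]].
Proof.
case: e => [[x y] [z t]] /= h; rewrite /edge_head /edge_tail /translate /edge_turn.
case: (adj_cases h) => [[-> ->]|[[-> ->]|[[-> ->]|[-> ->]]]] /=;
  [apply: Or41|apply: Or42|apply: Or43|apply: Or44]; split; congr pair; lia.
Qed.

Lemma under_edge e w : adj e.1 e.2 ->
  under (edge_tail e) (edge_head e) w = [&& e.1.1 == e.2.1, w.1 == e.1.1 & (w.2 < e.1.2) || (w.2 < e.2.2)].
Proof.
move=> h; case: (tail_head_cases h) => -[h2 -> ->]; case: e w {h} h2 => [[x y] [z t]] [a b] /= [-> ->].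
- by rewrite under_vertical /=; lia.
- by rewrite under_horizontal /=; lia.
- by rewrite under_vertical /=; lia.
- by rewrite under_horizontal /=; lia.
Qed.

Lemma under_up e w : adj e.1 e.2 ->
  under (edge_tail e) (edge_head e) w (+) under (edge_tail e) (edge_head e) (w.1, w.2 + 1) =
  (e == (w, (w.1, w.2 + 1))) || (e == ((w.1, w.2 + 1), w)).
Proof.
move=> h; rewrite !under_edge //; case: (tail_head_cases h).
all: case: e w {h} => [[x y] [z t]] [a b] /= [[-> ->] _ _]; rewrite !xpair_eqE /=.
- by have [->|] := eqVneq x a; lia.
- by have [->|] := eqVneq x a; lia.
- by have [->|] := eqVneq z a; lia.
- by have [->|] := eqVneq z a; lia.
Qed.

(** The rays from w and from its right neighbour are separated by a vertical line of dual vertices.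
    The endpoints of e on this line above w give the correction term, which cancels along a closed
    contour. *)
Lemma under_right e w : adj e.1 e.2 ->
  under (edge_tail e) (edge_head e) w (+) under (edge_tail e) (edge_head e) (w.1 + 1, w.2)
  (+) ((((edge_tail e).1 == w.1 + 1) && (w.2 < (edge_tail e).2))
       (+) (((edge_head e).1 == w.1 + 1) && (w.2 < (edge_head e).2))) =
  (e == (w, (w.1 + 1, w.2))) || (e == ((w.1 + 1, w.2), w)).
Proof.
move=> h; rewrite !under_edge //; case: (tail_head_cases h).
all: case=> h2 -> ->; case: e w {h} h2 => [[x y] [z t]] [a b] /= [-> ->]; rewrite !xpair_eqE /=.
- by have [->|] := eqVneq x a; lia.
- by have [->|] := eqVneq x a; lia.
- by have [->|] := eqVneq z a; lia.
- by have [->|] := eqVneq z a; lia.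
Qed.
End Contour.

(** The orbits partition E, so an odd total forces an odd orbit. This selects, among all contours,
    one that surrounds the origin. *)
Lemma odd_orbit (E : finType) (f : E -> E) (c : E -> bool) : injective f ->
  \big[addb/false]_(x : E) c x ->
  exists x0, \big[addb/false]_(i < order f x0) c (iter i f x0).
Proof.
move=> injf; have sym := fconnect_sym injf.
rewrite (partition_big (froot f) xpredT) //= => H.
have [j hj] : exists j, \big[addb/false]_(x | froot f x == j) c x.
  apply/existsP; apply: contraT; rewrite negb_exists => /forallP h.
  by move: H; rewrite big1 // => i _; apply/negbTE/h.
have [x0 /eqP hx0] : exists x0, froot f x0 == j.
  apply/existsP; apply: contraT; rewrite negb_exists => /forallP h.
  by move: hj; rewrite big_pred0 // => i; apply/negbTE/h.
exists x0; apply: etrans hj; rewrite -hx0.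
rewrite (eq_bigl (fun x => x \in orbit f x0)); last first.
  by move=> x; rewrite -fconnect_orbit -(root_connect sym) eq_sym.
rewrite -(big_uniq _ (orbit_uniq f x0)) (big_nth x0) size_orbit big_mkord.
by apply: eq_bigr => i _; rewrite nth_traject.
Qed.

Lemma big_addb_mem (T : eqType) (c : nat -> T) (e : T) L : {in gtn L &, injective c} ->
  \big[addb/false]_(i < L) (c i == e) = (e \in map c (iota 0 L)).
Proof.
elim: L => [|L IH] injc; first by rewrite big_ord0.
have -> : iota 0 L.+1 = iota 0 L ++ [:: L] by rewrite -addn1 iotaD.
rewrite big_ord_recr /= IH; last by move=> i j hi hj; apply: injc; rewrite inE ltnW //; apply: leq_trans hi _.
rewrite map_cat mem_cat inE [e == _]eq_sym.
have [ce|] := eqVneq (c L) e; last by rewrite addbF orbF.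
rewrite orbT; suff -> : (e \in map c (iota 0 L)) = false by [].
apply/negbTE/mapP => -[i]; rewrite mem_iota /= => iL; rewrite -ce => /injc.
by rewrite !inE ltnS leqnn ltnS ltnW // => /(_ isT isT) eLi; rewrite eLi ltnn in iL.
Qed.

Lemma boundary_in_box (s : vertex -> bool) N e : (forall v, s v -> v \in box N) ->
  boundary_edge s e -> (e.1 \in box N) && (e.2 \in box N.+1).
Proof.
move=> sN /and3P[h /sN u1 _]; rewrite u1 /=; exact: adj_box u1 h.
Qed.

(** The boundary edges above the origin are the changes of [s] along the positive vertical
    half-axis; there [s] starts true and ends false, so their number is odd. *)
Lemma origin_parity (s : vertex -> bool) N (E : {fset vertex * vertex}) :
  (forall v, s v -> v \in box N) -> s origin ->
  (forall e, (e \in E) = boundary_edge s e) ->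
  \big[addb/false]_(e <- E) under (edge_tail e) (edge_head e) origin.
Proof.
move=> sN so EE.
pose g (y : nat) : vertex * vertex :=
  if s (0, y%:Z) then ((0, y%:Z), (0, y.+1%:Z)) else ((0, y.+1%:Z), (0, y%:Z)).
have gi : injective g.
  move=> y z; rewrite /g; case: ifP => _; case: ifP => _ [] //; lia.
have gA y : adj (g y).1 (g y).2 by rewrite /g; case: ifP => _; rewrite /adj /=; lia.
pose r := [seq y <- iota 0 N.+1 | s (0, y%:Z) (+) s (0, y.+1%:Z)].
apply: (etrans (y := \big[addb/false]_(e <- [seq e <- E | under (edge_tail e) (edge_head e) origin]) true)).
  by rewrite big_filter [RHS]big_mkcond /=; apply: eq_bigr => e _; case: (under _ _ _).
rewrite (perm_big (map g r)) /=; last first.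
  apply: uniq_perm.
  - exact: filter_uniq (fset_uniq E).
  - by rewrite map_inj_uniq // filter_uniq // iota_uniq.
  move=> e; rewrite mem_filter EE; apply/andP/mapP.
    move=> [hu /[dup] /and3P[ha hs1 hs2] hb]; move: hu; rewrite under_edge // /origin /= => /and3P[].
    case: e ha hs1 hs2 hb => [[x y] [z t]] /= ha hs1 hs2 hb /eqP exz /eqP ex0 hyt.
    rewrite -exz -ex0 in ha hs1 hs2 hb *.
    have := sN _ hs1; rewrite in_box /= => hN.
    have [ety|eyt] : t = y + 1 \/ y = t + 1 by have := adj_cases ha; lia.
      exists `|y|%N.
        rewrite mem_filter mem_iota; have -> : `|y|%N%:Z = y by lia.
        have -> : `|y|%N.+1%:Z = t by lia.
        by rewrite hs1 (negbTE hs2) /=; lia.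
      rewrite /g; have -> : `|y|%N%:Z = y by lia.
      have -> : `|y|%N.+1%:Z = t by lia.
      by rewrite hs1.
    exists `|t|%N.
      rewrite mem_filter mem_iota; have -> : `|t|%N%:Z = t by lia.
      have -> : `|t|%N.+1%:Z = y by lia.
      by rewrite hs1 (negbTE hs2) /=; lia.
    rewrite /g; have -> : `|t|%N%:Z = t by lia.
    have -> : `|t|%N.+1%:Z = y by lia.
    by rewrite (negbTE hs2).
  move=> [y]; rewrite mem_filter mem_iota => /andP[hs hy] ->; split.
    by rewrite under_edge // /origin /g; case: ifP => _ /=; lia.
  rewrite /boundary_edge gA /=; move: hs; rewrite /g.
  by case: ifP => h /=; rewrite ?h //= => ->.
rewrite big_map /r big_filter (big_mkcond _ _) /=.
rewrite (eq_bigr (fun y => s (0, y%:Z) (+) s (0, y.+1%:Z))); last by move=> y _; case: (_ (+) _).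
rewrite (_ : 0%N :: iota 1 N = index_iota 0 N.+1) // big_mkord.
rewrite (big_addb_telescope (fun y => s (0, y%:Z))) so.
by case h : (s _) => //; have := sN _ h; rewrite in_box /=; lia.
Qed.

Lemma size_box N : (#|` box N| <= N.*2.+1 * N.*2.+1)%N.
Proof.
apply: (@size_columns _ (- N%:Z)); first exact: fset_uniq.
  by case=> a b; rewrite [_ \in _]in_box /=; lia.
by case=> [a b] [c d]; rewrite [_ \in _]in_box [X in _ -> is_true X -> _]in_box /=; lia.
Qed.

Record contour (s : vertex -> bool) (L : nat) (c : nat -> vertex * vertex) : Prop := Contour {
  contour_pos : (0 < L)%N;
  contour_closed : c L = c 0%N;
  contour_edge : forall i, boundary_edge s (c i);
  contour_next : forall i, edge_tail (c i.+1) = edge_head (c i);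
  contour_inj : {in gtn L &, injective c} }.

(** [next_edge] permutes the finite set of boundary edges, and its cycles are the contours; the
    length is bounded by the number of all candidate edges. *)
Lemma contour_exists (s : vertex -> bool) N : (forall v, s v -> v \in box N) -> s origin ->
  exists L c, [/\ contour s L c, (L <= (N.*2.+1 * N.*2.+1) * (N.+1.*2.+1 * N.+1.*2.+1))%N
    & inside (fun i => edge_tail (c i)) L origin].
Proof.
move=> sN so.
pose E : {fset vertex * vertex} := [fset e in (box N `*` box N.+1)%fset | boundary_edge s e]%fset.
have EE e : (e \in E) = boundary_edge s e.
  rewrite !inE /=; apply/andP/idP => [[]//|h]; split=> //.
  by case: e h => u v h; exact: boundary_in_box sN h.
pose f (x : E) : E := insubd x (next_edge s (val x)).
have bE (x : E) : boundary_edge s (val x) by rewrite -EE; exact: valP.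
have vf x : val (f x) = next_edge s (val x).
  by rewrite val_insubd EE boundary_next.
have fi : injective f.
  move=> x y /(congr1 val); rewrite !vf => h; apply: val_inj.
  by rewrite -(prev_next (bE x)) h prev_next.
have [x0 hx0] : exists x0, \big[addb/false]_(i < order f x0)
    under (edge_tail (val (iter i f x0))) (edge_head (val (iter i f x0))) origin.
  apply: (@odd_orbit _ f (fun x : E => under (edge_tail (val x)) (edge_head (val x)) origin)) => //.
  by rewrite -(big_seq_fsetE addb E xpredT (fun e => under (edge_tail e) (edge_head e) origin)) /=;
    exact: origin_parity sN so EE.
have cnext i : edge_tail (val (iter i.+1 f x0)) = edge_head (val (iter i f x0)).
  by rewrite iterS vf tail_next.
exists (order f x0), (fun i => val (iter i f x0)); split.
- split => //.
  + by rewrite iter_order.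
  + move=> i j hi hj /val_inj h.
    by rewrite -(findex_iter hi) -(findex_iter hj) h.
- apply: leq_trans (max_card _) _; rewrite -cardfE.
  apply: (@leq_trans (size [seq (u, v) | u <- box N, v <- box N.+1])).
    apply: uniq_leq_size; first exact: fset_uniq.
    case=> u v; rewrite -[_ \in _]/((u, v) \in E) EE => /(boundary_in_box sN) /andP[h1 h2].
    by apply/allpairsP; exists (u, v).
  by rewrite size_allpairs leq_mul // size_box.
- by rewrite /inside; under eq_bigr do rewrite cnext.
Qed.

(** * Interior of a contour modulo 2 *)

Section Interior.
Variables (s : vertex -> bool) (L : nat) (c : nat -> vertex * vertex).
Hypothesis cc : contour s L c.

Let phi i := edge_tail (c i).
Let A := inside phi L.
Let adjc i : adj (c i).1 (c i).2.
Proof. by have /and3P[] := contour_edge cc i. Qed.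

Lemma contour_interiorE v : A v = \big[addb/false]_(i < L) under (edge_tail (c i)) (edge_head (c i)) v.
Proof. by apply: eq_bigr => i _; rewrite /phi (contour_next cc). Qed.

Lemma contour_telescope (g : vertex -> bool) :
  \big[addb/false]_(i < L) (g (edge_tail (c i)) (+) g (edge_head (c i))) = false.
Proof.
under eq_bigr do rewrite -(contour_next cc).
by rewrite (big_addb_telescope (fun i => g (edge_tail (c i)))) (contour_closed cc) addbb.
Qed.

Lemma contour_step i : ((phi i.+1).1 - (phi i).1) ^+ 2 + ((phi i.+1).2 - (phi i).2) ^+ 2 <= 1.
Proof. by rewrite /phi (contour_next cc) tail_head_step. Qed.

Lemma interior_flip w w' : adj w w' -> A w (+) A w' =
  \big[addb/false]_(i < L) ((c i == (w, w')) || (c i == (w', w))).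
Proof.
have up u : A u (+) A (u.1, u.2 + 1) = \big[addb/false]_(i < L)
    ((c i == (u, (u.1, u.2 + 1))) || (c i == ((u.1, u.2 + 1), u))).
  rewrite !contour_interiorE -(@big_split _ false addb) /=.
  by apply: eq_bigr => i _; rewrite under_up.
have right u : A u (+) A (u.1 + 1, u.2) = \big[addb/false]_(i < L)
    ((c i == (u, (u.1 + 1, u.2))) || (c i == ((u.1 + 1, u.2), u))).
  (* A vanishing telescoping sum supplies the endpoint terms of [under_right]. *)
  rewrite !contour_interiorE -[LHS]addbF.
  rewrite -[X in _ (+) X](contour_telescope (fun p => (p.1 == u.1 + 1) && (u.2 < p.2))).
  rewrite -!(@big_split _ false addb) /=.
  by apply: eq_bigr => i _; rewrite under_right.
have swap (x y : vertex * vertex) i : (c i == x) || (c i == y) = (c i == y) || (c i == x) by rewrite orbC.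
case: w w' => [x y] [z t] h; case: (adj_cases h) => [[-> ->]|[[-> ->]|[[-> ->]|[-> ->]]]].
- exact: right (x, y).
- exact: up (x, y).
- by rewrite addbC; have /= -> := right (z, y); apply: eq_bigr => i _; rewrite swap.
- by rewrite addbC; have /= -> := up (x, t); apply: eq_bigr => i _; rewrite swap.
Qed.

Lemma interior_flip_same w w' : adj w w' -> s w = s w' -> A w = A w'.
Proof.
move=> h ss; have := interior_flip h; rewrite big1 => [|i _].
  by case: (A w); case: (A w').
have /and3P[_ h1 h2] := contour_edge cc i.
by apply/negbTE; rewrite negb_or; apply/andP; split; apply/eqP => e;
  move: h1 h2; rewrite e /= ss => ->.
Qed.

Lemma interior_flip_out w w' : adj w w' -> s w -> ~~ s w' ->
  A w (+) A w' = ((w, w') \in map c (iota 0 L)).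
Proof.
move=> h sw sw'; rewrite interior_flip // -(big_addb_mem _ (contour_inj cc)).
apply: eq_bigr => i _; have -> : (c i == (w', w)) = false; last by rewrite orbF.
by apply/eqP => e; have /and3P[_] := contour_edge cc i; rewrite e /= (negbTE sw').
Qed.

Lemma interior_in_box N v : (forall v, s v -> v \in box N) -> A v -> v \in box N.
Proof.
move=> sN; case: v => a b; rewrite contour_interiorE in_box /=.
have edge i : `|(c i).1.1| <= N%:Z /\ `|(c i).1.2| <= N%:Z.
  have /and3P[_ /sN + _] := contour_edge cc i; rewrite in_box.
  by case: (c i).1 => x y /=; lia.
have out : (forall i, under (edge_tail (c i)) (edge_head (c i)) (a, b) = false) ->
    \big[addb/false]_(i < L) under (edge_tail (c i)) (edge_head (c i)) (a, b) = false.
  by move=> h; rewrite big1.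
have [ha|ha] := leP `|a| N%:Z; last first.
  rewrite out // => i; rewrite under_edge //; have [] := edge i.
  by case: (c i) (adjc i) => [[x y] [z t]] /= hh; have := adj_cases hh; lia.
have [hb|hb] := leP b N%:Z; last first.
  rewrite out // => i; rewrite under_edge //; have [] := edge i.
  by case: (c i) (adjc i) => [[x y] [z t]] /= hh; have := adj_cases hh; lia.
have [hb'|hb'] := leP (- N%:Z) b; first by move=> _; lia.
(* Below the box the ray meets every edge that passes over it, and a closed walk crosses a vertical
   line an even number of times. *)
rewrite (eq_bigr (fun i : 'I_L => ((edge_tail (c i)).1 <= a) (+) ((edge_head (c i)).1 <= a))).
  by rewrite (contour_telescope (fun p => p.1 <= a)).
move=> i _; rewrite under_edge //; case: (tail_head_cases (adjc i)) => -[h -> ->];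
  by case: (c i) (edge i) h => [[x y] [z t]] /= [_ ?] [? ?]; lia.
Qed.

(** A contour of length L stays within distance L of its start. Were the start farther than L from
    the origin, the contour would lie to one side: to the left, to the right or below, no edge meets
    the ray; above, the number of edges met is even. *)
Lemma contour_near_origin : A origin -> (`|(phi 0%N).1| <= L%:Z) /\ (`|(phi 0%N).2| <= L%:Z).
Proof.
have lip i : (i <= L)%N -> (`|(phi i).1 - (phi 0%N).1| <= L%:Z) /\ (`|(phi i).2 - (phi 0%N).2| <= L%:Z).
  move=> iL; have [] := walk_lipschitz contour_step 0 i; rewrite add0n; lia.
rewrite contour_interiorE => hA.
have nz (F : nat -> bool) : \big[addb/false]_(i < L) F i -> (forall i, (i < L)%N -> F i = false) -> False.
  by move=> + F0; rewrite big1 // => i _; exact: F0.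
have lip2 i : (i < L)%N -> [/\ `|(edge_tail (c i)).1 - (phi 0%N).1| <= L%:Z, `|(edge_tail (c i)).2 - (phi 0%N).2| <= L%:Z,
   `|(edge_head (c i)).1 - (phi 0%N).1| <= L%:Z & `|(edge_head (c i)).2 - (phi 0%N).2| <= L%:Z].
  by move=> iL; rewrite -(contour_next cc); have [] := lip i (ltnW iL); have [] := lip i.+1 iL.
have hor i : under (edge_tail (c i)) (edge_head (c i)) origin = 
  [&& (edge_tail (c i)).2 == (edge_head (c i)).2, 0 < (edge_tail (c i)).2 & ((edge_tail (c i)).1 <= 0) (+) ((edge_head (c i)).1 <= 0)].
  rewrite under_edge // /origin; case: (tail_head_cases (adjc i)) => -[he -> ->];
  by case: (c i) he => [[x y] [z t]] /= [? ?]; lia.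
split; rewrite leNgt; apply/negP => hL.
  apply: (nz (fun i => under (edge_tail (c i)) (edge_head (c i)) origin) hA) => i iL; rewrite hor; have [] := lip2 _ iL; lia.
have [h2|h2] := leP (phi 0%N).2 0.
  apply: (nz (fun i => under (edge_tail (c i)) (edge_head (c i)) origin) hA) => i iL; rewrite hor; have [] := lip2 _ iL; lia.
suff E : \big[addb/false]_(i < L) under (edge_tail (c i)) (edge_head (c i)) origin = false by rewrite E in hA.
rewrite -[RHS](contour_telescope (fun p => p.1 <= 0)); apply: eq_bigr => i _.
rewrite hor; have [_ t2 _ h2'] := lip2 i (ltn_ord i).
have ver : (edge_tail (c i)).2 != (edge_head (c i)).2 -> (edge_tail (c i)).1 = (edge_head (c i)).1.
  by case: (tail_head_cases (adjc i)) => -[h -> ->]; case: (c i) h => [[x y] [z t]] /= [? ?]; lia.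
have -> : 0 < (edge_tail (c i)).2 by lia.
by have [|/ver ->] := eqVneq; rewrite //= addbb.
Qed.
End Interior.

(** * Energy gained by flipping the inside of a contour *)

Definition disagree (b : bool) N (s : config N) (v : vertex) : bool :=
  if insub v is Some u then s u (+) b else false.

Lemma disagree_val b N (s : config N) (u : box N) : disagree b s (val u) = s u (+) b.
Proof. by rewrite /disagree valK. Qed.

Lemma disagree_in_box b N (s : config N) v : disagree b s v -> v \in box N.
Proof. by rewrite /disagree; case: insubP. Qed.

Lemma disagree_out b N (s : config N) v : v \notin box N -> disagree b s v = false.
Proof. by move=> h; apply/negbTE; apply: contra h; exact: disagree_in_box. Qed.

Definition flip_config (A : pred vertex) N (s : config N) : config N :=
  [ffun u => s u (+) A (val u)].

Lemma flip_configK A N : involutive (@flip_config A N).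
Proof. by move=> s; apply/ffunP => u; rewrite !ffunE -addbA addbb addbF. Qed.

Section Flip.
Variable R : realType.

Definition flip_field (A : pred vertex) (eta : vertex -> R) (v : vertex) : R :=
  if A v then - eta v else eta v.

Lemma sum_pairs_mem (X Y : seq vertex) (S : seq (vertex * vertex)) :
  uniq X -> uniq Y -> uniq S -> (forall e, e \in S -> (e.1 \in X) && (e.2 \in Y)) ->
  \sum_(u <- X) \sum_(v <- Y) ((u, v) \in S)%:R = (size S)%:R :> R.
Proof.
move=> uX uY uS sub.
transitivity (\sum_(p <- [seq (u, v) | u <- X, v <- Y]) (p \in S)%:R : R).
  by rewrite big_allpairs_dep.
rewrite -natr_sum; congr _%:R.
transitivity (count (mem S) [seq (u, v) | u <- X, v <- Y]).
  by rewrite -sum1_count [RHS]big_mkcond /=; apply: eq_bigr => p _; case: (_ \in _).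
rewrite -size_filter; apply: perm_size; apply: uniq_perm => //.
  by rewrite filter_uniq // allpairs_uniq // => -[? ?] [? ?].
move=> p; rewrite mem_filter andb_idr // => /sub /andP[h1 h2].
by apply/allpairsP; exists p; case: p h1 h2.
Qed.

Lemma spin_addb (x y : bool) : spin (x (+) y) = (if y then - spin x else spin x) :> R.
Proof. by case: x; case: y; rewrite /spin /= ?opprK. Qed.

Lemma adjC u v : adj u v = adj v u.
Proof. by case: u v => [x y] [z t]; rewrite /adj /=; lia. Qed.

Variables (b : bool) (N : nat) (s : config N) (L : nat) (c : nat -> vertex * vertex).
Hypothesis cc : contour (disagree b s) L c.
Let S := map c (iota 0 L).
Let A : pred vertex := inside (fun i => edge_tail (c i)) L.
Let e (u v : vertex) : R := ((u, v) \in S)%:R.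

Lemma contour_mem u v : (u, v) \in S -> boundary_edge (disagree b s) (u, v).
Proof. by move=> /mapP[i _ ->]; exact: (contour_edge cc). Qed.

Lemma contour_mem0 u v : ~~ disagree b s u || disagree b s v -> e u v = 0.
Proof.
rewrite /e; case h : (_ \in S) => //; have /and3P[_ /= -> h2] := contour_mem h.
by rewrite (negbTE h2).
Qed.

(** A contour edge separates a disagreeing vertex from an agreeing one, so its bond passes from -1
    to 1; any other bond has both ends flipped or neither. *)
Lemma flip_bond (u v : box N) : adj (val u) (val v) ->
  spin (flip_config A s u) * spin (flip_config A s v) =
  spin (s u) * spin (s v) + 2 * (e (val u) (val v) + e (val v) (val u)) :> R.
Proof.
move=> h; have h' : adj (val v) (val u) by rewrite adjC.
rewrite !ffunE !spin_addb -/A.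
case du : (disagree b s (val u)); case dv : (disagree b s (val v)).
- rewrite !contour_mem0 ?du ?dv // (_ : A (val u) = A (val v)); last first.
    by apply: (interior_flip_same cc h); rewrite du.
  by case: (A _); ring.
- rewrite (contour_mem0 (u := val v)) ?dv // /e -(interior_flip_out cc h) ?du ?dv // -/A.
  move: du dv; rewrite !disagree_val => du dv.
  have -> : s u = ~~ s v by case: (s u) (s v) b du dv => [] [] [].
  by case: (A _); case: (A _); case: (s v); rewrite /spin /=; ring.
- rewrite (contour_mem0 (u := val u)) ?du // /e -(interior_flip_out cc h') ?du ?dv // -/A.
  move: du dv; rewrite !disagree_val => du dv.
  have -> : s u = ~~ s v by case: (s u) (s v) b du dv => [] [] [].
  by case: (A _); case: (A _); case: (s v); rewrite /spin /=; ring.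
- rewrite !contour_mem0 ?du ?dv // (_ : A (val u) = A (val v)); last first.
    by apply: (interior_flip_same cc h); rewrite du.
  by case: (A _); ring.
Qed.

Lemma flip_boundary_bond (u : box N) v : v \notin box N -> adj (val u) v ->
  spin b * spin (flip_config A s u) = spin b * spin (s u) + 2 * e (val u) v :> R.
Proof.
move=> vN h; have dv := disagree_out b s vN.
have Av : A v = false.
  apply/negbTE; apply: contra vN; apply: (interior_in_box cc) => w; exact: disagree_in_box.
rewrite ffunE spin_addb -/A.
case du : (disagree b s (val u)).
  rewrite /e -(interior_flip_out cc h) ?du ?dv // -/A Av addbF.
  move: du; rewrite disagree_val => du.
  have -> : s u = ~~ b by case: (s u) b du => [] [].
  by case: (A _); case: b; rewrite /spin /=; ring.
rewrite contour_mem0 ?du // (_ : A (val u) = false); first by ring.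
by rewrite -Av; apply: (interior_flip_same cc h); rewrite du dv.
Qed.

(** Every contour edge is counted once: inside the box by half of the sum over ordered pairs, across
    the boundary of the box by the second sum. *)
Lemma contour_energy :
  2^-1 * (\sum_(u : box N) \sum_(v : box N | adj (val u) (val v))
    (e (val u) (val v) + e (val v) (val u)))
  + \sum_(u : box N) \sum_(v : box N.+1 | (val v \notin box N) && adj (val u) (val v))
      e (val u) (val v) = L%:R :> R.
Proof.
have -> : \sum_(u : box N) \sum_(v : box N | adj (val u) (val v)) (e (val u) (val v) + e (val v) (val u))
   = 2 * \sum_(u : box N) \sum_(v : box N | adj (val u) (val v)) e (val u) (val v).
  under eq_bigr do rewrite big_split /=.
  rewrite big_split /= mulr_natl mulr2n; congr (_ + _).
  rewrite (exchange_big_dep xpredT) //=; apply: eq_bigr => u _; apply: eq_bigl => v.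
  by rewrite adjC.
rewrite mulKf ?pnatr_eq0 //.
have noadj u v : ~~ adj u v -> e u v = 0.
  by move=> h; rewrite /e; case h2 : (_ \in S) => //; have /and3P[/= h3] := contour_mem h2; rewrite h3 in h.
have dropadj (X : {fset vertex}) (P : pred vertex) u :
    \sum_(v : X | P (val v) && adj u (val v)) e u (val v) = \sum_(v <- X | P v) e u v.
  rewrite big_seq_fsetE /= big_mkcond /= [RHS]big_mkcond /=; apply: eq_bigr => v _.
  by case: (P _) => //=; case: ifP => // /negbT /noadj ->.
under eq_bigr do rewrite (dropadj _ xpredT).
under [X in _ + X]eq_bigr do rewrite (dropadj _ (fun v => v \notin box N)).
rewrite -big_split /=.
have sz : size S = L by rewrite size_map size_iota.
rewrite -sz -(@sum_pairs_mem (box N) (box N.+1)); last 4 first.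
- exact: fset_uniq.
- exact: fset_uniq.
- rewrite map_inj_in_uniq ?iota_uniq // => i j; rewrite !mem_iota => hi hj.
  by apply: (contour_inj cc); rewrite inE.
- move=> p pS; apply: (boundary_in_box (s := disagree b s)) => [v|]; first exact: disagree_in_box.
  by case: p pS => u v; exact: contour_mem.
rewrite (big_seq_fsetE _ (box N)) /=; apply: eq_bigr => u _.
rewrite [RHS](bigID (fun v => v \in box N)) /=; congr (_ + _).
rewrite -[RHS]big_filter; apply: perm_big; apply: uniq_perm; rewrite ?filter_uniq ?fset_uniq //.
move=> v; rewrite mem_filter andb_idr // => h.
by move: h; rewrite -[_ \in _]/(v \in box N) -[X in _ -> is_true X]/(v \in box N.+1) !in_box; lia.
Qed.

Lemma hamiltonian_flip (eta : vertex -> R) :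
  hamiltonian b (flip_field A eta) (flip_config A s) = hamiltonian b eta s - 2 * L%:R.
Proof.
rewrite /hamiltonian -contour_energy.
have -> : \sum_(u : box N) flip_field A eta (val u) * spin (flip_config A s u)
   = \sum_(u : box N) eta (val u) * spin (s u).
  apply: eq_bigr => u _; rewrite ffunE spin_addb /flip_field.
  by case: (A _); rewrite ?mulrNN.
have -> : \sum_(u : box N) \sum_(v : box N | adj (val u) (val v))
     spin (flip_config A s u) * spin (flip_config A s v) =
   \sum_(u : box N) \sum_(v : box N | adj (val u) (val v)) spin (s u) * spin (s v) +
   2 * \sum_(u : box N) \sum_(v : box N | adj (val u) (val v)) (e (val u) (val v) + e (val v) (val u)) :> R.
  rewrite mulr_sumr -big_split /=; apply: eq_bigr => u _.
  rewrite mulr_sumr -big_split /=; apply: eq_bigr => v h; exact: flip_bond.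
have -> : spin b * (\sum_(u : box N) \sum_(v : box N.+1 | (val v \notin box N) && adj (val u) (val v))
     spin (flip_config A s u)) =
   spin b * (\sum_(u : box N) \sum_(v : box N.+1 | (val v \notin box N) && adj (val u) (val v))
     spin (s u)) +
   2 * \sum_(u : box N) \sum_(v : box N.+1 | (val v \notin box N) && adj (val u) (val v)) e (val u) (val v) :> R.
  rewrite mulr_sumr mulr_sumr mulr_sumr -big_split /=; apply: eq_bigr => u _.
  rewrite !mulr_sumr -big_split /=; apply: eq_bigr => v /andP[h1 h2]; exact: flip_boundary_bond.
move: (\sum_(u : box N) _) (\sum_(u : box N) _) (spin b * _) (\sum_(u : box N) _) (\sum_(u : box N) _) => x1 x2 x3 x4 x5.
by field.
Qed.
End Flip.

(** * Free energy and the Peierls argument *)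

(** A starting point in [-a, a]^2 followed by M increments in [-m, m]^2. *)
Definition walk_code (a m M : nat) : finType :=
  ((('I_a.*2.+1 * 'I_a.*2.+1) * {ffun 'I_M -> 'I_m.*2.+1 * 'I_m.*2.+1})%type : finType).

Definition decode a m M (w : walk_code a m M) (j : nat) : vertex :=
  ((w.1.1)%:Z - a%:Z + \sum_(i < M | (i < j)%N) ((w.2 i).1%:Z - m%:Z),
   (w.1.2)%:Z - a%:Z + \sum_(i < M | (i < j)%N) ((w.2 i).2%:Z - m%:Z)).

Lemma card_walk_code a m M :
  #|walk_code a m M| = ((a.*2.+1 * a.*2.+1) * (m.*2.+1 * m.*2.+1) ^ M)%N.
Proof. by rewrite !card_prod card_ffun card_prod !card_ord. Qed.

Lemma decode_surj a m M (f : nat -> vertex) :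
  `|(f 0%N).1| <= a%:Z -> `|(f 0%N).2| <= a%:Z ->
  (forall j, (j < M)%N -> `|(f j.+1).1 - (f j).1| <= m%:Z) ->
  (forall j, (j < M)%N -> `|(f j.+1).2 - (f j).2| <= m%:Z) ->
  exists w : walk_code a m M, forall j, (j <= M)%N -> decode w j = f j.
Proof.
move=> h1 h2 s1 s2.
have ordE n (x : int) : `|x| <= n%:Z -> exists i : 'I_n.*2.+1, (i : nat)%:Z - n%:Z = x.
  move=> hx; have hi : (absz (x + n%:Z)%R < n.*2.+1)%N by lia.
  by exists (Ordinal hi) => /=; lia.
have [i1 e1] := ordE _ _ h1; have [i2 e2] := ordE _ _ h2.
have steps (i : 'I_M) : exists p : 'I_m.*2.+1 * 'I_m.*2.+1,
    (p.1 : nat)%:Z - m%:Z = (f i.+1).1 - (f i).1 /\ (p.2 : nat)%:Z - m%:Z = (f i.+1).2 - (f i).2.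
  have [p1 hp1] := ordE _ _ (s1 i (ltn_ord i)); have [p2 hp2] := ordE _ _ (s2 i (ltn_ord i)).
  by exists (p1, p2).
have [g hg] := choice steps.
exists ((i1, i2), [ffun i => g i]) => j jM; rewrite /decode /= e1 e2.
have tel (F : nat -> int) : \sum_(i < M | (i < j)%N) (F i.+1 - F i) = F j - F 0%N.
  by rewrite -(big_ord_widen M (fun i => F i.+1 - F i) jM) -(big_mkord xpredT (fun i => F i.+1 - F i)) telescope_sumr.
under eq_bigr do rewrite ffunE (hg _).1.
under [X in (_, _ + X)]eq_bigr do rewrite ffunE (hg _).2.
rewrite (tel (fun i => (f i).1)) (tel (fun i => (f i).2)).
by case: (f j) (f 0%N) => [x y] [z t] /=; congr pair; ring.
Qed.

Section FreeEnergy.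
Variable R : realType.
Variables (temp : R) (b : bool) (N : nat).
Hypothesis temp_ge0 : 0 <= temp.

Definition partition_function (eta : vertex -> R) : R :=
  \sum_(s : config N) expR (- temp^-1 * hamiltonian b eta s).

Definition ground_state (eta : vertex -> R) : config N :=
  [arg min_(t < ([ffun=> true] : config N)) hamiltonian (N := N) b eta t]%O.

Definition free_energy (eta : vertex -> R) : R :=
  if temp == 0 then - hamiltonian b eta (ground_state eta)
  else temp * ln (partition_function eta).

Lemma ground_stateP (eta : vertex -> R) (t : config N) : hamiltonian b eta (ground_state eta) <= hamiltonian b eta t.
Proof. by rewrite /ground_state; case: arg_minP => // i _; exact. Qed.

Lemma partition_function_gt0 eta : 0 < partition_function eta.
Proof.
rewrite /partition_function (bigD1 [ffun=> true]) //= ltr_pwDl ?expR_gt0 //.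
by apply: sumr_ge0 => s _; rewrite expR_ge0.
Qed.

Lemma hamiltonian_field (eta eta' : vertex -> R) (s : config N) :
  hamiltonian b eta s - hamiltonian b eta' s <= \sum_(v : box N) `|eta (val v) - eta' (val v)|.
Proof.
rewrite /hamiltonian.
have -> (x y z z' : R) : - (x + y + z) - - (x + y + z') = z' - z by ring.
rewrite -sumrB; apply: ler_sum => v _; rewrite -mulrBl distrC.
by apply: le_trans (ler_norm _) _; rewrite normrM /spin; case: (s v); rewrite ?normrN1 ?normr1 mulr1.
Qed.

Lemma free_energy_lipschitz (eta eta' : vertex -> R) :
  free_energy eta - free_energy eta' <= \sum_(v : box N) `|eta (val v) - eta' (val v)|.
Proof.
have dC : \sum_(v : box N) `|eta (val v) - eta' (val v)| = \sum_(v : box N) `|eta' (val v) - eta (val v)|.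
  by apply: eq_bigr => v _; rewrite distrC.
rewrite /free_energy; have [_|t0] := eqVneq temp 0.
  have := hamiltonian_field eta' eta (ground_state eta).
  have := ground_stateP eta' (ground_state eta); rewrite dC; lra.
have T0 : 0 < temp by rewrite lt_def t0.
rewrite -mulrBr -ler_pdivlMl // lerBlDr -[X in X + _]expRK -lnM ?posrE ?expR_gt0 ?partition_function_gt0 //.
rewrite ler_ln ?posrE ?mulr_gt0 ?expR_gt0 ?partition_function_gt0 //.
rewrite /partition_function mulr_sumr; apply: ler_sum => s _.
rewrite -expRD ler_expR !mulNr lerNl opprD opprK addrC lerBlDr -lerBlDl -mulrBr.
by rewrite ler_pM2l ?invr_gt0 // dC hamiltonian_field.
Qed.

Definition contour_weight : R := if temp == 0 then 0 else expR (- temp^-1).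

Lemma contour_weight_ge0 : 0 <= contour_weight.
Proof. by rewrite /contour_weight; case: ifP => // _; rewrite expR_ge0. Qed.

Lemma gibbs_ge0 (eta : vertex -> R) (s : config N) : 0 <= gibbs temp b eta s.
Proof.
rewrite /gibbs; case: ifP => _; rewrite divr_ge0 ?expR_ge0 //.
by apply: sumr_ge0 => t _; rewrite expR_ge0.
Qed.

Lemma gibbs_sum1 (eta : vertex -> R) : \sum_(s : config N) gibbs temp b eta s = 1.
Proof.
rewrite /gibbs; case: (temp == 0); rewrite -mulr_suml; last first.
  by rewrite divff // gt_eqF // partition_function_gt0.
have -> : \sum_(s : config N) (s \in ground_states b N eta)%:R = #|ground_states b N eta|%:R :> R.
  by rewrite -natr_sum -sum1_card [in RHS]big_mkcond; congr _%:R; apply: eq_bigr => s _; case: ifP.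
rewrite divff // pnatr_eq0 -lt0n; apply/card_gt0P.
exists (ground_state eta); rewrite inE; apply/forallP => t; exact: ground_stateP.
Qed.

(** For positive temperature the images under the injective [tau] have total weight at most Z(eta'),
    so the sum is at most exp (- 2 L / T) Z(eta') / Z(eta), and the assumption on the free energy
    gives back only exp (L / T). At temperature 0 a ground state in Q would push the ground energy
    for eta' lower than the assumption allows. *)
Lemma gibbs_flip (Q : pred (config N)) (tau : config N -> config N)
    (eta eta' : vertex -> R) (L : nat) :
  injective tau -> (0 < L)%N ->
  (forall s, Q s -> hamiltonian b eta' (tau s) <= hamiltonian b eta s - 2 * L%:R) ->
  free_energy eta' <= free_energy eta + L%:R ->
  \sum_(s | Q s) gibbs temp b eta s <= contour_weight ^+ L.
Proof.
move=> tauI L0 HQ; rewrite /free_energy /contour_weight /gibbs.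
have [_|t0] := eqVneq temp 0 => hF.
  rewrite big1 ?exprn_ge0 // => s Qs; case: (boolP (s \in _)); rewrite ?mul0r // inE => /forallP hs.
  have := HQ _ Qs; have := ground_stateP eta' (tau s); have := hs (ground_state eta).
  have : (1 : R) <= L%:R by rewrite ler1n.
  lra.
have T0 : 0 < temp by rewrite lt_def t0.
rewrite -mulr_suml ler_pdivrMr ?partition_function_gt0 //.
have hZ : partition_function eta' <= expR (temp^-1 * L%:R) * partition_function eta.
  rewrite -ler_ln ?posrE ?mulr_gt0 ?expR_gt0 ?partition_function_gt0 //.
  rewrite lnM ?posrE ?expR_gt0 ?partition_function_gt0 // expRK -(ler_pM2l T0).
  by rewrite mulrDr mulrA divff // mul1r addrC.
have e1 : expR (- temp^-1) ^+ L = expR (- temp^-1 * (2 * L%:R)) * expR (temp^-1 * L%:R).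
  by rewrite -expRM_natl -expRD; congr expR; ring.
rewrite e1 -mulrA; apply: (@le_trans _ _ (expR (- temp^-1 * (2 * L%:R)) * partition_function eta')); last first.
  by rewrite ler_pM2l ?expR_gt0.
rewrite /partition_function mulr_sumr.
apply: (@le_trans _ _ (\sum_(s | Q s) expR (- temp^-1 * (2 * L%:R)) * expR (- temp^-1 * hamiltonian b eta' (tau s)))).
  apply: ler_sum => s Qs; rewrite -expRD ler_expR -mulrDr !mulNr lerN2 ler_pM2l ?invr_gt0 //.
  by have := HQ _ Qs; lra.
rewrite [leRHS](reindex_onto tau (finv tau)) /=; last by move=> s _; rewrite f_finv.
rewrite [leLHS]big_mkcond; rewrite [leRHS]big_mkcond; apply: ler_sum => s _.
rewrite finv_f // eqxx; case: ifP => _ //; by rewrite mulr_ge0 ?expR_ge0.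
Qed.

(** A closed walk of length L has at most (2L + 1)^2 <= 9^L starting points and 9 possible
    increments at each step, hence 81^L codes; the geometric series of ratio at most 1/2 doubles its
    first term. *)
Lemma peierls (eta : vertex -> R) Lmax :
  ((N.*2.+1 * N.*2.+1) * (N.+1.*2.+1 * N.+1.*2.+1) <= Lmax)%N ->
  (forall L phi, (0 < L)%N -> (L <= Lmax)%N -> phi L = phi 0%N ->
     `|(phi 0%N).1| <= L%:Z -> `|(phi 0%N).2| <= L%:Z ->
     (forall i, ((phi i.+1).1 - (phi i).1) ^+ 2 + ((phi i.+1).2 - (phi i).2) ^+ 2 <= 1) ->
     free_energy (flip_field (inside phi L) eta) <= free_energy eta + L%:R) ->
  81 * contour_weight <= 1 / 2 ->
  \sum_(s : config N | s [` origin_in_box N]%fset != b) gibbs temp b eta s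
  <= 162 * contour_weight.
Proof.
move=> hLmax good q81.
pose Q (L : nat) (w : walk_code L 1 L) (s : config N) := `[< exists c,
  [/\ contour (disagree b s) L c, forall j, (j <= L)%N -> decode w j = edge_tail (c j)
    & inside (fun i => edge_tail (c i)) L origin] >].
have cover (s : config N) : s [` origin_in_box N]%fset != b ->
    exists (L : 'I_Lmax.+1) (w : walk_code L 1 L), Q L w s.
  move=> so; have [] := @contour_exists (disagree b s) N.
  - by move=> v; exact: disagree_in_box.
  - have := disagree_val b s [` origin_in_box N]%fset; rewrite /= => ->.
    by case: (s _) b so => [] [].
  move=> L [c [cc cL cA]].
  have LL : (L < Lmax.+1)%N by rewrite ltnS (leq_trans cL).
  have [n1 n2] := contour_near_origin cc cA.
  have lip i : (`|(edge_tail (c i.+1)).1 - (edge_tail (c i)).1| <= 1%:Z) /\ (`|(edge_tail (c i.+1)).2 - (edge_tail (c i)).2| <= 1%:Z).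
    by have := walk_lipschitz (contour_step cc) i 1; rewrite addn1.
  have [w hw] := @decode_surj L 1 L (fun i => edge_tail (c i)) n1 n2
    (fun j _ => (lip j).1) (fun j _ => (lip j).2).
  by exists (Ordinal LL), w; apply/asboolP; exists c.
apply: (@le_trans _ _ (\sum_(L < Lmax.+1) \sum_(w : walk_code L 1 L) \sum_(s | Q L w s) gibbs temp b eta s)).
  under [leRHS]eq_bigr do rewrite (exchange_big_dep xpredT) //=.
  rewrite exchange_big /= big_mkcond; apply: ler_sum => s _.
  case: ifP => [/cover [L [w hw]]|_]; last first.
    by do 2![apply: sumr_ge0 => ? _]; exact: gibbs_ge0.
  rewrite (bigD1 L) //= (bigD1 w) //= -addrA lerDl addr_ge0 //.
    by apply: sumr_ge0 => ? _; exact: gibbs_ge0.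
  by do 2![apply: sumr_ge0 => ? _]; exact: gibbs_ge0.
apply: (@le_trans _ _ (\sum_(L < Lmax.+1 | (0 < L)%N) (81 * contour_weight) ^+ L)).
  rewrite [leRHS]big_mkcond; apply: ler_sum => L _.
  have hQ w : \sum_(s | Q L w s) gibbs temp b eta s <= if (0 < L)%N then contour_weight ^+ L else 0.
    have [h|h] := pselect (exists s, Q L w s); last first.
      rewrite big1 => [|s Qs]; last by case: h; exists s.
      by case: ifP => // _; rewrite exprn_ge0 // contour_weight_ge0.
    have [s0 /asboolP [c0 [cc0 w0 A0]]] := h.
    rewrite (contour_pos cc0).
    (* The interior is determined by the code alone, so a single involution serves all the
       configurations that share it. *)
    have polyE (c : nat -> vertex * vertex) : (forall j, (j <= L)%N -> decode w j = edge_tail (c j)) ->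
        inside (fun i => edge_tail (c i)) L = inside (decode w) L.
      move=> hc; apply/funext => v; apply: eq_bigr => j _.
      by rewrite !hc // ltnW.
    apply: (@gibbs_flip _ (@flip_config (inside (decode w) L) N) _ (flip_field (inside (decode w) L) eta)).
    - exact: inv_inj (@flip_configK _ _).
    - exact: contour_pos cc0.
    - move=> s /asboolP [c [cc hw _]]; rewrite -(polyE c) // (hamiltonian_flip cc) //.
    - rewrite -(polyE c0) //; have [n1 n2] := contour_near_origin cc0 A0.
      apply: (good L (fun i => edge_tail (c0 i))) => //.
      + exact: contour_pos cc0.
      + by rewrite -ltnS.
      + by rewrite (contour_closed cc0).
      + exact: contour_step cc0.
  case: ifP hQ => L0 hQ; last by rewrite (le_trans (ler_sum _ (fun w _ => hQ w))) // big1.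
  apply: le_trans (ler_sum _ (fun w _ => hQ w)) _.
  rewrite sumr_const card_walk_code -[_ *+ _]mulr_natl exprMn ler_wpM2r ?exprn_ge0 ?contour_weight_ge0 //.
  rewrite -natrX ler_nat (_ : 81 ^ L = 3 ^ L * 3 ^ L * (1.*2.+1 * 1.*2.+1) ^ L)%N; last by rewrite -!expnMn.
  have e (n : nat) : (n.*2.+1 <= 3 ^ n)%N.
    by elim: n => // n IH; rewrite expnS doubleS; lia.
  by rewrite leq_mul2r leq_mul ?orbT.
set q := 81 * contour_weight in q81 *.
have q0 : 0 <= q by rewrite mulr_ge0 // contour_weight_ge0.
have -> : 162 * contour_weight = 2 * q by rewrite /q; ring.
(* The added term dominates the rest of the series, and lets the induction close. *)
have geo n : \sum_(L < n.+1 | (0 < L)%N) q ^+ L + 2 * q ^+ n.+1 <= 2 * q.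
  elim: n => [|n IH]; first by rewrite big_mkcond big_ord_recr big_ord0 /= !add0r expr1.
  apply: le_trans IH; rewrite big_mkcond big_ord_recr /= -big_mkcond -addrA lerD2l.
  by rewrite (exprS _ n.+1); have := exprn_ge0 n.+1 q0; nra.
by apply: le_trans (geo Lmax); rewrite lerDl mulr_ge0 // exprn_ge0.
Qed.
End FreeEnergy.

(** * Sub-Gaussian increments *)

Section SubGaussian.
Variables (R : realType) (I V : finType) (p x : V -> R) (neg : V -> V).
Hypothesis p_ge0 : forall y, 0 <= p y.
Hypothesis p_sum1 : \sum_y p y = 1.
Hypothesis p_mgf : forall l, \sum_y p y * expR (l * x y) <= expR (l ^+ 2 / 2).
Hypothesis negK : involutive neg.
Hypothesis p_neg : forall y, p (neg y) = p y.

Lemma cosh_le (s t : R) : `|t| <= s -> expR t + expR (- t) <= expR s + expR (- s).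
Proof.
wlog t0 : t / 0 <= t => [H|].
  have [t0|t0] := leP 0 t; first exact: H.
  by rewrite -normrN => h; have := H (- t); rewrite opprK addrC; apply => //; lra.
rewrite ger0_norm // => ts; rewrite -subr_ge0.
have -> : expR s + expR (- s) - (expR t + expR (- t)) = (expR s - expR t) * (1 - expR (- s) * expR (- t)).
  rewrite [RHS](_ : _ = expR s - expR t - (expR s * expR (- s)) * expR (- t)
    + (expR t * expR (- t)) * expR (- s)); last by ring.
  by rewrite !expRxMexpNx_1; ring.
rewrite mulr_ge0 ?subr_ge0 ?ler_expR // -expRD -[leRHS]expR0 ler_expR; lra.
Qed.

(* Jensen's inequality compares f with its value at an independent copy; the
   difference is symmetric, so only its hyperbolic cosine matters. *)
Lemma mgf_average (f : V -> R) (l c : R) : 0 <= c ->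
  (forall y y', `|f y - f y'| <= c * `|x y - x y'|) ->
  \sum_y p y * expR (l * f y) <= expR (l ^+ 2 * c ^+ 2) * expR (l * \sum_y p y * f y).
Proof.
move=> c0 lip; set m := \sum_y p y * f y.
rewrite -ler_pdivrMr ?expR_gt0 // -expRN.
have jensen : expR (- (l * m)) <= \sum_y p y * expR (- (l * f y)).
  apply: (@le_trans _ _ (\sum_y p y * (expR (- (l * m)) * (1 + (l * m - l * f y))))).
    have -> : \sum_y p y * (expR (- (l * m)) * (1 + (l * m - l * f y))) =
       expR (- (l * m)) * (\sum_y (p y * (1 + l * m) - l * (p y * f y))).
      by rewrite mulr_sumr; apply: eq_bigr => y _; ring.
    by rewrite sumrB -mulr_suml -mulr_sumr p_sum1 -/m mul1r addrK mulr1.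
  apply: ler_sum => y _; rewrite ler_wpM2l //.
  rewrite [leRHS](_ : _ = expR (- (l * m)) * expR (l * m - l * f y)).
    by rewrite ler_pM2l ?expR_gt0 // expR_ge1Dx.
  by rewrite -expRD; congr expR; ring.
apply: (@le_trans _ _ ((\sum_y p y * expR (l * f y)) * (\sum_y p y * expR (- (l * f y))))).
  rewrite ler_wpM2l // sumr_ge0 // => y _; by rewrite mulr_ge0 // expR_ge0.
have dbl (g : V -> R) (k : R) : (\sum_y p y * expR (k * g y)) * (\sum_y p y * expR (- (k * g y))) =
    2^-1 * \sum_y \sum_y' p y * p y' * (expR (k * (g y - g y')) + expR (- (k * (g y - g y')))).
  have e : (\sum_y p y * expR (k * g y)) * (\sum_y p y * expR (- (k * g y))) =
      \sum_y \sum_y' p y * p y' * expR (k * (g y - g y')).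
    rewrite mulr_suml; apply: eq_bigr => y _; rewrite mulr_sumr; apply: eq_bigr => y' _.
    by rewrite mulrBr expRD; ring.
  have e' : \sum_y \sum_y' p y * p y' * expR (- (k * (g y - g y'))) =
      \sum_y \sum_y' p y * p y' * expR (k * (g y - g y')).
    rewrite exchange_big /=; apply: eq_bigr => y _; apply: eq_bigr => y' _.
    by rewrite mulrC [p y * _]mulrC mulrC -mulrN opprB.
  under [in RHS]eq_bigr do (under eq_bigr do rewrite mulrDr; rewrite big_split /=).
  rewrite big_split /= e' e; set z := (X in 2^-1 * (_ + X)).
  by rewrite -[X in 2^-1 * (X + _)]/z -[LHS]/z; lra.
rewrite dbl; apply: (@le_trans _ _ (2^-1 * \sum_y \sum_y' p y * p y' *
    (expR (l * c * (x y - x y')) + expR (- (l * c * (x y - x y')))))).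
  rewrite ler_wpM2l // ?invr_ge0 //; apply: ler_sum => y _; apply: ler_sum => y' _.
  rewrite ler_wpM2l // ?mulr_ge0 //.
  have cosh_abs (t : R) : expR t + expR (- t) = expR `|t| + expR (- `|t|).
    by have [_|_] := ger0P t; rewrite ?opprK // addrC.
  rewrite [leRHS]cosh_abs; apply: cosh_le; rewrite !normrM -mulrA ler_wpM2l //.
  by rewrite [ `|c| ]ger0_norm.
rewrite -(dbl x); have -> : l ^+ 2 * c ^+ 2 = (l * c) ^+ 2 / 2 + (l * c) ^+ 2 / 2 by field.
rewrite expRD; apply: ler_pM.
- by apply: sumr_ge0 => y _; rewrite mulr_ge0 // expR_ge0.
- by apply: sumr_ge0 => y _; rewrite mulr_ge0 // expR_ge0.
- exact: p_mgf.
- have := p_mgf (- (l * c)); rewrite sqrrN; apply: le_trans; apply: ler_sum => y _.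
  by rewrite mulNr.
Qed.

Local Notation state := {ffun I -> V}.
Implicit Types (a : state) (F G Phi : state -> R).

Definition weight a : R := \prod_i p (a i).
Definition mean Phi : R := \sum_a weight a * Phi a.
Definition update a i y : state := [ffun j => if j == i then y else a j].
Definition average i Phi a : R := \sum_y p y * Phi (update a i y).
Definition averages (D : seq I) Phi : state -> R := foldl (fun Phi i => average i Phi) Phi D.
Definition lipschitz c F := forall a i y y', `|F (update a i y) - F (update a i y')| <= c * `|x y - x y'|.
Definition ignores (D : pred I) G := forall a a', (forall i, ~~ D i -> a i = a' i) -> G a = G a'.

Lemma weight_ge0 a : 0 <= weight a. Proof. exact: prodr_ge0. Qed.

(** Exchanging the i-th coordinate with an independent copy preserves the product weight. *)
Lemma mean_average i Phi : mean (average i Phi) = mean Phi.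
Proof.
rewrite /mean /average.
pose swap (q : state * V) := (update q.1 i q.2, q.1 i).
have swapK : involutive swap.
  case=> a y; rewrite /swap /=; congr pair; last by rewrite ffunE eqxx.
  by apply/ffunP => j; rewrite !ffunE; case: eqP => // ->.
have wE (q : state * V) : weight (swap q).1 * p (swap q).2 = weight q.1 * p q.2.
  case: q => a y; rewrite /swap /weight /= (bigD1 i) //= [in RHS](bigD1 i) //= ffunE eqxx.
  rewrite (eq_bigr (fun j => p (a j))); last by move=> j ji; rewrite ffunE (negbTE ji).
  by move: (\prod_(_ | _) _) => z; ring.
transitivity (\sum_(q : state * V) weight q.1 * p q.2 * Phi (swap q).1).
  rewrite -(pair_bigA _ (fun a y => weight a * p y * Phi (update a i y))) /=.
  by apply: eq_bigr => a _; rewrite mulr_sumr; apply: eq_bigr => y _; rewrite mulrA.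
rewrite (reindex_inj (inv_inj swapK)) /=.
transitivity (\sum_(q : state * V) weight q.1 * p q.2 * Phi q.1).
  apply: eq_bigr => q _; rewrite -[(update q.1 i q.2)]/((swap q).1) -[q.1 i]/((swap q).2).
  by rewrite wE -[update (swap q).1 i (swap q).2]/((swap (swap q)).1) swapK.
rewrite -(pair_bigA _ (fun a y => weight a * p y * Phi a)) /=.
by apply: eq_bigr => a _; rewrite -mulr_suml -mulr_sumr p_sum1 mulr1.
Qed.

Lemma mean_averages D Phi : mean (averages D Phi) = mean Phi.
Proof. by elim: D Phi => //= i D IH Phi; rewrite IH mean_average. Qed.

Lemma average_lipschitz c i F : 0 <= c -> lipschitz c F -> lipschitz c (average i F).
Proof.
move=> c0 lip a j y y'; rewrite /average -sumrB.
have [->|ji] := eqVneq j i.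
  rewrite big1 ?normr0 ?mulr_ge0 // => z _.
  have e w : update (update a i w) i z = update a i z by apply/ffunP => k; rewrite !ffunE; case: eqP.
  by rewrite !e subrr.
apply: le_trans (ler_norm_sum _ _ _) _.
apply: (@le_trans _ _ (\sum_z p z * (c * `|x y - x y'|))); last by rewrite -mulr_suml p_sum1 mul1r.
apply: ler_sum => z _; rewrite -mulrBr normrM ger0_norm // ler_wpM2l //.
have e w : update (update a j w) i z = update (update a i z) j w.
  by apply/ffunP => k; rewrite !ffunE; case: eqP => // ->; rewrite eq_sym (negbTE ji).
by rewrite !e.
Qed.

Lemma averages_le D F G : (forall a, F a <= G a) -> forall a, averages D F a <= averages D G a.
Proof.
elim: D F G => //= i D IH F G h; apply: IH => a.
by apply: ler_sum => y _; rewrite ler_wpM2l.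
Qed.

Lemma averagesM D F G : ignores (mem D) G -> forall a, averages D (fun a => G a * F a) a = G a * averages D F a.
Proof.
elim: D F => //= i D IH F hG a.
have -> : average i (fun a => G a * F a) = (fun a => G a * average i F a).
  apply/funext => a'; rewrite /average mulr_sumr; apply: eq_bigr => y _.
  rewrite (hG (update a' i y) a'); first by ring.
  by move=> j; rewrite inE negb_or ffunE => /andP[/negbTE -> _].
by apply: IH => a1 a2 h; apply: hG => j; rewrite inE negb_or => /andP[_]; exact: h.
Qed.

Lemma averages_ignores (S : pred I) D F : ignores S F -> ignores (fun i => S i || (i \in D)) (averages D F).
Proof.
elim: D S F => [|i D IH] S F hF /=; first by move=> a a' h; apply: hF => j Sj; apply: h; rewrite orbF.
move=> a a' h; apply: (IH (fun j => S j || (j == i))) => [a1 a2 h1|j Sj].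
  rewrite /average; apply: eq_bigr => y _; congr (_ * _); apply: hF => j Sj.
  by rewrite !ffunE; case: eqP => // /eqP ji; apply: h1; rewrite negb_or Sj.
by apply: h; rewrite inE orbA.
Qed.

(** Coordinates are averaged one at a time; each costs a factor exp (l^2 c^2) and leaves a function
    with the same Lipschitz constant. *)
Lemma averages_mgf D F l c : 0 <= c -> lipschitz c F ->
  forall a, averages D (fun a => expR (l * F a)) a <=
    expR (l ^+ 2 * c ^+ 2 * (size D)%:R) * expR (l * averages D F a).
Proof.
move=> c0; elim: D F => [|i D IH] F lip a /=; first by rewrite mulr0 expR0 mul1r.
apply: (@le_trans _ _ (averages D (fun a => expR (l ^+ 2 * c ^+ 2) * expR (l * average i F a)) a)).
  apply: averages_le => a'; apply: mgf_average c0 _ => y y'; exact: lip.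
rewrite (@averagesM D _ (fun=> expR (l ^+ 2 * c ^+ 2))) //.
rewrite (_ : l ^+ 2 * c ^+ 2 * (size D).+1%:R = l ^+ 2 * c ^+ 2 + l ^+ 2 * c ^+ 2 * (size D)%:R).
  by rewrite expRD -mulrA ler_wpM2l ?expR_ge0 // IH //; exact: average_lipschitz.
by rewrite -(natr1 (size D)); ring.
Qed.

Definition flip_state (D : seq I) a : state := [ffun i => if i \in D then neg (a i) else a i].

Lemma mean_flip D Phi : mean (fun a => Phi (flip_state D a)) = mean Phi.
Proof.
have fK : involutive (flip_state D).
  by move=> a; apply/ffunP => i; rewrite !ffunE; case: (i \in D); rewrite ?negK.
rewrite /mean [RHS](reindex_inj (inv_inj fK)); apply: eq_bigr => a _; congr (_ * _).
by apply: eq_bigr => i _; rewrite ffunE; case: ifP.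
Qed.

Lemma mean_ge0_le F G : (forall a, F a <= G a) -> mean F <= mean G.
Proof. by move=> h; apply: ler_sum => a _; rewrite ler_wpM2l // weight_ge0. Qed.

Lemma weight_sum1 : \sum_a weight a = 1.
Proof. by rewrite -(bigA_distr_bigA (fun _ y => p y)) /= big1 // => i _. Qed.

(** The mean is unchanged by averaging over D, and the centering factor does not depend on D, so it
    passes through the averages. *)
Lemma centered_mgf D F l c : 0 <= c -> lipschitz c F ->
  mean (fun a => expR (l * (F a - averages D F a))) <= expR (l ^+ 2 * c ^+ 2 * (size D)%:R).
Proof.
move=> c0 lip; rewrite -(mean_averages D).
have ign : ignores (mem D) (fun a => expR (- (l * averages D F a))).
  move=> a a' h; congr (expR (- (l * _))); apply: (@averages_ignores xpred0 D F) => // a1 a2 h1.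
  by congr F; apply/ffunP => i; exact: h1.
have -> : (fun a => expR (l * (F a - averages D F a))) =
    (fun a => expR (- (l * averages D F a)) * expR (l * F a)).
  by apply/funext => a; rewrite -expRD; congr expR; ring.
rewrite [leRHS](_ : _ = \sum_a weight a * expR (l ^+ 2 * c ^+ 2 * (size D)%:R)); last first.
  by rewrite -mulr_suml weight_sum1 mul1r.
apply: ler_sum => a _; rewrite ler_wpM2l ?weight_ge0 // averagesM //.
apply: le_trans (ler_wpM2l (expR_ge0 _) (averages_mgf D l c0 lip a)) _.
by rewrite mulrCA -expRD addNr expR0 mulr1.
Qed.

(* Both F and its flip are compared with the average of F over the flipped
   coordinates, which is invariant under the flip. *)
Lemma flip_mgf D F l c : 0 <= c -> lipschitz c F ->
  mean (fun a => expR (l * (F (flip_state D a) - F a))) <= expR (4 * l ^+ 2 * c ^+ 2 * (size D)%:R).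
Proof.
move=> c0 lip; set m := averages D F.
have mflip a : m (flip_state D a) = m a.
  apply: (@averages_ignores xpred0 D F) => [a1 a2 h1|i /= iD].
    by congr F; apply/ffunP => i; exact: h1.
  by rewrite ffunE (negbTE iD).
apply: (@le_trans _ _ (mean (fun a => 2^-1 * (expR (2 * l * (F (flip_state D a) - m (flip_state D a)))
    + expR (- (2 * l) * (F a - m a)))))).
  apply: mean_ge0_le => a; rewrite mflip.
  set u := l * (F (flip_state D a) - m a); set v := - l * (F a - m a).
  have -> : l * (F (flip_state D a) - F a) = u + v by rewrite /u /v; ring.
  have -> : 2 * l * (F (flip_state D a) - m a) = u + u by rewrite /u; ring.
  have -> : - (2 * l) * (F a - m a) = v + v by rewrite /v; ring.
  rewrite !expRD; have := sqr_ge0 (expR u - expR v); nra.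
have -> : mean (fun a => 2^-1 * (expR (2 * l * (F (flip_state D a) - m (flip_state D a)))
    + expR (- (2 * l) * (F a - m a)))) =
  2^-1 * (mean (fun a => expR (2 * l * (F (flip_state D a) - m (flip_state D a))))
    + mean (fun a => expR (- (2 * l) * (F a - m a)))).
  by rewrite /mean -big_split mulr_sumr /=; apply: eq_bigr => a _; ring.
rewrite (mean_flip D (fun a => expR (2 * l * (F a - m a)))).
have := centered_mgf D (2 * l) c0 lip; have := centered_mgf D (- (2 * l)) c0 lip.
rewrite -/m; have -> : (- (2 * l)) ^+ 2 = 4 * l ^+ 2 by ring.
have -> : (2 * l) ^+ 2 = 4 * l ^+ 2 by ring.
lra.
Qed.

Lemma flip_tail D F l c u : 0 <= c -> lipschitz c F ->
  \sum_(a | 4 * l ^+ 2 * c ^+ 2 * (size D)%:R + u <= l * (F (flip_state D a) - F a)) weight a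
  <= expR (- u).
Proof.
move=> c0 lip; set t := 4 * _ * _ * _.
have := flip_mgf D l c0 lip; rewrite -/t => h.
rewrite -(ler_pM2l (expR_gt0 (t + u))) -expRD addrK; apply: le_trans h.
rewrite mulr_sumr big_mkcond; apply: ler_sum => a _; case: ifP => ha.
  by rewrite mulrC ler_wpM2l ?weight_ge0 // ler_expR.
by rewrite mulr_ge0 ?weight_ge0 // expR_ge0.
Qed.
End SubGaussian.

(** * Discretization of the Gaussian field *)

Lemma measure_bigsetU_le d (T : measurableType d) (R : realType) (mu : {measure set T -> \bar R})
    (I : finType) (Q : pred I) (A : I -> set T) :
  (forall i, measurable (A i)) ->
  (mu (\big[setU/set0]_(i | Q i) A i) <= \sum_(i | Q i) mu (A i))%E.
Proof.
move=> mA; suff [] : measurable (\big[setU/set0]_(i | Q i) A i) /\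
  (mu (\big[setU/set0]_(i | Q i) A i) <= \sum_(i | Q i) mu (A i))%E by [].
apply: (big_ind2 (fun X (y : \bar R) => measurable X /\ (mu X <= y)%E)).
- by split; [exact: measurable0 | rewrite measure0].
- move=> X1 y1 X2 y2 [m1 h1] [m2 h2]; split; first exact: measurableU.
  by apply: le_trans (measureU2 mu m1 m2) _; exact: leeD.
- by move=> i _; split.
Qed.

Section StandardGaussian.
Variable R : realType.
Local Notation mu := (@lebesgue_measure R).
Local Notation gauss := (normal_prob (0 : R) 1).
Local Notation pdf := (normal_pdf (0 : R) 1).

Lemma normal_pdfN (t : R) : pdf (- t) = pdf t.
Proof. by rewrite !normal_pdfE ?oner_neq0 // /normal_fun !subr0 sqrrN. Qed.

Lemma normal_prob_opp (A : set R) : measurable A -> gauss (-%R @^-1` A) = gauss A.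
Proof.
move=> mA; rewrite /normal_prob.
transitivity (\int[pushforward mu (-%R : _ -> measurableTypeR R)]_(x in A) (pdf x)%:E)%E; last first.
  by apply: eq_measure_integral => //= B mB _; exact: lebesgue_measureN.
rewrite ge0_integral_pushforward //=.
- by apply: eq_integral => x _; rewrite /= normal_pdfN.
- by apply/measurable_EFinP; apply: measurable_funTS; exact: measurable_normal_pdf.
- by move=> y _; rewrite lee_fin normal_pdf_ge0.
Qed.

Lemma normal_pdf_shift (l t : R) :
  expR (l * t) * pdf t = expR (l ^+ 2 / 2) * normal_pdf l 1 t.
Proof.
rewrite !normal_pdfE ?oner_neq0 // mulrCA [RHS]mulrCA; congr (_ * _).
rewrite /normal_fun -!expRD; congr expR; rewrite expr1n subr0; by field.
Qed.

Lemma gauss_mgf (l : R) : (\int[mu]_t (expR (l * t) * pdf t)%:E = (expR (l ^+ 2 / 2))%:E)%E.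
Proof.
under eq_integral do rewrite normal_pdf_shift EFinM.
rewrite ge0_integralZl //.
- by rewrite integral_normal_pdf mule1.
- by apply/measurable_EFinP; exact: measurable_normal_pdf.
- by move=> t _; rewrite lee_fin normal_pdf_ge0.
Qed.

(** Unlike the exponential, its symmetrization is monotone in |t|, so it can only decrease when t is
    rounded towards 0. *)
Definition cosh2 (l t : R) : R := expR (l * t) + expR (- (l * t)).

Lemma measurable_cosh2_pdf l : measurable_fun setT (fun t => (cosh2 l t * pdf t)%:E).
Proof.
apply/measurable_EFinP/measurable_funM; last exact: measurable_normal_pdf.
apply: measurable_funD; apply: measurableT_comp => //.
exact: measurableT_comp.
Qed.

Lemma cosh2_ge0 l t : 0 <= cosh2 l t.
Proof. by rewrite addr_ge0 ?expR_ge0. Qed.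

Lemma cosh2_pdf_ge0 l t : (0 <= (cosh2 l t * pdf t)%:E)%E.
Proof. by rewrite lee_fin mulr_ge0 ?cosh2_ge0 ?normal_pdf_ge0. Qed.

Lemma gauss_cosh2 (l : R) : (\int[mu]_t (cosh2 l t * pdf t)%:E = (2 * expR (l ^+ 2 / 2))%:E)%E.
Proof.
have mE (k : R) : measurable_fun [set: R] (fun t : R => (expR (k * t) * pdf t)%:E).
  apply/measurable_EFinP/measurable_funM; last exact: measurable_normal_pdf.
  by apply: measurableT_comp => //; exact: mulrl_measurable.
under eq_integral do rewrite /cosh2 mulrDl -mulNr EFinD.
rewrite ge0_integralD //.
- by rewrite !gauss_mgf sqrrN -EFinD -mulr2n mulr_natl.
- by move=> t _; rewrite lee_fin mulr_ge0 ?expR_ge0 ?normal_pdf_ge0.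
- exact: mE.
- by move=> t _; rewrite lee_fin mulr_ge0 ?expR_ge0 ?normal_pdf_ge0.
- exact: mE.
Qed.

Lemma gauss_cell (A : set R) (k l : R) : measurable A -> 0 <= k ->
  (forall t, A t -> k <= cosh2 l t) ->
  (k%:E * gauss A <= \int[mu]_(t in A) (cosh2 l t * pdf t)%:E)%E.
Proof.
move=> mA k0 h.
have mp : measurable_fun A (fun t : R => (pdf t)%:E).
  by apply/measurable_EFinP; apply: measurable_funTS; exact: measurable_normal_pdf.
have p0 (t : R) : A t -> (0 <= (pdf t)%:E)%E by move=> _; rewrite lee_fin normal_pdf_ge0.
rewrite /normal_prob (_ : k%:E * _ = \int[mu]_(t in A) (k%:E * (pdf t)%:E))%E; last first.
  by rewrite ge0_integralZl.
apply: ge0_le_integral => //.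
- by move=> t _; rewrite -EFinM lee_fin mulr_ge0 ?normal_pdf_ge0.
- exact: measurable_funeM.
- by apply: measurable_funTS; exact: measurable_cosh2_pdf.
- by move=> t At; rewrite -EFinM lee_fin ler_wpM2r ?normal_pdf_ge0 ?h.
Qed.

Lemma gauss_tail (M : R) : 0 <= M -> (gauss [set t | (M <= `|t|)%R] <= (4 * expR (- M))%:E)%E.
Proof.
move=> M0.
have mA : measurable [set t : R | M <= `|t|].
  rewrite (_ : [set t | _] = (@Num.norm R R) @^-1` `[M, +oo[); last by apply/seteqP; split => t /=; rewrite in_itv /= andbT.
  by rewrite -[X in measurable X]setTI; apply: normr_measurable => //; exact: measurable_itv.
have := @gauss_cell _ (expR M) 1 mA (expR_ge0 _).
have h t : [set t : R | M <= `|t|] t -> expR M <= cosh2 1 t.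
  rewrite /= /cosh2 mul1r => Mt; apply: (@le_trans _ _ (expR `|t|)); first by rewrite ler_expR.
  by have [_|_] := ger0P t; rewrite ?lerDl ?lerDr expR_ge0.
move=> /(_ h) H.
have {}H : ((expR M)%:E * gauss [set t | (M <= `|t|)%R] <= 4%:E)%E.
  apply: le_trans H _; apply: (@le_trans _ _ (\int[mu]_t (cosh2 1 t * pdf t)%:E)%E).
    by apply: ge0_subset_integral => //; [exact: measurable_cosh2_pdf | move=> t _; exact: cosh2_pdf_ge0].
  rewrite gauss_cosh2 lee_fin; have : expR (1 ^+ 2 / 2) <= 2 :> R.
    have := @expR_ge1Dx R (- (1 / 2)); have := @expRxMexpNx_1 R (1 / 2).
    have := @expR_gt0 R (1/2); rewrite expr1n; nra.
  lra.
have -> : (4 * expR (- M))%:E = ((expR (- M))%:E * 4%:E)%E :> \bar R by rewrite -EFinM mulrC.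
apply: le_trans (lee_wpmul2l _ H); last by rewrite lee_fin expR_ge0.
by rewrite muleA -EFinM -expRD addNr expR0 mul1e.
Qed.

Section Cells.
Variables (m : nat) (dl : R).
Hypothesis dl0 : 0 < dl.

Local Notation V := (bool * 'I_m.+1)%type.

(* The line is cut into 2(m + 1) cells, indexed by a sign and a magnitude, the
   last magnitude being unbounded; [cell_value] rounds towards 0. *)
Definition half_cell (j : nat) : set R :=
  if (j < m)%N then [set t | j%:R * dl <= t < j.+1%:R * dl] else [set t | m%:R * dl <= t].

Definition cell (y : V) : set R :=
  if y.1 then [set t | (0 <= t)%R /\ half_cell y.2 t] else [set t | (t < 0)%R /\ half_cell y.2 (- t)].

Definition cell_value (y : V) : R := if y.1 then y.2%:R * dl else - (y.2%:R * dl).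
Definition cell_opp (y : V) : V := (~~ y.1, y.2).
Definition cell_prob (y : V) : R := fine (gauss (cell y)).

Lemma measurable_half_cell j : measurable (half_cell j).
Proof.
rewrite /half_cell; case: ifP => _.
  rewrite (_ : [set t | _] = `[j%:R * dl, j.+1%:R * dl[%classic); first exact: measurable_itv.
  by apply/seteqP; split => t /=; rewrite in_itv.
rewrite (_ : [set t | _] = `[m%:R * dl, +oo[%classic); first exact: measurable_itv.
by apply/seteqP; split => t /=; rewrite in_itv /= andbT.
Qed.

Lemma measurable_cell y : measurable (cell y).
Proof.
rewrite /cell; case: ifP => _.
  rewrite (_ : [set t | _] = `[0, +oo[%classic `&` half_cell y.2); last first.
    by apply/seteqP; split => t /=; rewrite in_itv /= andbT.
  by apply: measurableI; [exact: measurable_itv | exact: measurable_half_cell].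
rewrite (_ : [set t | _] = `]-oo, 0[%classic `&` (-%R @^-1` half_cell y.2)); last first.
  by apply/seteqP; split => t /=; rewrite in_itv.
apply: measurableI; first exact: measurable_itv.
rewrite -[X in measurable X]setTI; apply: oppr_measurable => //; exact: measurable_half_cell.
Qed.

Lemma half_cell_exists t : 0 <= t -> exists j : 'I_m.+1, half_cell j t.
Proof.
move=> t0; have [h|h] := leP (m%:R * dl) t.
  by exists ord_max; rewrite /half_cell /= ltnn.
have [j [jm hj]] : exists j, (j < m)%N /\ (j%:R * dl <= t < j.+1%:R * dl).
  elim: m h => [|n IH] h; first by rewrite mul0r ltNge t0 in h.
  have [h2|h2] := leP (n%:R * dl) t; first by exists n; rewrite h2 h.
  by have [j [jn hj]] := IH h2; exists j; split => //; exact: leqW.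
by exists (Ordinal (leqW jm)); rewrite /half_cell /= jm.
Qed.

Lemma half_cell_lb j t : (j <= m)%N -> half_cell j t -> j%:R * dl <= t.
Proof.
rewrite /half_cell; case: ltnP => [_ _ /= /andP[]//|h1 h2 /=].
by have -> : j = m by apply/eqP; rewrite eqn_leq h2.
Qed.

Lemma half_cell_uniq (j k : 'I_m.+1) t : half_cell j t -> half_cell k t -> j = k.
Proof.
wlog jk : j k / (j <= k)%N => [H h1 h2|].
  by case/orP: (leq_total j k) => h; [exact: H | apply/esym; exact: H].
move=> hj hk; apply/val_inj => /=; apply/eqP; rewrite eqn_leq jk /= leqNgt; apply/negP => jk'.
have jm : (j < m)%N by apply: leq_trans jk' _; rewrite -ltnS.
have := half_cell_lb (ltn_ord k : (k <= m)%N) hk.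
move: hj; rewrite /half_cell jm /= => /andP[_ h1] h2.
have := le_lt_trans h2 h1; rewrite ltr_pM2r // ltr_nat ltnS leqNgt jk'.
by [].
Qed.

Lemma cell_exists t : exists y, cell y t.
Proof.
have [t0|t0] := leP 0 t.
  by have [j hj] := half_cell_exists t0; exists (true, j); split.
have [|j hj] := @half_cell_exists (- t); first by rewrite oppr_ge0 ltW.
by exists (false, j); split.
Qed.

Lemma cell_uniq y z t : cell y t -> cell z t -> y = z.
Proof.
case: y z => [b j] [b' k]; rewrite /cell /=.
case: b; case: b' => -[h1 h2] [h3 h4].
- by congr pair; exact: half_cell_uniq h2 h4.
- by move: h3; rewrite ltNge h1.
- by move: h1; rewrite ltNge h3.
- by congr pair; exact: half_cell_uniq h2 h4.
Qed.

Lemma cell_trivIset (D : set V) : trivIset D cell.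
Proof. by move=> y z _ _ [t [h1 h2]]; exact: cell_uniq h1 h2. Qed.

Lemma cell_value_le y t : cell y t -> `|cell_value y| <= `|t|.
Proof.
case: y => [b j]; have jm : (j <= m)%N by rewrite -ltnS.
rewrite /cell /cell_value /=; case: b => -[h1 /(half_cell_lb jm) h2].
  by rewrite !ger0_norm // mulr_ge0 ?ler0n // ltW.
by rewrite normrN ger0_norm ?mulr_ge0 ?ler0n ?(ltW dl0) // ltr0_norm.
Qed.

Lemma cell_tail y t : cell y t -> (y.2 : nat) = m -> m%:R * dl <= `|t|.
Proof.
move=> h e; apply: le_trans (cell_value_le h); move: h.
rewrite /cell_value e; case: y.1 => _; rewrite ?normrN ler_norm //.
Qed.

Lemma cell_value_near y t : cell y t -> (y.2 < m)%N -> `|t - cell_value y| <= dl.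
Proof.
case: y => [b j] /= + jm; rewrite /cell /cell_value /half_cell /= jm.
have e : j.+1%:R * dl = j%:R * dl + dl by rewrite -natr1 mulrDl mul1r.
case: b => -[_ /=]; rewrite e => /andP[h1 h2].
  by rewrite ger0_norm ?subr_ge0 //; lra.
by rewrite opprK -normrN opprD ger0_norm; lra.
Qed.

Lemma cell_oppK : involutive cell_opp.
Proof. by case=> b j; rewrite /cell_opp /= negbK. Qed.

Lemma cell_value_opp y : cell_value (cell_opp y) = - cell_value y.
Proof. by case: y => [[] j]; rewrite /cell_value /= ?opprK. Qed.

Lemma cell_probE y : (cell_prob y)%:E = gauss (cell y).
Proof. by rewrite /cell_prob fineK // fin_num_measure //; exact: measurable_cell. Qed.

Lemma cell_prob_ge0 y : 0 <= cell_prob y.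
Proof. by rewrite -lee_fin cell_probE measure_ge0. Qed.

Lemma bigcup_cell : \big[setU/set0]_(y <- index_enum V) cell y = setT.
Proof.
apply/seteqP; split => // t _; have [y hy] := cell_exists t.
by rewrite -bigcup_seq; exists y => //=; rewrite mem_index_enum.
Qed.

Lemma cell_integral (f : R -> R) : measurable_fun setT f -> (forall t, 0 <= f t) ->
  (\sum_(y : V) \int[mu]_(t in cell y) (f t)%:E = \int[mu]_t (f t)%:E)%E.
Proof.
move=> mf f0; rewrite -bigcup_cell ge0_integral_bigsetU //=.
- by move=> y; exact: measurable_cell.
- exact: index_enum_uniq.
- exact: cell_trivIset.
- by rewrite bigcup_cell; apply/measurable_EFinP.
- by move=> t _; rewrite lee_fin.
Qed.

Lemma cell_prob_sum1 : \sum_y cell_prob y = 1.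
Proof.
apply: EFin_inj; rewrite -sumEFin; under eq_bigr do rewrite cell_probE.
rewrite /normal_prob (cell_integral (measurable_normal_pdf 0 1)) ?integral_normal_pdf //.
by move=> t; rewrite normal_pdf_ge0.
Qed.

Lemma cell_prob_opp y : cell_prob (cell_opp y) = cell_prob y.
Proof.
have aux j : gauss (cell (false, j)) = gauss (cell (true, j)).
  rewrite -(normal_prob_opp (measurable_cell (false, j))).
  (* The point 0 belongs to a cell of positive sign, so opposite cells are mirror images only up to
     this point, which has measure zero. *)
  have e : cell (true, j) = (-%R @^-1` cell (false, j)) `|` (cell (true, j) `&` [set 0]).
    apply/seteqP; split => t; rewrite /cell /= ?oppr_lt0 ?opprK.
      move=> [t0 h]; have [t00|tn] := eqVneq t 0; first by right.
      by left; split => //; rewrite lt_def tn.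
    by case=> [[t0 h]|[]//]; split => //; exact: ltW.
  have m1 : measurable (-%R @^-1` cell (false, j)).
    by rewrite -[X in measurable X]setTI; apply: oppr_measurable => //; exact: measurable_cell.
  have m2 : measurable (cell (true, j) `&` [set 0]) by apply: measurableI => //; exact: measurable_cell.
  apply/eqP; rewrite eq_le; apply/andP; split.
    apply: le_measure; rewrite ?inE //; first exact: measurable_cell.
    by rewrite [X in _ `<=` X]e; exact: subsetUl.
  have H : (gauss (cell (true, j)) <= gauss (-%R @^-1` cell (false, j)) + gauss (cell (true, j) `&` [set (0 : R)%R]))%E.
    by rewrite [X in (gauss X <= _)%E]e; exact: measureU2.
  apply: le_trans H _; rewrite [X in (_ + X)%E](_ : _ = 0%E) ?adde0 //.
  apply/eqP; rewrite eq_le measure_ge0 andbT.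
  apply: (@le_trans _ _ (gauss [set (0 : R)])); first by apply: le_measure; rewrite ?inE //; exact: subIsetr.
  by rewrite /normal_prob integral_set1.
by rewrite /cell_prob; case: y => [[] j]; rewrite /cell_opp /= aux.
Qed.

(** By symmetry the exponential may be replaced by half of [cosh2], which does not increase under
    rounding; the comparison with the Gaussian integral is made cell by cell. *)
Lemma cell_mgf l : \sum_y cell_prob y * expR (l * cell_value y) <= expR (l ^+ 2 / 2).
Proof.
have sym : \sum_y cell_prob y * expR (l * cell_value y) =
    2^-1 * \sum_y cell_prob y * cosh2 l (cell_value y).
  have e : \sum_y cell_prob y * expR (- (l * cell_value y)) =
      \sum_y cell_prob y * expR (l * cell_value y).
    rewrite [RHS](reindex_inj (inv_inj cell_oppK)); apply: eq_bigr => y _.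
    by rewrite cell_prob_opp cell_value_opp mulrN.
  have -> : \sum_y cell_prob y * cosh2 l (cell_value y) =
      \sum_y cell_prob y * expR (l * cell_value y) + \sum_y cell_prob y * expR (- (l * cell_value y)).
    by rewrite -big_split /=; apply: eq_bigr => y _; rewrite /cosh2 mulrDr.
  by rewrite e; lra.
rewrite sym ler_pdivrMl // -lee_fin -gauss_cosh2 -sumEFin.
rewrite -cell_integral; last 2 first.
- by apply/measurable_EFinP; exact: measurable_cosh2_pdf.
- by move=> t; rewrite -lee_fin cosh2_pdf_ge0.
apply: lee_sum => y _; rewrite EFinM cell_probE muleC; apply: gauss_cell.
- exact: measurable_cell.
- exact: cosh2_ge0.
move=> t /cell_value_le h; rewrite /cosh2.
have cosh_abs (u : R) : expR u + expR (- u) = expR `|u| + expR (- `|u|).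
  by have [_|_] := ger0P u; rewrite ?opprK // addrC.
by rewrite [leRHS]cosh_abs; apply: cosh_le; rewrite !normrM ler_wpM2l.
Qed.
End Cells.
End StandardGaussian.

(** * Fluctuation of a functional between two flips of the field *)

Section PairEvent.
Variables (R : realType) (d : measure_display) (T : measurableType d) (P : probability T R).
Variable h : vertex -> {RV P >-> R}.
Hypothesis iid : iid_standard_gaussian h.
Variable N : nat.

Section Discretization.
Variables (m : nat) (dl : R).
Hypothesis dl0 : 0 < dl.
Local Notation V := (bool * 'I_m.+1)%type.
Local Notation state := {ffun box N -> V}.

Definition cell_field (a : state) (v : vertex) : R :=
  if insub v is Some v' then cell_value dl (a v') else 0.

Lemma cell_field_val a (v : box N) : cell_field a (val v) = cell_value dl (a v).
Proof. by rewrite /cell_field valK. Qed.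

Definition cell_event (a : state) : set T :=
  \bigcap_(v in [set` box N]) (h v @^-1` (if insub v is Some v' then cell dl (a v') else setT)).

Lemma measurable_vertex_event v (A : set R) : measurable A -> measurable (h v @^-1` A).
Proof. by move=> mA; rewrite -[X in measurable X]setTI; exact: measurable_funP. Qed.

Lemma measurable_cell_event a : measurable (cell_event a).
Proof.
apply: fin_bigcap_measurable; first exact: finite_fset.
move=> v _; apply: measurable_vertex_event; case: insubP => [? _ _|_]; last exact: measurableT.
exact: measurable_cell.
Qed.

Lemma vertex_law v (A : set R) : measurable A -> P (h v @^-1` A) = normal_prob 0 1 A.
Proof. by move=> mA; rewrite -(iid.2 v A mA). Qed.

Lemma cell_event_prob a : P (cell_event a) = (weight (@cell_prob R m dl) a)%:E.
Proof.
rewrite /cell_event (iid.1 (box N) (fun v => if insub v is Some v' then cell dl (a v') else setT)); last first.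
  by move=> v; case: insubP => [? _ _|_]; [exact: measurable_cell | exact: measurableT].
rewrite big_seq_fsetE /= /weight -prodEFin; apply: eq_bigr => v _.
by rewrite valK vertex_law ?cell_probE //; exact: measurable_cell.
Qed.

Lemma cell_event_cover w : exists a : state, cell_event a w /\ forall v : box N, cell dl (a v) (h (val v) w).
Proof.
have [a ha] := choice (fun v : box N => @cell_exists R m dl (h (val v) w)).
exists [ffun v => a v]; split=> [v /= vN|v]; last by rewrite ffunE.
by case: insubP => [v' _ <-|]; [rewrite ffunE | rewrite vN].
Qed.

Variables (F : (vertex -> R) -> R) (B B' : pred vertex) (eps : R).
Hypothesis eps0 : 0 <= eps.
Hypothesis Flip : forall eta eta',
  F eta - F eta' <= \sum_(v : box N) `|eta (val v) - eta' (val v)|.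

Definition cell_functional (A : pred vertex) (a : state) : R :=
  F (flip_field A (fun v => eps * cell_field a v)).

Lemma flip_field_dist A (eta eta' : vertex -> R) v :
  `|flip_field A eta v - flip_field A eta' v| = `|eta v - eta' v|.
Proof. by rewrite /flip_field; case: ifP => // _; rewrite -opprD normrN. Qed.

Lemma cell_functional_lipschitz A : lipschitz (@cell_value R m dl) eps (cell_functional A).
Proof.
have one a i y y' : cell_functional A (update a i y) - cell_functional A (update a i y') <=
    eps * `|cell_value dl y - cell_value dl y'|.
  apply: le_trans (Flip _ _) _; rewrite (bigD1 i) //= big1 ?addr0.
    rewrite flip_field_dist -mulrBr normrM (ger0_norm eps0) (cell_field_val (update a i y)).
    by rewrite (cell_field_val (update a i y')) /update !ffunE eqxx.
  move=> j ji; rewrite flip_field_dist -mulrBr (cell_field_val (update a i y)).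
  by rewrite (cell_field_val (update a i y')) /update !ffunE (negbTE ji) subrr mulr0 normr0.
move=> a i y y'; rewrite ler_norml; apply/andP; split; last exact: one.
by rewrite lerNl opprB [X in _ * X]distrC; exact: one.
Qed.

Definition flip_list : seq (box N) := [seq v <- index_enum (box N) | B (val v) (+) B' (val v)].

Lemma size_flip_list : size flip_list = count (fun v => B v (+) B' v) (box N).
Proof.
rewrite size_filter -!sum1_count (big_seq_fsetE _ (box N)) /=.
by apply: eq_bigl => v.
Qed.

Lemma cell_functional_flip a :
  cell_functional B (flip_state (@cell_opp m) flip_list a) = cell_functional B' a.
Proof.
congr F; apply/funext => v; rewrite /flip_field /cell_field.
case: insubP => [v' vN <-|_]; last by rewrite mulr0 oppr0; case: (B v); case: (B' v).
rewrite ffunE mem_filter mem_index_enum andbT.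
by case: (B _); case: (B' _) => //=; rewrite cell_value_opp mulrN ?opprK.
Qed.

Lemma cell_event_near A (a : state) w : (forall v : box N, cell dl (a v) (h (val v) w)) ->
  (forall v : box N, `|h (val v) w| < m%:R * dl) ->
  `|F (flip_field A (fun v => eps * h v w)) - cell_functional A a| <= eps * (#|{: box N}|%:R * dl).
Proof.
move=> ca small.
have near v : `|h (val v) w - cell_value dl (a v)| <= dl.
  apply: cell_value_near (ca v) _; rewrite ltn_neqAle -ltnS ltn_ord andbT.
  by apply/eqP => e; have := small v; rewrite ltNge (cell_tail dl0 (ca v) e).
have bnd : \sum_(v : box N) `|eps * h (val v) w - eps * cell_field a (val v)| <= eps * (#|{: box N}|%:R * dl).
  rewrite mulr_natl -sumr_const mulr_sumr; apply: ler_sum => v _.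
  by rewrite cell_field_val -mulrBr normrM (ger0_norm eps0) ler_wpM2l.
rewrite ler_norml; apply/andP; split.
  rewrite lerNl opprB; apply: le_trans (Flip _ _) _; apply: le_trans bnd.
  by apply: ler_sum => v _; rewrite flip_field_dist distrC.
apply: le_trans (Flip _ _) _; apply: le_trans bnd.
by apply: ler_sum => v _; rewrite flip_field_dist.
Qed.
End Discretization.

(** One u is the Chernoff margin for the discretized field, the other absorbs the rounding. The
    event G excludes the cells on which the discretized increment is large, and the fields that
    leave the bounded cells. *)
Lemma pair_event (F : (vertex -> R) -> R) (B B' : pred vertex) (eps l u : R) :
  0 <= eps -> 0 <= l -> 0 < u ->
  (forall eta eta', F eta - F eta' <= \sum_(v : box N) `|eta (val v) - eta' (val v)|) ->
  exists G : set T, [/\ measurable G, (P (~` G) <= (2 * expR (- u))%:E)%E &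
    forall w, G w ->
      l * (F (flip_field B' (fun v => eps * h v w)) - F (flip_field B (fun v => eps * h v w)))
      <= 4 * l ^+ 2 * eps ^+ 2 * (count (fun v => B v (+) B' v) (box N))%:R + 2 * u].
Proof.
move=> eps0 l0 u0 Flip.
set n : R := #|{: box N}|%:R; have n0 : 0 <= n by rewrite ler0n.
(* The mesh at which rounding both flipped fields costs at most u; the summand 1 keeps the
   denominator positive. *)
pose dl := u / (2 * l * eps * n + 1).
have den0 : 0 < 2 * l * eps * n + 1 by rewrite ltr_wpDl // !mulr_ge0.
have dl0 : 0 < dl by rewrite divr_gt0.
have dlu : 2 * l * eps * n * dl <= u.
  by rewrite /dl mulrA ler_pdivrMr // mulrC ler_pM2l // lerDl.
(* The range 4 n beyond u pays for the union of the n tails, since 4 n exp (- 4 n) <= 1. *)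
have [m hm] : exists m : nat, u + 4 * n <= m%:R * dl.
  exists (Num.bound ((u + 4 * n) / dl)); rewrite -ler_pdivrMr //.
  by apply/ltW/archi_boundP; rewrite divr_ge0 ?(ltW dl0) // addr_ge0 ?mulr_ge0 // ltW.
have edge_tail : n * (4 * expR (- (m%:R * dl))) <= expR (- u).
  apply: (@le_trans _ _ (n * (4 * expR (- (u + 4 * n))))).
    by rewrite ler_wpM2l // ler_pM2l // ler_expR lerN2.
  have e4 : 4 * n * expR (- (4 * n)) <= 1.
    rewrite -[leRHS](@expRxMexpNx_1 R (4 * n)) ler_wpM2r ?expR_ge0 //.
    by apply: le_trans (expR_ge1Dx _); rewrite lerDr.
  rewrite opprD expRD [leLHS](_ : _ = expR (- u) * (4 * n * expR (- (4 * n)))); last by ring.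
  by rewrite ler_piMr ?expR_ge0.
pose D := flip_list B B'.
pose Q (a : {ffun box N -> bool * 'I_m.+1}) :=
  4 * l ^+ 2 * eps ^+ 2 * (size D)%:R + u <=
  l * (cell_functional dl F eps B (flip_state (@cell_opp m) D a) - cell_functional dl F eps B a).
pose Tail (v : box N) : set T := h (val v) @^-1` [set t | m%:R * dl <= `|t|].
have mabs : measurable [set t : R | m%:R * dl <= `|t|].
  rewrite (_ : [set t | _] = (@Num.norm R R) @^-1` `[m%:R * dl, +oo[); last first.
    by apply/seteqP; split => t /=; rewrite in_itv /= andbT.
  by rewrite -[X in measurable X]setTI; apply: normr_measurable => //; exact: measurable_itv.
have mTail v : measurable (Tail v) by exact: measurable_vertex_event.
have mC := measurable_cell_event (m := m) dl.
pose B1 := \big[setU/set0]_(a | Q a) cell_event dl a.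
pose B2 := \big[setU/set0]_(v : box N) Tail v.
have mB1 : measurable B1 by apply: bigsetU_measurable.
have mB2 : measurable B2 by apply: bigsetU_measurable.
exists (~` (B1 `|` B2)); split.
- by apply: measurableC; exact: measurableU.
- rewrite setCK; apply: le_trans (measureU2 P mB1 mB2) _.
  rewrite mulr_natl mulr2n EFinD; apply: leeD.
    apply: le_trans (measure_bigsetU_le _ _ mC) _.
    rewrite (eq_bigr (fun a => (weight (@cell_prob R m dl) a)%:E)); last first.
      by move=> a _; exact: cell_event_prob.
    rewrite sumEFin lee_fin; apply: flip_tail => //.
    + exact: cell_prob_ge0.
    + exact: cell_prob_sum1.
    + exact: cell_mgf.
    + exact: cell_oppK.
    + exact: cell_prob_opp.
    + exact: cell_functional_lipschitz.
  apply: le_trans (measure_bigsetU_le _ _ mTail) _.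
  apply: (@le_trans _ _ (\sum_(v : box N) (4 * expR (- (m%:R * dl)))%:E)%E).
    apply: lee_sum => v _; rewrite [leLHS](vertex_law (val v) mabs).
    by apply: gauss_tail; rewrite mulr_ge0 ?ler0n // ltW.
  by rewrite sumEFin lee_fin sumr_const -[_ *+ _]mulr_natl.
move=> w /= notB.
have [a [ha ca]] := cell_event_cover m dl w.
have nQ : ~~ Q a.
  apply/negP => Qa; apply: notB; left; rewrite /B1 (bigD1 a) //=; by left.
have small (v : box N) : `|h (val v) w| < m%:R * dl.
  rewrite ltNge; apply/negP => hv; apply: notB; right.
  by rewrite /B2 (bigD1 v) //=; left.
have := cell_event_near dl0 eps0 Flip B' ca small; have := cell_event_near dl0 eps0 Flip B ca small.
rewrite -/n ler_norml => /andP[h1 _]; rewrite ler_norml => /andP[_ h2].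
move: nQ; rewrite /Q -ltNge cell_functional_flip size_flip_list => /ltW h3.
have : l * (F (flip_field B' (fun v => eps * h v w)) - F (flip_field B (fun v => eps * h v w))
   - (cell_functional dl F eps B' a - cell_functional dl F eps B a)) <= l * (2 * (eps * (n * dl))).
  by apply: ler_wpM2l => //; lra.
have : l * (2 * (eps * (n * dl))) <= u by apply: le_trans dlu; rewrite le_eqVlt; apply/orP; left; apply/eqP; ring.
rewrite mulrBr; lra.
Qed.
End PairEvent.

(** * The good event *)

Lemma union_event (R : realType) d (T : measurableType d) (P : probability T R)
    (I : finType) (q : R) (Q : I -> T -> Prop) :
  (forall i, exists G : set T, [/\ measurable G, (P (~` G) <= q%:E)%E & forall w, G w -> Q i w]) ->
  exists G : set T, [/\ measurable G, (P (~` G) <= (#|I|%:R * q)%:E)%E & forall w, G w -> forall i, Q i w].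
Proof.
move=> /choice [G hG].
have mG i : measurable (~` G i) by have [m _ _] := hG i; exact: measurableC.
exists (~` (\big[setU/set0]_(i : I) ~` G i)); split.
- by apply: measurableC; apply: bigsetU_measurable.
- rewrite setCK; apply: le_trans (measure_bigsetU_le _ _ mG) _.
  apply: (@le_trans _ _ (\sum_(i : I) q%:E)%E); first by apply: lee_sum => i _; have [] := hG i.
  by rewrite sumEFin lee_fin sumr_const mulr_natl.
move=> w /= hw i; have [_ _] := hG i; apply; apply: contrapT => h.
by apply: hw; rewrite (bigD1 i) //=; left.
Qed.

Definition dilate (m : nat) (p : vertex) : vertex := (p.1 * m%:Z, p.2 * m%:Z).

(** The meshes are nested, so the rounded polygon at one scale determines the one at the next
    scale. *)
Lemma round_to_round_to (m n : nat) p : (0 < m)%N -> (m %| n)%N ->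
  round_to n (round_to m p) = round_to n p.
Proof.
move=> m0 /dvdnP [c ->]; rewrite /round_to /= PoszM.
have e (x : int) : ((x %/ m%:Z)%Z * m%:Z %/ (c%:Z * m%:Z))%Z = (x %/ (c%:Z * m%:Z))%Z.
  rewrite divzMpr; last by lia.
  by rewrite [c%:Z * _]mulrC divzMA_ge0 //; lia.
by rewrite !e.
Qed.

(** * Encoding two consecutive polygons at once *)

Section CodedLevels.
Variables (kap K k : nat).
Let M := (2 ^ (K - k))%N.
Let m := (2 ^ (k - kap))%N.

(** In units of the mesh, a step of length 2^k is at most 2^kap, and the rounding adds 1; the start
    is bounded by 2^K, that is, M * 2^kap + 1 units. *)
Definition level_code : finType := walk_code (M * 2 ^ kap + 1) (2 ^ kap + 1) M.

Definition code_fine (w : level_code) : pred vertex :=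
  inside (fun j => dilate m (decode w j)) M.

Definition code_coarse (w : level_code) : pred vertex :=
  inside (fun j => round_to (2 ^ (k.+1 - kap)) (dilate m (decode w j.*2))) (2 ^ (K - k.+1)).

Lemma card_level_code : (#|level_code| <= 2 ^ (4 * M * (kap + 4)))%N.
Proof.
have M0 : (0 < M)%N by rewrite expn_gt0.
rewrite card_walk_code.
have h1 : ((M * 2 ^ kap + 1).*2.+1 <= 2 ^ (M + kap + 3))%N.
  have : (M < 2 ^ M)%N by exact: ltn_expl.
  have : (0 < 2 ^ kap)%N by rewrite expn_gt0.
  rewrite !expnD; move: (2 ^ kap)%N (2 ^ M)%N => x y x0 hM.
  have : (1 <= M * x)%N by rewrite muln_gt0 M0.
  have : (M * x <= y * x)%N by rewrite leq_mul2r (ltnW hM) orbT.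
  by move: (M * x)%N (y * x)%N => ? ?; lia.
have h2 : ((2 ^ kap + 1).*2.+1 <= 2 ^ (kap + 3))%N.
  have : (0 < 2 ^ kap)%N by rewrite expn_gt0.
  by rewrite expnD; lia.
apply: (@leq_trans (2 ^ (M + kap + 3) * 2 ^ (M + kap + 3) * (2 ^ (kap + 3) * 2 ^ (kap + 3)) ^ M)).
  by rewrite leq_mul ?leq_mul // leq_exp2r // leq_mul.
rewrite -!expnD -expnM -expnD leq_exp2l //.
by nia.
Qed.

Variable phi : nat -> vertex.
Hypothesis kK : (k < K)%N.
Hypothesis phi_step : forall i, ((phi i.+1).1 - (phi i).1) ^+ 2 + ((phi i.+1).2 - (phi i).2) ^+ 2 <= 1.
Hypothesis phi_start : (`|(phi 0%N).1| <= (2 ^ K)%N%:Z) /\ (`|(phi 0%N).2| <= (2 ^ K)%N%:Z).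

Lemma level_code_surj : exists w : level_code,
  level_set phi K kap k = code_fine w /\ level_set phi K kap k.+1 = code_coarse w.
Proof.
have m0 : (0 < m)%N by rewrite expn_gt0.
have skap : (2 ^ k <= 2 ^ kap * m)%N by rewrite -expnD leq_exp2l //; lia.
have divb (x : int) (c : nat) : `|x| <= (c * (2 ^ kap * m))%N%:Z -> `|(x %/ m%:Z)%Z| <= (c * 2 ^ kap + 1)%N%:Z.
  rewrite mulnA => h; have e := divz_eq x m%:Z; have l1 := modz_ge0 x (_ : m%:Z != 0).
  have l2 := @ltz_pmod x m%:Z; move: l1 l2 => /(_ ltac:(lia)) l1 /(_ ltac:(lia)) l2.
  move: e l1 l2 h; move: (x %/ m%:Z)%Z (x %% m%:Z)%Z (c * 2 ^ kap)%N => z r n e l1 l2 h.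
  have h1 : `|z * m%:Z + r| <= n%:Z * m%:Z by rewrite -e -PoszM.
  have [hz|hz] := leP 0 z; last first.
    have : - z * m%:Z <= (n + 1)%N%:Z * m%:Z by nia.
    by rewrite ler_pM2r; lia.
  have : z * m%:Z <= (n + 1)%N%:Z * m%:Z by nia.
  by rewrite ler_pM2r; lia.
have divd (x y : int) : `|y - x| <= (2 ^ kap * m)%N%:Z -> `|(y %/ m%:Z)%Z - (x %/ m%:Z)%Z| <= (2 ^ kap + 1)%N%:Z.
  have e := divz_eq x m%:Z; have l1 := modz_ge0 x (_ : m%:Z != 0).
  have l2 := @ltz_pmod x m%:Z; move: l1 l2 => /(_ ltac:(lia)) l1 /(_ ltac:(lia)) l2.
  have e' := divz_eq y m%:Z; have l1' := modz_ge0 y (_ : m%:Z != 0).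
  have l2' := @ltz_pmod y m%:Z; move: l1' l2' => /(_ ltac:(lia)) l1' /(_ ltac:(lia)) l2'.
  move: e l1 l2 e' l1' l2'; move: (x %/ m%:Z)%Z (x %% m%:Z)%Z (y %/ m%:Z)%Z (y %% m%:Z)%Z (2 ^ kap)%N.
  move=> z r z' r' n -> l1 l2 -> l1' l2'; rewrite PoszM => h.
  have e : z' * m%:Z + r' - (z * m%:Z + r) = (z' - z) * m%:Z + (r' - r) by ring.
  rewrite e in h; move: h; move: (z' - z) => t h.
  have [ht|ht] := leP 0 t; last first.
    have : - t * m%:Z < (n + 1)%N%:Z * m%:Z by nia.
    by rewrite ltr_pM2r; lia.
  have : t * m%:Z < (n + 1)%N%:Z * m%:Z by nia.
  by rewrite ltr_pM2r; lia.
pose g j : vertex := (((phi (j * 2 ^ k)%N).1 %/ m%:Z)%Z, ((phi (j * 2 ^ k)%N).2 %/ m%:Z)%Z).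
have start (x : int) : `|x| <= (2 ^ K)%N%:Z -> `|(x %/ m%:Z)%Z| <= (M * 2 ^ kap + 1)%N%:Z.
  move=> h; apply: divb; apply: le_trans h _; rewrite lez_nat.
  by rewrite -(subnK (ltnW kK)) expnD leq_mul2l skap orbT.
have lip j : (`|(g j.+1).1 - (g j).1| <= (2 ^ kap + 1)%N%:Z) /\ (`|(g j.+1).2 - (g j).2| <= (2 ^ kap + 1)%N%:Z).
  have [l1 l2] := walk_lipschitz phi_step (j * 2 ^ k) (2 ^ k); rewrite addnC -mulSn in l1 l2.
  by split; apply: divd; [apply: le_trans l1 _ | apply: le_trans l2 _]; rewrite lez_nat.
have [w hw] := @decode_surj (M * 2 ^ kap + 1) (2 ^ kap + 1) M g
  (start _ phi_start.1) (start _ phi_start.2) (fun j _ => (lip j).1) (fun j _ => (lip j).2).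
exists w; split; apply/funext => v; apply: eq_bigr => j _.
  rewrite (hw j (ltnW (ltn_ord j))) (hw j.+1 (ltn_ord j)).
  by rewrite /level /round_to /dilate /g /m.
have sub i : (i <= 2 ^ (K - k.+1))%N -> level phi kap k.+1 i =
    round_to (2 ^ (k.+1 - kap)) (dilate m (decode w i.*2)).
  move=> iM; rewrite hw; last first.
    by rewrite /M -(subnSK kK) expnS -mul2n leq_mul2l iM.
  rewrite /level -(@round_to_round_to m); first last.
  - by rewrite dvdn_exp2l //; lia.
  - exact: m0.
  by rewrite /g /dilate /round_to /= -!mul2n !expnS !(mulnCA i) !mulnA.
by rewrite !sub // ltnW.
Qed.
End CodedLevels.

Section FieldBound.
Variables (R : realType) (d : measure_display) (T : measurableType d) (P : probability T R).
Variable h : vertex -> {RV P >-> R}.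
Hypothesis iid : iid_standard_gaussian h.
Variables (N : nat) (F : (vertex -> R) -> R).
Hypothesis Flip : forall eta eta',
  F eta - F eta' <= \sum_(v : box N) `|eta (val v) - eta' (val v)|.
Variables (r a : R) (kap Kmax : nat).
Let eps : R := expR (- r ^+ 2).
Hypothesis r1 : 1 <= r.
Hypothesis a0 : 0 < a.
Hypothesis kap_hi : (2 ^ kap)%N%:R <= expR (2 * r ^+ 2).
Hypothesis kap_lo : 1 <= 2 ^+ kap * a ^+ 2.

Let field w : vertex -> R := fun v => eps * h v w.
Definition slope (k : nat) : R := a + (3 / 4) ^+ k.

Let eps0 : 0 < eps. Proof. exact: expR_gt0. Qed.
Let r0 : 0 < r. Proof. exact: lt_le_trans r1. Qed.

Lemma slope_ge k : a <= slope k.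
Proof. by rewrite lerDl exprn_ge0. Qed.

Lemma slope_gt0 k : 0 < slope k. Proof. exact: lt_le_trans (slope_ge k). Qed.

(** Up to kap the mesh is 1 and 2 * (3/4)^2 = 9/8 >= 1 suffices; beyond, [kap_lo] does. The ratio
    3/4 is below 1 so that the slopes sum to K a + O(1). *)
Lemma slope_round k : (2 ^ (k - kap))%N%:R <= 2 ^+ k * slope k ^+ 2.
Proof.
have q0 : 0 <= (3 / 4 : R) ^+ k by rewrite exprn_ge0.
have [kk|kk] := leqP k kap.
  rewrite (eqP kk) expn0 (@le_trans _ _ (2 ^+ k * ((3 / 4) ^+ k) ^+ 2)) //.
    rewrite -exprM mulnC exprM -exprMn exprn_ege1 //; lra.
  by rewrite ler_pM2l ?exprn_gt0 // lerXn2r ?nnegrE ?(ltW (slope_gt0 _)) // lerDr ltW.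
rewrite natrX -{2}(subnK (ltnW kk)) exprD -mulrA ler_peMr ?exprn_ge0 //.
apply: le_trans kap_lo _; rewrite ler_pM2l ?exprn_gt0 //.
by apply: lerXn2r; rewrite ?nnegrE ?(ltW a0) ?(ltW (slope_gt0 k)) ?slope_ge.
Qed.

Lemma sum_slope K : \sum_(k < K) slope k <= K%:R * a + 4.
Proof.
rewrite big_split /= sumr_const card_ord -[_ *+ K]mulr_natl lerD2l.
have e n : \sum_(k < n) (3 / 4 : R) ^+ k + 4 * (3 / 4) ^+ n = 4.
  elim: n => [|n IH]; first by rewrite big_ord0 expr0; ring.
  by rewrite big_ord_recr /= -[RHS]IH exprS; field.
by rewrite -[leRHS](e K) lerDl mulr_ge0 // exprn_ge0.
Qed.

(* The Chernoff parameter is fixed per scale, so that the union bound involves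
   thresholds affine in the number of flipped sites; [slope] is the typical
   ratio of a second difference to the scale, and the geometric term in it
   absorbs the scales at which rounding has no effect. *)
Definition level_rate k : R := r / (eps * (2 ^+ k * slope k)).
Definition level_entropy K k : R := 28 * 2 ^+ (K - k) * r ^+ 2.

Definition level_bound K k w := forall c : level_code kap K k,
  level_rate k * (F (flip_field (code_fine c) (field w)) - F (flip_field (code_coarse c) (field w)))
  <= 4 * level_rate k ^+ 2 * eps ^+ 2 * (count (fun v => code_coarse c v (+) code_fine c v) (box N))%:R
     + 2 * level_entropy K k.

(** As 2^(kap + 4) <= exp (6 r^2), there are at most exp (24 * 2^(K-k) r^2) codes. The remaining 4
    out of the 28 in [level_entropy] leave exp (- 4 r^2) for the union over the scales. *)
Lemma level_event K k : exists G : set T, [/\ measurable G,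
  (P (~` G) <= (2 * expR (- (4 * r ^+ 2)))%:E)%E & forall w, G w -> level_bound K k w].
Proof.
have M1 : (1 : R) <= 2 ^+ (K - k) by rewrite exprn_ege1 //; lra.
have [|G [mG PG hG]] := @union_event R d T P (level_code kap K k) (2 * expR (- level_entropy K k))
  (fun c w => level_rate k * (F (flip_field (code_fine c) (field w)) - F (flip_field (code_coarse c) (field w)))
  <= 4 * level_rate k ^+ 2 * eps ^+ 2 * (count (fun v => code_coarse c v (+) code_fine c v) (box N))%:R
     + 2 * level_entropy K k).
  move=> c; apply: (pair_event iid).
  - exact: ltW.
  - by rewrite divr_ge0 ?(ltW r0) // mulr_ge0 ?(ltW eps0) // mulr_ge0 ?exprn_ge0 ?ltW ?slope_gt0.
  - by rewrite !mulr_gt0 // exprn_gt0.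
  - exact: Flip.
exists G; split => //; apply: le_trans PG _; rewrite lee_fin mulrCA ler_pM2l //.
apply: (@le_trans _ _ (expR (24 * 2 ^+ (K - k) * r ^+ 2) * expR (- level_entropy K k))).
  rewrite ler_wpM2r ?expR_ge0 //.
  apply: (@le_trans _ _ ((2 ^ (4 * 2 ^ (K - k) * (kap + 4)))%N%:R)); first by rewrite ler_nat card_level_code.
  rewrite mulnC expnM natrX.
  have -> : 24 * 2 ^+ (K - k) * r ^+ 2 = (4 * 2 ^ (K - k))%N%:R * (6 * r ^+ 2).
    by rewrite natrM natrX; ring.
  rewrite expRM_natl lerXn2r ?nnegrE ?expR_ge0 ?ler0n //.
  rewrite expnD natrM; have -> : 6 * r ^+ 2 = 2 * r ^+ 2 + 4 * r ^+ 2 by ring.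
  rewrite expRD ler_pM ?ler0n //.
  rewrite expRM_natl natrX lerXn2r ?nnegrE ?expR_ge0 ?ler0n //.
  have : 1 <= r ^+ 2 by rewrite exprn_ege1.
  have := @expR_ge1Dx R (r ^+ 2); lra.
rewrite -expRD ler_expR /level_entropy; have : 1 * r ^+ 2 <= 2 ^+ (K - k) * r ^+ 2.
  by rewrite ler_wpM2r // sqr_ge0.
lra.
Qed.

Lemma field_event : exists G : set T, [/\ measurable G,
  (P (~` G) <= ((Kmax.+1 * Kmax.+1)%N%:R * (2 * expR (- (4 * r ^+ 2))))%:E)%E &
  forall w, G w -> forall K k, (K <= Kmax)%N -> (k < K)%N -> level_bound K k w].
Proof.
have [|G [mG PG hG]] := @union_event R d T P ('I_Kmax.+1 * 'I_Kmax.+1)%type (2 * expR (- (4 * r ^+ 2)))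
  (fun p w => level_bound p.1 p.2 w).
  by move=> [K k] /=; exact: level_event.
exists G; split => //; first by rewrite card_prod !card_ord in PG.
move=> w Gw K k hK hk.
have hk' : (k < Kmax.+1)%N by rewrite ltnS (leq_trans (ltnW hk)).
exact: (hG w Gw (Ordinal (hK : (K < Kmax.+1)%N), Ordinal hk')).
Qed.

Hypothesis small : r * eps * (152 * (Kmax%:R * a + 4) + 8 / a ^+ 3) <= 1 / 2.

(** Dividing [level_bound] by the rate leaves 4 r eps times the cost of [chain_cost] plus 56 r eps
    2^K times the slope, hence 152 = 4 * 24 + 56 and 8 = 4 * 2. *)
Lemma chain_bound w phi K : (forall k, (k < K)%N -> level_bound K k w) -> (K <= Kmax)%N ->
  (forall i, ((phi i.+1).1 - (phi i).1) ^+ 2 + ((phi i.+1).2 - (phi i).2) ^+ 2 <= 1) ->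
  phi (2 ^ K)%N = phi 0%N ->
  (`|(phi 0%N).1| <= (2 ^ K)%N%:Z) -> (`|(phi 0%N).2| <= (2 ^ K)%N%:Z) ->
  F (flip_field (inside phi (2 ^ K)) (field w)) - F (field w) <= 2 ^+ K / 2.
Proof.
move=> good hK step clo s1 s2.
pose A k := level_set phi K kap k; pose f k := F (flip_field (A k) (field w)).
have -> : F (flip_field (inside phi (2 ^ K)) (field w)) = f 0%N.
  by congr F; apply/funext => v; rewrite /flip_field /A level_set0.
have -> : F (field w) = f K.
  by congr F; apply/funext => v; rewrite /flip_field /A level_setK.
have -> : f 0%N - f K = \sum_(k < K) (f k - f k.+1).
  rewrite -(big_mkord xpredT (fun k => f k - f k.+1)).
  by rewrite (telescope_sumr_eq (fun k => - f k)) // => [|k _]; ring.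
pose D k : R := (count (fun v => A k v (+) A k.+1 v) (box N))%:R.
have step1 (k : 'I_K) : f k - f k.+1 <=
    4 * r * eps * (D k / (2 ^+ k * slope k)) + 56 * r * eps * 2 ^+ K * slope k.
  have [c [e1 e2]] := level_code_surj kap (ltn_ord k) step (conj s1 s2).
  have := good k (ltn_ord k) c; rewrite -e1 -e2 -/(A k) -/(A k.+1) -/(f k) -/(f k.+1).
  rewrite (eq_count (a2 := fun v => A k v (+) A k.+1 v)); last by move=> v; rewrite addbC.
  rewrite -/(D k) /level_entropy => H.
  have t0 : 0 < 2 ^+ k :> R by rewrite exprn_gt0.
  have s0 := slope_gt0 k.
  have l0 : 0 < level_rate k by rewrite divr_gt0 // !mulr_gt0.
  rewrite -(ler_pM2l l0); apply: le_trans H _.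
  have -> : 2 ^+ K = 2 ^+ (K - k) * 2 ^+ k :> R by rewrite -exprD subnK // ltnW.
  rewrite /level_rate le_eqVlt; apply/orP; left; apply/eqP.
  by field; rewrite !gt_eqF.
apply: le_trans (ler_sum _ (fun k _ => step1 k)) _.
rewrite big_split /= -!mulr_sumr.
have cc := @chain_cost phi K kap step clo R (box N) a slope (fset_uniq _) a0 slope_ge slope_round.
have re0 : 0 <= r * eps by rewrite mulr_ge0 ?ltW.
have L0 : 0 <= 2 ^+ K :> R by rewrite exprn_ge0.
apply: (@le_trans _ _ (2 ^+ K * (r * eps * (152 * (\sum_(k < K) slope k) + 8 / a ^+ 3)))).
  have -> : 2 ^+ K * (r * eps * (152 * (\sum_(k < K) slope k) + 8 / a ^+ 3)) =
    4 * r * eps * (24 * 2 ^+ K * (\sum_(k < K) slope k) + 2 * 2 ^+ K / a ^+ 3)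
     + 56 * r * eps * 2 ^+ K * (\sum_(k < K) slope k) by ring.
  by rewrite lerD2r ler_wpM2l // -mulrA mulr_ge0.
rewrite ler_wpM2l // -[leRHS]div1r; apply: le_trans small; rewrite ler_wpM2l // lerD2r ler_pM2l //.
apply: le_trans (sum_slope K) _; rewrite lerD2r ler_wpM2r ?(ltW a0) //.
by rewrite ler_nat.
Qed.

(** Padding to a power of 2 at most doubles the length, which is why [small] asks for 1/2. *)
Lemma contour_field_event : exists G : set T, [/\ measurable G,
  (P (~` G) <= ((Kmax.+1 * Kmax.+1)%N%:R * (2 * expR (- (4 * r ^+ 2))))%:E)%E &
  forall w, G w -> forall L phi, (0 < L)%N -> (L <= 2 ^ Kmax)%N -> phi L = phi 0%N ->
     `|(phi 0%N).1| <= L%:Z -> `|(phi 0%N).2| <= L%:Z ->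
     (forall i, ((phi i.+1).1 - (phi i).1) ^+ 2 + ((phi i.+1).2 - (phi i).2) ^+ 2 <= 1) ->
     F (flip_field (inside phi L) (field w)) <= F (field w) + L%:R].
Proof.
have [G [mG PG hG]] := field_event; exists G; split => // w Gw L phi L0 LK clo s1 s2 step.
(* The padded walk stays at its endpoint after time L; stationary steps do not affect the
   interior. *)
pose K := up_log 2 L; pose psi i := phi (minn i L).
have LK1 : (L <= 2 ^ K)%N by exact: up_logP.
have KK : (K <= Kmax)%N by rewrite /K -[Kmax](@up_expnK 2) // leq_up_log.
have K2 : (2 ^ K <= 2 * L)%N.
  have [L1|L1] := leqP L 1.
    by rewrite /K (_ : L = 1%N) ?up_log1 //; lia.
  have /andP[h1 _] := @up_log_bounds 2 L isT L1.
  have Kp : (0 < K)%N by rewrite up_log_gt0.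
  by rewrite -(prednK Kp) expnS leq_mul2l /= ltnW.
have pstep i : ((psi i.+1).1 - (psi i).1) ^+ 2 + ((psi i.+1).2 - (psi i).2) ^+ 2 <= 1.
  rewrite /psi; have [iL|iL] := ltnP i L; first by rewrite (minn_idPl iL).
  by rewrite (minn_idPr (leqW iL)) !subrr.
have psi0 : psi 0%N = phi 0%N by rewrite /psi min0n.
have pclo : psi (2 ^ K)%N = psi 0%N by rewrite psi0 /psi (minn_idPr LK1).
have pE : inside phi L = inside psi (2 ^ K).
  apply/funext => v; rewrite /inside (big_ord_widen _ (fun j => under (phi j) (phi j.+1) v) LK1).
  rewrite big_mkcond; apply: eq_bigr => j _; rewrite /psi; case: ltnP => jL.
    by rewrite (minn_idPl jL).
  by rewrite (minn_idPr (leqW jL)) under_vertical.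
have sK (x : int) : `|x| <= L%:Z -> `|x| <= (2 ^ K)%N%:Z.
  by move=> hx; apply: le_trans hx _; rewrite lez_nat.
have := @chain_bound w psi K (fun k => hG w Gw K k KK) KK pstep pclo.
rewrite psi0 -pE => /(_ (sK _ s1) (sK _ s2)) H.
have : 2 ^+ K <= 2 * L%:R :> R by rewrite -natrX -natrM ler_nat.
lra.
Qed.
End FieldBound.

(** * Conclusion *)

Section Expectation.
Variables (R : realType) (d : measure_display) (T : measurableType d) (P : probability T R).

(** Derived from the definition of the integral by suprema over simple functions, so as to apply to
    arbitrary functions such as the influence. *)
Lemma integral_monotone (f g : T -> \bar R) : (forall x, (f x <= g x)%E) ->
  (\int[P]_x f x <= \int[P]_x g x)%E.
Proof.
move=> fg; rewrite /integral !patch_setT; apply: leeB; apply: ereal_sup_le => _ [k hk <-];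
  exists k => // x; apply: le_trans (hk x) _.
- exact: (@funepos_le _ _ setT _ _ (fun x _ => fg x) x (mem_set I)).
- exact: (@funeneg_le _ _ setT _ _ (fun x _ => fg x) x (mem_set I)).
Qed.

(** The function is bounded below by 1 - e on G and by -1 elsewhere, so its expectation is at least
    (2 - e) P(G) - 1. *)
Lemma expectation_lower (f : T -> R) (G : set T) (e q : R) : measurable G ->
  (P (~` G) <= q%:E)%E -> 0 <= e -> e <= 1 -> (forall w, G w -> 1 - e <= f w) -> (forall w, -1 <= f w) ->
  ((1 - e - 2 * q)%:E <= 'E_P[f])%E.
Proof.
move=> mG PG e0 e1 fG f1; rewrite unlock.
apply: (@le_trans _ _ (\int[P]_w ((2 - e) * \1_G w - 1)%:E)%E); last first.
  apply: integral_monotone => w; rewrite lee_fin indicE.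
  have [wG|wG] := boolP (w \in G); last by rewrite mulr0 add0r.
  by rewrite mulr1; have := fG w (set_mem wG); lra.
have iG : P.-integrable setT (fun w => (2 - e)%:E * (\1_G w)%:E)%E.
  by apply: integrableZl => //; exact: integrable_indic.
have i1 : P.-integrable setT (EFin \o cst 1) by exact: finite_measure_integrable_cst.
have -> : (\int[P]_w ((2 - e) * \1_G w - 1)%:E = (2 - e)%:E * P G - 1)%E.
  under eq_integral do rewrite EFinB EFinM.
  rewrite (integralB _ iG i1) // integralZl //; last exact: integrable_indic.
  rewrite integral_indic // setIT; congr (_ - _)%E.
  apply: (etrans (integral_cst P measurableT 1%E)).
  by rewrite mul1e; exact: probability_setT.
have PG1 : P G = (1 - fine (P (~` G)))%:E.
  rewrite -[G in LHS]setCK probability_setC; last exact: measurableC.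
  by rewrite EFinB fineK // fin_num_measure //; exact: measurableC.
have : fine (P (~` G)) <= q.
  by rewrite -lee_fin fineK // fin_num_measure //; exact: measurableC.
have : 0 <= fine (P (~` G)) by rewrite fine_ge0.
rewrite PG1 -EFinM -EFinB lee_fin; nra.
Qed.
End Expectation.

Lemma influence_ge (R : realType) (temp : R) N (eta : vertex -> R) (w : R) :
  (forall b, \sum_(s : config N | s [` origin_in_box N]%fset != b) gibbs temp b eta s <= w) ->
  1 - 2 * w <= influence temp N eta.
Proof.
move=> hw; have h1 := hw true; have h2 := hw false; rewrite /influence.
have e1 := gibbs_sum1 temp true N eta; rewrite (bigID (fun s : config N => s [` origin_in_box N]%fset)) /= in e1.
rewrite (eq_bigl (fun s : config N => ~~ s [` origin_in_box N]%fset)) in h1; last by move=> s; case: (s _).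
rewrite (eq_bigl (fun s : config N => s [` origin_in_box N]%fset)) in h2; last by move=> s; case: (s _).
move: e1 h1 h2; lra.
Qed.

Lemma influence_ge_N1 (R : realType) (temp : R) N (eta : vertex -> R) : -1 <= influence temp N eta.
Proof.
rewrite /influence.
have e1 := gibbs_sum1 temp false N eta; rewrite (bigID (fun s : config N => s [` origin_in_box N]%fset)) /= in e1.
have p b (Q : pred (config N)) : 0 <= \sum_(s | Q s) gibbs temp b eta s.
  by apply: sumr_ge0 => s _; exact: gibbs_ge0.
have := p true (fun s : config N => s [` origin_in_box N]%fset).
have := p false (fun s : config N => ~~ s [` origin_in_box N]%fset).
move: e1; lra.
Qed.

Lemma expR1_le4 (R : realType) : expR 1 <= 4 :> R.
Proof.
have e : expR 1 = expR (1 / 2) * expR (1 / 2) :> R by rewrite -expRD; congr expR; field.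
rewrite e; have := @expR_ge1Dx R (- (1 / 2)); have := @expRxMexpNx_1 R (1 / 2).
have := @expR_gt0 R (1/2); nra.
Qed.

Lemma contour_weight_le (R : realType) (temp : R) : 0 <= temp -> contour_weight temp <= temp.
Proof.
move=> t0; rewrite /contour_weight; case: eqVneq => [->//|tn].
have tp : 0 < temp by rewrite lt_def tn.
rewrite expRN -[leRHS]invrK lef_pV2 ?posrE ?invr_gt0 ?expR_gt0 //.
by apply: le_trans (expR_ge1Dx _); rewrite lerDr.
Qed.

Section Conclusion.
Variables (R : realType) (d : measure_display) (T : measurableType d) (P : probability T R).

Lemma expectation_influence (temp q : R) (N Lmax : nat) (eta : T -> vertex -> R) (G : set T) :
  0 <= temp -> 81 * contour_weight temp <= 1 / 2 -> 324 * contour_weight temp <= 1 ->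
  ((N.*2.+1 * N.*2.+1) * (N.+1.*2.+1 * N.+1.*2.+1) <= Lmax)%N ->
  measurable G -> (P (~` G) <= q%:E)%E ->
  (forall w, G w -> forall b L phi, (0 < L)%N -> (L <= Lmax)%N -> phi L = phi 0%N ->
     `|(phi 0%N).1| <= L%:Z -> `|(phi 0%N).2| <= L%:Z ->
     (forall i, ((phi i.+1).1 - (phi i).1) ^+ 2 + ((phi i.+1).2 - (phi i).2) ^+ 2 <= 1) ->
     free_energy temp b N (flip_field (inside phi L) (eta w)) <= free_energy temp b N (eta w) + L%:R) ->
  ((1 - 324 * contour_weight temp - 2 * q)%:E <= 'E_P[fun w => influence temp N (eta w)])%E.
Proof.
move=> t0 c1 c2 hL mG PG good.
have e0 : 0 <= 324 * contour_weight temp.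
  by apply: mulr_ge0; [exact: ler0n | exact: contour_weight_ge0].
apply: (expectation_lower mG PG e0 c2).
- move=> w Gw; have -> : 324 * contour_weight temp = 2 * (162 * contour_weight temp) by ring.
  apply: influence_ge => b; apply: (@peierls _ _ _ _ t0 _ Lmax) => //.
  exact: good.
- by move=> w; exact: influence_ge_N1.
Qed.

Lemma log2_bound (N : nat) (Y : R) : (1 <= N)%N -> N%:R <= expR Y ->
  (up_log 2 N)%:R <= 2 + 2 * Y.
Proof.
move=> N1 hN; set n := up_log 2 N.
have h2 : (2 ^ n <= 2 * N)%N.
  have [NN|NN] := leqP N 1.
    by rewrite /n (_ : N = 1%N) ?up_log1 //; lia.
  have /andP[h1 _] := @up_log_bounds 2 N isT NN.
  have np : (0 < n)%N by rewrite up_log_gt0.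
  by rewrite -(prednK np) expnS leq_mul2l /= ltnW.
have h3 : expR (n%:R / 2) <= 2 ^+ n :> R.
  rewrite expRM_natl lerXn2r ?nnegrE ?expR_ge0 //.
  have := @expR_ge1Dx R (- 2^-1); have := @expRxMexpNx_1 R (2^-1).
  have := @expR_gt0 R (2^-1); nra.
have h4 : 2 <= expR 1 :> R by have := @expR_ge1Dx R 1; lra.
have : expR (n%:R / 2) <= expR (1 + Y).
  apply: le_trans h3 _; rewrite expRD -natrX; apply: (@le_trans _ _ (2 * N%:R)).
    by rewrite -natrM ler_nat.
  by apply: ler_pM.
rewrite ler_expR; lra.
Qed.

Lemma box_size_log (N : nat) : (1 <= N)%N ->
  ((N.*2.+1 * N.*2.+1) * (N.+1.*2.+1 * N.+1.*2.+1) <= 2 ^ (4 * up_log 2 N + 10))%N.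
Proof.
move=> N1; have h : (N <= 2 ^ up_log 2 N)%N by exact: up_logP.
set n := up_log 2 N in h *.
have p : (0 < 2 ^ n)%N by rewrite expn_gt0.
have -> : (4 * n + 10 = (n + 2 + (n + 2)) + (n + 3 + (n + 3)))%N by lia.
rewrite (expnD 2 (_ + _)) (expnD 2 (n + 2)) (expnD 2 (n + 3)).
by rewrite !leq_mul // expnD; move: (2 ^ n)%N h p => z ? ?; lia.
Qed.
End Conclusion.

(** * Numerical constants, with x = eps^(1/3) and r^2 = log (1/eps) *)

Section Constants.
Variables (R : realType) (m x r y0 c : R).
Hypothesis y0E : y0 = (1 - m) / 100 / 100 / 100.
Hypothesis cy : c <= y0.
Hypothesis m01 : 0 < m < 1.
Hypothesis x0 : 0 < x.
Hypothesis xy : x <= y0.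
Hypothesis r0 : 0 <= r.
Hypothesis xr : x ^+ 3 = expR (- r ^+ 2).

Lemma y0_lt : 0 < y0 /\ y0 * 100 * 100 * 100 <= 1.
Proof. by rewrite y0E; move: m01 => /andP[? ?]; split; lra. Qed.

Lemma r_ge1 : 1 <= r.
Proof.
have [_ h] := y0_lt; have x1 : x <= 1 / 4 by have := xy; lra.
have : expR (- r ^+ 2) <= expR (- 1).
  rewrite -xr expRN; apply: (@le_trans _ _ (4^-1)); last by rewrite lef_pV2 ?posrE ?expR_gt0 ?expR1_le4.
  by have := x0; rewrite !exprS expr0; nra.
by rewrite ler_expR lerN2 => h2; rewrite leNgt; apply/negP => h3; have := r0; nra.
Qed.

Lemma r2x_le : r ^+ 2 * x <= 3.
Proof.
have h : r ^+ 2 = 3 * ln x^-1.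
  have : ln (x ^+ 3) = - r ^+ 2 by rewrite xr expRK.
  by rewrite lnXn // lnV ?posrE // -mulr_natl; lra.
have : ln x^-1 <= x^-1 by apply/ltW; apply: ln_sublinear; rewrite invr_gt0.
by rewrite h -(ler_pM2r x0) mulVf ?gt_eqF //; lra.
Qed.

Let a : R := 8 * x * r.

(** Y is the exponent in the claimed bound. With the chosen [a], the term in K becomes a multiple of
    K eps^(4/3) log (1/eps), and r x^3 * 8 / a^3 becomes 1 / (64 r^2). *)
Lemma field_small (Y K : R) : 0 <= Y -> Y * (x ^+ 4 * r ^+ 2) <= c -> K <= 18 + 8 * Y ->
  r * expR (- r ^+ 2) * (152 * (K * a + 4) + 8 / a ^+ 3) <= 1 / 2.
Proof.
move=> Y0 hY hK; have [y1 y2] := y0_lt; have r1 := r_ge1; have h := r2x_le; have x0' := x0; have xy' := xy; have cy' := cy.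
have rp : 0 < r by lra.
rewrite -xr.
have -> : r * x ^+ 3 * (152 * (K * a + 4) + 8 / a ^+ 3) =
  1216 * (K * (x ^+ 4 * r ^+ 2)) + 608 * (r * x ^+ 3) + 1 / (64 * r ^+ 2).
  by rewrite /a; field; rewrite !gt_eqF.
have t1 : x ^+ 4 * r ^+ 2 <= 3 * x.
  have -> : x ^+ 4 * r ^+ 2 = x ^+ 3 * (r ^+ 2 * x) by ring.
  have : x ^+ 3 <= x by rewrite !exprS expr0; nra.
  have : 0 <= x ^+ 3 by rewrite exprn_ge0 // ltW.
  by have := sqr_ge0 r; nra.
have t2 : K * (x ^+ 4 * r ^+ 2) <= 18 * (3 * x) + 8 * c.
  have : 0 <= x ^+ 4 * r ^+ 2 by rewrite mulr_ge0 ?sqr_ge0 // exprn_ge0 // ltW.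
  nra.
have t3 : r * x ^+ 3 <= 3 * x.
  have e : r * x ^+ 3 <= r ^+ 2 * x * x ^+ 2.
    have -> : r ^+ 2 * x * x ^+ 2 = r ^+ 2 * x ^+ 3 by ring.
    by rewrite ler_wpM2r ?exprn_ge0 ?(ltW x0) // expr2 ler_peMl // ltW.
  apply: le_trans e _; rewrite expr2; nra.
have t4 : 1 / (64 * r ^+ 2) <= 1 / 64.
  by rewrite ler_pM2l // lef_pV2 ?posrE ?mulr_gt0 ?exprn_gt0 // ler_peMr // exprn_ege1.
lra.
Qed.

(** The exponential is x^12: eight powers of x make K^2 bounded, and the other four are small. *)
Lemma probability_small (Y K : R) : 0 <= Y -> Y * (x ^+ 4 * r ^+ 2) <= c -> 0 <= K -> K <= 19 + 8 * Y ->
  4 * (K ^+ 2 * expR (- (4 * r ^+ 2))) <= (1 - m) / 8.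
Proof.
move=> Y0 hY K0 hK; have [y1 y2] := y0_lt; have r1 := r_ge1; have x0' := x0; have xy' := xy; have cy' := cy.
have -> : expR (- (4 * r ^+ 2)) = (x ^+ 4) ^+ 2 * x ^+ 4.
  by rewrite -mulrN expRM_natl -xr -!exprM -exprD.
have x4 : x ^+ 4 <= x.
  by rewrite exprS ler_piMr ?(ltW x0) // exprn_ile1 ?(ltW x0) //; lra.
have p4 : 0 <= x ^+ 4 by rewrite exprn_ge0 // ltW.
have Yx : Y * x ^+ 4 <= 1.
  have : Y * x ^+ 4 <= Y * (x ^+ 4 * r ^+ 2).
    by rewrite ler_wpM2l // ler_peMr // exprn_ege1.
  lra.
have Kx : K * x ^+ 4 <= 27 by nra.
have -> : K ^+ 2 * ((x ^+ 4) ^+ 2 * x ^+ 4) = (K * x ^+ 4) ^+ 2 * x ^+ 4 by ring.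
have : (K * x ^+ 4) ^+ 2 <= 27 ^+ 2.
  by rewrite lerXn2r ?nnegrE // mulr_ge0.
move: xy; rewrite y0E; nra.
Qed.
End Constants.

Lemma pow2_between (R : realType) (z : R) : 1 <= z ->
  exists k : nat, z <= 2 ^+ k /\ 2 ^+ k <= 2 * z.
Proof.
move=> z1.
have ex : exists k : nat, z <= 2 ^+ k.
  exists (Num.bound z); apply: (@le_trans _ _ (Num.bound z)%:R).
    by apply/ltW/archi_boundP; lra.
  by rewrite -natrX ler_nat ltnW // ltn_expl.
have := ex_minnP ex; case: ex_minnP => -[|k] hk mink _.
  by exists 0%N; split => //; rewrite expr0; lra.
exists k.+1; split => //; rewrite exprS ler_pM2l // leNgt; apply/negP => h.
by have := mink _ (ltW h); rewrite ltnn.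
Qed.

Lemma zero_field_magnetization (R : realType) (m : R) (d : measure_display) (T : measurableType d)
    (P : probability T R) (h : vertex -> {RV P >-> R}) (temp : R) (N : nat) :
  0 <= temp -> 81 * contour_weight temp <= 1 / 2 -> 324 * contour_weight temp <= 1 ->
  m < 1 - 324 * contour_weight temp ->
  (m%:E < 'E_P[fun w => influence temp N (fun v => 0 * h v w)%R])%E.
Proof.
move=> t0 c1 c2 hm.
apply: (@lt_le_trans _ _ (1 - 324 * contour_weight temp - 2 * 0)%:E); first by rewrite lte_fin mulr0 subr0.
apply: (expectation_influence (G := setT) (Lmax := ((N.*2.+1 * N.*2.+1) * (N.+1.*2.+1 * N.+1.*2.+1))%N)) => //.
  by rewrite setCT measure0.
move=> w _ b L phi L0 _ _ _ _ _.
rewrite (_ : flip_field _ _ = (fun v => 0 * h v w)); first by rewrite lerDl.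
by apply/funext => v; rewrite /flip_field mul0r oppr0; case: ifP.
Qed.

Lemma magnetization_lower (R : realType) (m y0 c : R) (d : measure_display) (T : measurableType d)
    (P : probability T R) (h : vertex -> {RV P >-> R}) (temp eps : R) (N : nat) :
  0 < m < 1 -> y0 = (1 - m) / 100 / 100 / 100 -> c = y0 ^+ 3 ->
  iid_standard_gaussian h -> 0 <= temp <= c -> 0 <= eps <= c -> (1 <= N)%N ->
  (eps != 0 -> N%:R < expR (c * (eps `^ (- (4 / 3))) / ln (1 / eps))) ->
  (m%:E < 'E_P[fun w => influence temp N (fun v => eps * h v w)%R])%E.
Proof.
move=> m01 y0E cE iid /andP[t0 tc] /andP[e0 ec] N1 hN.
have [y1 y2] := y0_lt y0E m01; have /andP[m0 m1] := m01.
have y2' : y0 <= 1 by lra.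
have cy : c <= y0 by rewrite cE exprS ler_piMr ?(ltW y1) // exprn_ile1 // ltW.
have cw := contour_weight_le t0; have cw0 := contour_weight_ge0 temp.
have c1 : 81 * contour_weight temp <= 1 / 2 by lra.
have c2 : 324 * contour_weight temp <= 1 by lra.
have c3 : 324 * contour_weight temp <= (1 - m) / 8 by lra.
have [eps_eq0|epsn] := eqVneq eps 0.
  by rewrite eps_eq0; apply: zero_field_magnetization => //; lra.
have ep : 0 < eps by rewrite lt_def epsn.
pose x := eps `^ 3^-1; have x0 : 0 < x by rewrite powR_gt0.
have xE : x ^+ 3 = eps.
  by rewrite /x -powR_mulrn ?powR_ge0 // -powRrM mulVf // powRr1.
have x4 : eps `^ (- (4 / 3)) = (x ^+ 4)^-1.
  by rewrite powRN /x -powR_mulrn ?powR_ge0 // -powRrM mulrC.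
have xy : x <= y0.
  by rewrite -(@ler_pXn2r _ 3) ?nnegrE ?(ltW x0) ?(ltW y1) // xE -cE.
pose r := Num.sqrt (ln (1 / eps)).
have lnE : ln (1 / eps) = - ln eps by rewrite div1r lnV.
have r2 : r ^+ 2 = ln (1 / eps) by rewrite sqr_sqrtr // lnE oppr_ge0 ln_le0 //; lra.
have r0 : 0 <= r by exact: sqrtr_ge0.
have xr : x ^+ 3 = expR (- r ^+ 2) by rewrite r2 lnE opprK lnK.
have epsE : eps = expR (- r ^+ 2) by rewrite -xr xE.
have r1 := r_ge1 y0E m01 x0 xy r0 xr.
have rp : 0 < r by lra.
pose a := 8 * x * r; have a0 : 0 < a by rewrite !mulr_gt0.
pose Y := c * (x ^+ 4)^-1 / r ^+ 2.
have cge0 : 0 <= c by rewrite cE exprn_ge0 // ltW.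
have Y0 : 0 <= Y by rewrite !mulr_ge0 // ?invr_ge0 ?exprn_ge0 // ltW.
have Yc : Y * (x ^+ 4 * r ^+ 2) <= c.
  by rewrite /Y le_eqVlt; apply/orP; left; apply/eqP; field; rewrite !gt_eqF.
have {}hN : N%:R <= expR Y by apply/ltW; move: (hN epsn); rewrite x4 -r2.
pose Kmax := (4 * up_log 2 N + 10)%N.
have hK : Kmax%:R <= 18 + 8 * Y.
  by rewrite /Kmax natrD natrM; have := log2_bound N1 hN; lra.
(* This makes 2^(-kap) equal to eps up to a factor 2. *)
have [kap [kap1 kap2]] : exists k : nat, expR (r ^+ 2) <= 2 ^+ k /\ 2 ^+ k <= 2 * expR (r ^+ 2).
  by apply: pow2_between; rewrite -expR0 ler_expR sqr_ge0.
have r21 : 1 <= r ^+ 2 by rewrite exprn_ege1.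
have kap_hi : (2 ^ kap)%N%:R <= expR (2 * r ^+ 2).
  rewrite natrX; apply: le_trans kap2 _; have -> : 2 * r ^+ 2 = r ^+ 2 + r ^+ 2 by ring.
  by rewrite expRD ler_wpM2r ?expR_ge0 //; have := expR_ge1Dx (r ^+ 2); lra.
have kap_lo : 1 <= 2 ^+ kap * a ^+ 2.
  apply: (@le_trans _ _ (expR (r ^+ 2) * a ^+ 2)); last by rewrite ler_wpM2r ?sqr_ge0.
  rewrite -ler_pdivrMl ?expR_gt0 // mulr1 -expRN -xr.
  have -> : a ^+ 2 = 64 * r ^+ 2 * x ^+ 2 by rewrite /a; ring.
  rewrite exprS ler_wpM2r ?sqr_ge0 //; lra.
have small := field_small y0E cy m01 x0 xy r0 xr Y0 Yc hK.
have K0 : 0 <= Kmax.+1%:R :> R by rewrite ler0n.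
have hK1 : Kmax.+1%:R <= 19 + 8 * Y by rewrite -natr1; lra.
have psmall := probability_small y0E cy m01 x0 xy r0 xr Y0 Yc K0 hK1.
pose Q (b : bool) (w : T) := forall L phi, (0 < L)%N -> (L <= 2 ^ Kmax)%N -> phi L = phi 0%N ->
     `|(phi 0%N).1| <= L%:Z -> `|(phi 0%N).2| <= L%:Z ->
     (forall i, ((phi i.+1).1 - (phi i).1) ^+ 2 + ((phi i.+1).2 - (phi i).2) ^+ 2 <= 1) ->
     free_energy temp b N (flip_field (inside phi L) (fun v => expR (- r ^+ 2) * h v w))
     <= free_energy temp b N (fun v => expR (- r ^+ 2) * h v w) + L%:R.
have [|G [mG PG hG]] := @union_event R d T P bool
  ((Kmax.+1 * Kmax.+1)%N%:R * (2 * expR (- (4 * r ^+ 2)))) Q.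
  move=> b.
  have H := @contour_field_event R d T P h iid N (free_energy temp b N) (free_energy_lipschitz b N t0) r a kap Kmax r1 a0 kap_hi kap_lo small.
  exact: H.
rewrite epsE.
(* The two boundary signs and the factor 2 of [pair_event] make the 4 of [probability_small]. Of the
   margin 1 - m, the temperature takes at most 1/8 and the bad event at most 1/4. *)
apply: (@lt_le_trans _ _ (1 - 324 * contour_weight temp
   - 2 * (#|{: bool}|%:R * ((Kmax.+1 * Kmax.+1)%N%:R * (2 * expR (- (4 * r ^+ 2))))))%:E).
  rewrite lte_fin card_bool natrM.
  have -> : 2%:R * (Kmax.+1%:R * Kmax.+1%:R * (2 * expR (- (4 * r ^+ 2)))) =
    4 * (Kmax.+1%:R ^+ 2 * expR (- (4 * r ^+ 2))) :> R by ring.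
  lra.
apply: (expectation_influence (G := G) (Lmax := (2 ^ Kmax)%N)) => //; exact: box_size_log.
Qed.

Theorem theorem1p2 (R : realType) (m : R) (m_gt0 : 0 < m) (m_lt1 : m < 1) :
  exists2 c : R, 0 < c &
    forall (d : measure_display) (T : measurableType d) (P : probability T R)
           (h : vertex -> {RV P >-> R}),
      iid_standard_gaussian h ->
      forall temp eps : R,
        0 <= temp <= c -> 0 <= eps <= c ->
        ((if eps == 0%R then +oo
          else (expR (c * (eps `^ (- (4 / 3))) / ln (1 / eps))%R)%:E)
         <= correlation_length h temp m eps)%E.
Proof.
have m01 : 0 < m < 1 by rewrite m_gt0.
pose y0 : R := (1 - m) / 100 / 100 / 100.
have [y1 _] := y0_lt (erefl y0) m01.
(* The cube, because the smallness needed is that of eps^(1/3). *)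
exists (y0 ^+ 3); first by rewrite exprn_gt0.
move=> d T P h iid temp eps ht he.
have low := magnetization_lower m01 (erefl y0) (erefl (y0 ^+ 3)) iid ht he.
rewrite /correlation_length /min_or_infty; case: pselect => [exN|_]; last exact: leey.
case: ex_minnP => N; rewrite inE /= => -[N1 hN] _.
case: eqVneq => [e0|en].
  by have := low N N1; rewrite e0 eqxx => /(_ (fun f => False_ind _ (notF f))); rewrite -e0 ltNge hN.
rewrite lee_fin leNgt; apply/negP => hlt.
by have := low N N1 (fun _ => hlt); rewrite ltNge hN.
Qed.
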